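(* Let $M$ be a compact orientable 2-manifold with Riemannian metric $g_{[0]}$ admitting a global chart $\varphi:M\to D=\{(u^1,u^2):u^1\in I,\ -B(u^1)\le u^2\le B(u^1)\}$ ($I$ a closed interval, $B:I\to\mathbb{R}_{>0}$) such that $g_{[0]ij}=\delta_{ij}$ on the center curve $\{u^2=0\}$ and each curve $u^1=\mathrm{const}$ is a $g_{[0]}$-geodesic with unit tangent $\partial/\partial u^2$. For $0<\beta\le1$ let $D_\beta=\{(u^1,u^2):u^1\in I,\ |u^2|\le\beta B(u^1)\}$ and $M_{[0]\beta}=(\varphi^{-1}(D_\beta),g_{[0]}|)$, and use normalized coordinates $(s,r)\in I\times[-1,1]$ with $u^1=s$, $u^2=\beta B(s)r$. Let the stiffness tensor be isotropic, $C^{ijkl}=\lambda g_{[0]}^{*ij}g_{[0]}^{*kl}+\mu(g_{[0]}^{*ik}g_{[0]}^{*jl}+g_{[0]}^{*il}g_{[0]}^{*jk})$, with constant Lamé parameters corresponding to Young's modulus $Y$ and Poisson's ratio $\nu$. For each $\beta$ let $\Phi_\beta:M_{[0]\beta}\to\mathbb{E}^2$ be a smooth embedding minimizing the strain energy $W=\int_{M_{[0]\beta}}\tfrac12C^{ijkl}E_{\beta ij}E_{\beta kl}\,\upsilon_{[0]}$, where $E_\beta=\tfrac12(\Phi_\beta^*(\text{Euclidean metric})-g_{[0]})$, with minimizers assumed to exist and to depend smoothly on $\beta$. Let $S_\beta=C(E_\beta,\cdot)$ be the second Piola–Kirchhoff stress. Then, with components taken in the $g_{[0]}$-orthonormal frame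 $e_1=g_{[0]11}^{-1/2}\partial/\partial u^1$, $e_2=\partial/\partial u^2$ and evaluated at $(s,r)$, as $\beta\to0^+$: (i) $S_\beta^{12},S_\beta^{21},S_\beta^{22}\in O(\beta^3)$ (approximately $u^1$-directional uniaxial stress); (ii) $E_{\beta11}\in\tfrac12K_{[0]}(s)\,(\beta B(s))^2\big(r^2-\tfrac13\big)+O(\beta^3)$ and $E_{\beta22}\in-\nu E_{\beta11}+O(\beta^3)$, where $K_{[0]}(s)$ is the Gaussian curvature of $g_{[0]}$ at the center-curve point $(u^1,u^2)=(s,0)$.
   Context: Lamé parameters in dimension 2: $\lambda=\nu Y/((1+\nu)(1-\nu))$, $\mu=Y/(2(1+\nu))$. $g_{[0]}^{*}$ is the dual (inverse) metric. Minimization is over smooth embeddings of $M_{[0]\beta}$ into the Euclidean plane (the strain energy is invariant under rigid motions). $O(\beta^k)$ is for fixed $(s,r)$ as $\beta\to0^+$. *)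

(* Defs.v *)
From Stdlib Require Import Reals Lra List.
From Coquelicot Require Import Coquelicot.
Open Scope R_scope.

(* ---------- smoothness (C^infinity up to the boundary = on an open neighbourhood) ---------- *)

Definition smooth1_on (S : R -> Prop) (f : R -> R) : Prop :=
  exists U : R -> Prop, open U /\ (forall x, S x -> U x) /\
    forall (n : nat) x, U x -> ex_derive (Derive_n f n) x.

Definition pd2 (d : nat) (f : R -> R -> R) : R -> R -> R :=
  fun x y => if Nat.eqb d 0 then Derive (fun t => f t y) x
             else Derive (fun t => f x t) y.

Fixpoint dpart2 (l : list nat) (f : R -> R -> R) : R -> R -> R :=
  match l with nil => f | d :: l' => pd2 d (dpart2 l' f) end.

Definition smooth2_on (S : R -> R -> Prop) (f : R -> R -> R) : Prop :=
  exists U : R * R -> Prop, open U /\ (forall x y, S x y -> U (x, y)) /\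
    forall (l : list nat) x y, U (x, y) ->
      continuous (fun p : R * R => dpart2 l f (fst p) (snd p)) (x, y) /\
      ex_derive (fun t => dpart2 l f t y) x /\
      ex_derive (fun t => dpart2 l f x t) y.

Definition pd3 (d : nat) (f : R -> R -> R -> R) : R -> R -> R -> R :=
  fun x y z => if Nat.eqb d 0 then Derive (fun t => f t y z) x
               else if Nat.eqb d 1 then Derive (fun t => f x t z) y
               else Derive (fun t => f x y t) z.

Fixpoint dpart3 (l : list nat) (f : R -> R -> R -> R) : R -> R -> R -> R :=
  match l with nil => f | d :: l' => pd3 d (dpart3 l' f) end.

Definition smooth3_on (S : R -> R -> R -> Prop) (f : R -> R -> R -> R) : Prop :=
  exists U : R * (R * R) -> Prop, open U /\
    (forall x y z, S x y z -> U (x, (y, z))) /\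
    forall (l : list nat) x y z, U (x, (y, z)) ->
      continuous (fun p : R * (R * R) =>
                    dpart3 l f (fst p) (fst (snd p)) (snd (snd p))) (x, (y, z)) /\
      ex_derive (fun t => dpart3 l f t y z) x /\
      ex_derive (fun t => dpart3 l f x t z) y /\
      ex_derive (fun t => dpart3 l f x y t) z.

(* ---------- index sums (indices 0,1 stand for 1,2 in the paper) ---------- *)
Definition sum2 (f : nat -> R) : R := f 0%nat + f 1%nat.

Definition InD (a b : R) (B : R -> R) (u1 u2 : R) : Prop :=
  a <= u1 <= b /\ - B u1 <= u2 <= B u1.

Definition InDbeta (a b : R) (B : R -> R) (beta u1 u2 : R) : Prop :=
  a <= u1 <= b /\ Rabs u2 <= beta * B u1.

Definition gm (g11 g12 g22 : R -> R -> R) (i j : nat) : R -> R -> R :=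
  match i, j with
  | 0%nat, 0%nat => g11
  | 1%nat, 1%nat => g22
  | _, _ => g12
  end.

Definition detg (g11 g12 g22 : R -> R -> R) (x y : R) : R :=
  g11 x y * g22 x y - g12 x y ^ 2.

Definition ginv (g11 g12 g22 : R -> R -> R) (i j : nat) (x y : R) : R :=
  match i, j with
  | 0%nat, 0%nat => g22 x y / detg g11 g12 g22 x y
  | 1%nat, 1%nat => g11 x y / detg g11 g12 g22 x y
  | _, _ => - g12 x y / detg g11 g12 g22 x y
  end.

Definition Gam (g11 g12 g22 : R -> R -> R) (k i j : nat) (x y : R) : R :=
  / 2 * sum2 (fun l => ginv g11 g12 g22 k l x y *
     (pd2 i (gm g11 g12 g22 l j) x y + pd2 j (gm g11 g12 g22 l i) x y
      - pd2 l (gm g11 g12 g22 i j) x y)).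

(* R^l_{212} (paper indices), R(d1,d2)d2 = R^l_{212} d_l *)
Definition Riem (g11 g12 g22 : R -> R -> R) (l : nat) (x y : R) : R :=
  pd2 0 (Gam g11 g12 g22 l 1 1) x y - pd2 1 (Gam g11 g12 g22 l 0 1) x y
  + sum2 (fun m => Gam g11 g12 g22 l 0 m x y * Gam g11 g12 g22 m 1 1 x y
                 - Gam g11 g12 g22 l 1 m x y * Gam g11 g12 g22 m 0 1 x y).

(* Gaussian curvature K = g(R(d1,d2)d2, d1) / det g *)
Definition gaussK (g11 g12 g22 : R -> R -> R) (x y : R) : R :=
  sum2 (fun l => gm g11 g12 g22 0 l x y * Riem g11 g12 g22 l x y)
  / detg g11 g12 g22 x y.

Definition is_geodesic (g11 g12 g22 : R -> R -> R) (c1 c2 : R -> R) (t0 t1 : R) : Prop :=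
  let c := fun i : nat => if Nat.eqb i 0 then c1 else c2 in
  forall t, t0 <= t <= t1 -> forall k : nat, (k < 2)%nat ->
    Derive_n (c k) 2 t
    + sum2 (fun i => sum2 (fun j => Gam g11 g12 g22 k i j (c1 t) (c2 t)
                                   * Derive (c i) t * Derive (c j) t)) = 0.

Definition unit_speed (g11 g12 g22 : R -> R -> R) (c1 c2 : R -> R) (t0 t1 : R) : Prop :=
  let c := fun i : nat => if Nat.eqb i 0 then c1 else c2 in
  forall t, t0 <= t <= t1 ->
    sum2 (fun i => sum2 (fun j => gm g11 g12 g22 i j (c1 t) (c2 t)
                               * Derive (c i) t * Derive (c j) t)) = 1.

Definition chart_hyp (a b : R) (B : R -> R) (g11 g12 g22 : R -> R -> R) : Prop :=
  a < b /\
  smooth1_on (fun x => a <= x <= b) B /\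
  (forall x, a <= x <= b -> 0 < B x) /\
  smooth2_on (InD a b B) g11 /\ smooth2_on (InD a b B) g12 /\
  smooth2_on (InD a b B) g22 /\
  (forall x y, InD a b B x y -> 0 < g11 x y /\ 0 < detg g11 g12 g22 x y) /\
  (forall s, a <= s <= b -> g11 s 0 = 1 /\ g12 s 0 = 0 /\ g22 s 0 = 1) /\
  (forall c, a <= c <= b ->
     is_geodesic g11 g12 g22 (fun _ => c) (fun t => t) (- B c) (B c) /\
     unit_speed g11 g12 g22 (fun _ => c) (fun t => t) (- B c) (B c)).

Definition lame_lambda (Y nu : R) : R := nu * Y / ((1 + nu) * (1 - nu)).
Definition lame_mu (Y nu : R) : R := Y / (2 * (1 + nu)).

Definition Cst (Y nu : R) (g11 g12 g22 : R -> R -> R) (i j k l : nat) (x y : R) : R :=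
  let gi := ginv g11 g12 g22 in
  lame_lambda Y nu * gi i j x y * gi k l x y
  + lame_mu Y nu * (gi i k x y * gi j l x y + gi i l x y * gi j k x y).

Definition strain (g11 g12 g22 : R -> R -> R) (Phi1 Phi2 : R -> R -> R)
  (i j : nat) (x y : R) : R :=
  / 2 * (pd2 i Phi1 x y * pd2 j Phi1 x y + pd2 i Phi2 x y * pd2 j Phi2 x y
         - gm g11 g12 g22 i j x y).

Definition stress (Y nu : R) (g11 g12 g22 : R -> R -> R) (Phi1 Phi2 : R -> R -> R)
  (i j : nat) (x y : R) : R :=
  sum2 (fun k => sum2 (fun l =>
    Cst Y nu g11 g12 g22 i j k l x y * strain g11 g12 g22 Phi1 Phi2 k l x y)).

Definition energy_density (Y nu : R) (g11 g12 g22 : R -> R -> R)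
  (Phi1 Phi2 : R -> R -> R) (x y : R) : R :=
  / 2 * sum2 (fun i => sum2 (fun j => sum2 (fun k => sum2 (fun l =>
    Cst Y nu g11 g12 g22 i j k l x y
    * strain g11 g12 g22 Phi1 Phi2 i j x y * strain g11 g12 g22 Phi1 Phi2 k l x y)))).

Definition strain_energy (a b : R) (B : R -> R) (beta Y nu : R)
  (g11 g12 g22 : R -> R -> R) (Phi1 Phi2 : R -> R -> R) : R :=
  RInt (fun u1 => RInt (fun u2 =>
          energy_density Y nu g11 g12 g22 Phi1 Phi2 u1 u2
          * sqrt (detg g11 g12 g22 u1 u2))
        (- (beta * B u1)) (beta * B u1)) a b.

Definition is_embedding (a b : R) (B : R -> R) (beta : R) (Phi1 Phi2 : R -> R -> R) : Prop :=
  smooth2_on (InDbeta a b B beta) Phi1 /\ smooth2_on (InDbeta a b B beta) Phi2 /\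
  (forall x y x' y', InDbeta a b B beta x y -> InDbeta a b B beta x' y' ->
     Phi1 x y = Phi1 x' y' -> Phi2 x y = Phi2 x' y' -> x = x' /\ y = y') /\
  (forall x y, InDbeta a b B beta x y ->
     pd2 0 Phi1 x y * pd2 1 Phi2 x y - pd2 1 Phi1 x y * pd2 0 Phi2 x y <> 0).

(* for every beta in (0,1], (Phi1 beta, Phi2 beta) is an energy-minimising smooth
   embedding, and the minimisers depend smoothly on beta: in normalised coordinates
   (beta, s, r) |-> Phi_beta(s, beta B(s) r) extends smoothly to [0,1] x I x [-1,1] *)
Definition minimizer_family (a b : R) (B : R -> R) (Y nu : R) (g11 g12 g22 : R -> R -> R)
  (Phi1 Phi2 : R -> R -> R -> R) : Prop :=
  (forall beta, 0 < beta <= 1 ->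
     is_embedding a b B beta (Phi1 beta) (Phi2 beta) /\
     forall Psi1 Psi2 : R -> R -> R, is_embedding a b B beta Psi1 Psi2 ->
       strain_energy a b B beta Y nu g11 g12 g22 (Phi1 beta) (Phi2 beta)
       <= strain_energy a b B beta Y nu g11 g12 g22 Psi1 Psi2) /\
  (exists F1 F2 : R -> R -> R -> R,
     let S := fun be s r => 0 <= be <= 1 /\ a <= s <= b /\ -1 <= r <= 1 in
     smooth3_on S F1 /\ smooth3_on S F2 /\
     forall be s r, 0 < be <= 1 -> a <= s <= b -> -1 <= r <= 1 ->
       F1 be s r = Phi1 be s (be * B s * r) /\ F2 be s r = Phi2 be s (be * B s * r)).

(* e_a = sum_i P a i d_i ; d_i = sum_a Q i a e_a *)
Definition frameP (g11 : R -> R -> R) (a i : nat) (x y : R) : R :=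
  match a, i with
  | 0%nat, 0%nat => / sqrt (g11 x y)
  | 1%nat, 1%nat => 1
  | _, _ => 0
  end.
Definition frameQ (g11 : R -> R -> R) (i a : nat) (x y : R) : R :=
  match i, a with
  | 0%nat, 0%nat => sqrt (g11 x y)
  | 1%nat, 1%nat => 1
  | _, _ => 0
  end.

Definition strain_fr (g11 g12 g22 : R -> R -> R) (Phi1 Phi2 : R -> R -> R)
  (p q : nat) (x y : R) : R :=
  sum2 (fun i => sum2 (fun j => frameP g11 p i x y * frameP g11 q j x y
                               * strain g11 g12 g22 Phi1 Phi2 i j x y)).

Definition stress_fr (Y nu : R) (g11 g12 g22 : R -> R -> R) (Phi1 Phi2 : R -> R -> R)
  (p q : nat) (x y : R) : R :=
  sum2 (fun i => sum2 (fun j => frameQ g11 i p x y * frameQ g11 j q x y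
                               * stress Y nu g11 g12 g22 Phi1 Phi2 i j x y)).

Definition bigO0 (f : R -> R) (k : nat) : Prop :=
  exists C delta, 0 < delta /\ forall beta, 0 < beta < delta -> Rabs (f beta) <= C * beta ^ k.

(* Main.v *)
From Stdlib Require Import Reals Lra Lia List Classical ClassicalEpsilon FunctionalExtensionality.
From Coquelicot Require Import Coquelicot.
Require Import Defs.
Import ListNotations.
Open Scope R_scope.

(** Since the curves u^1 = const are unit-speed geodesics and the metric is Euclidean on the center
    curve, g = G (du^1)^2 + (du^2)^2 with K = - G_yy / 2 + G_y^2 / 4 on u^2 = 0.  The identity of the
    chart is a competitor of energy O(beta^3), which forces E_beta = O(beta).  No better competitor is
    used: a strip of strain O(beta^2) may overlap itself, hence fail to be an embedding.  Instead, a
    small multiple of any smooth field may be added to a minimizer without losing injectivity, so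
    that the Euler-Lagrange equation holds in weak form.  Fields depending on u^1 only, cut-off
    infinitesimal rotations, and monomials in u^2 give respectively: zero axial force, zero bending
    moment, and vanishing of S^12 and S^22, all at the leading order beta^k of the strain.  Hence the
    leading coefficient e of E_11 satisfies int e dr = int e r dr = 0 and E_22 = - nu E_11.  Expanding
    the embedding in beta shows that e is affine in r for k = 1, so that it vanishes, and that its
    second derivative in r is K B^2 for k = 2, which leaves K B^2 (r^2 - 1/3) / 2. *)

(** * Compactness, relative continuity, and vanishing moments *)

(** The weak equation yields integral identities, whereas pointwise orders are wanted. Smooth
    dependence on [beta] bridges the gap: the strains have Taylor coefficients in [beta] that are
    continuous in (s, r), and these are identified one at a time. A lateral derivative costs a
    factor 1/[beta] against an axial one, so in the balance tested with u1^m u2^(n+1) the column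
    S^12, S^22 dominates, and the vanishing of all its moments kills it pointwise. The ends of the
    strip are free, so the axial force is zero and not merely constant. Each order feeds the next:
    vanishing of E_12 and E_22 at order j forces the r-derivative of the map at order j + 1 to be
    constant across the width, so that E_11 at order j + 1 is a polynomial in r. In normalized
    coordinates d_2 Phi is an r-derivative divided by [beta] B, which is why the limit map must be
    shown to collapse onto a curve before d_2 Phi can be expanded. *)

(** Since [P] is monotone in [d], a positive lower bound for the local radii of a finite cover
    serves everywhere. Four parameters describe a pair of points of the strip, the form in which
    injectivity is tested. *)
Lemma compact_box4 (a1 b1 a2 b2 a3 b3 a4 b4 : R) (P : R -> R -> R -> R -> R -> Prop) :
  (forall d d' x y z w, 0 < d' <= d -> P d x y z w -> P d' x y z w) ->
  (forall x y z w, a1 <= x <= b1 -> a2 <= y <= b2 -> a3 <= z <= b3 -> a4 <= w <= b4 ->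
    exists d, 0 < d /\ forall x' y' z' w',
      a1 <= x' <= b1 -> a2 <= y' <= b2 -> a3 <= z' <= b3 -> a4 <= w' <= b4 ->
      Rabs (x' - x) < d -> Rabs (y' - y) < d -> Rabs (z' - z) < d -> Rabs (w' - w) < d ->
      P d x' y' z' w') ->
  exists d, 0 < d /\ forall x y z w,
    a1 <= x <= b1 -> a2 <= y <= b2 -> a3 <= z <= b3 -> a4 <= w <= b4 -> P d x y z w.
Proof.
  intros Hmono Hloc.
  pose (lo := (a1, (a2, (a3, (a4, tt)))) : Compactness.Tn 4 R).
  pose (hi := (b1, (b2, (b3, (b4, tt)))) : Compactness.Tn 4 R).
  (* Outside the box [Q] holds vacuously, so that every point has a radius and [delta] is a gauge on
     the whole space. *)
  pose (Q := fun (t : Compactness.Tn 4 R) (d : posreal) =>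
    bounded_n 4 lo hi t -> forall x', bounded_n 4 lo hi x' -> close_n 4 d x' t ->
      let '(x, (y, (z, (w, _)))) := x' in P d x y z w).
  assert (HQ : forall t, exists d, Q t d).
  { intros [x [y [z [w []]]]].
    destruct (classic (bounded_n 4 lo hi (x, (y, (z, (w, tt)))))) as [H | H].
    - pose proof H as H0. simpl in H. destruct H as (H1 & H2 & H3 & H4 & _).
      destruct (Hloc x y z w H1 H2 H3 H4) as [d [Hd Hd']].
      exists (mkposreal d Hd). intros _ [x' [y' [z' [w' []]]]] Hb Hc.
      simpl in Hb, Hc |- *. apply Hd'; tauto.
    - exists (mkposreal 1 Rlt_0_1). intros H'. contradiction. }
  pose (delta := fun t => proj1_sig (constructive_indefinite_description _ (HQ t))).
  destruct (compactness_value 4 lo hi delta) as [d Hd].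
  exists d. split; [apply cond_pos |]. intros x y z w H1 H2 H3 H4.
  assert (Hb : bounded_n 4 lo hi (x, (y, (z, (w, tt))))) by (simpl; tauto).
  (* [compactness_value] provides the tag of a point only up to double negation. *)
  specialize (Hd _ Hb). apply NNPP in Hd. destruct Hd as [t [Ht [Hc Hle]]].
  pose proof (proj2_sig (constructive_indefinite_description _ (HQ t))) as HQt.
  fold (delta t) in HQt. specialize (HQt Ht _ Hb Hc). simpl in HQt.
  apply (Hmono (delta t)); [split; [apply cond_pos | exact Hle] | exact HQt].
Qed.

Lemma compact_box3 (a1 b1 a2 b2 a3 b3 : R) (P : R -> R -> R -> R -> Prop) :
  (forall d d' x y z, 0 < d' <= d -> P d x y z -> P d' x y z) ->
  (forall x y z, a1 <= x <= b1 -> a2 <= y <= b2 -> a3 <= z <= b3 ->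
    exists d, 0 < d /\ forall x' y' z',
      a1 <= x' <= b1 -> a2 <= y' <= b2 -> a3 <= z' <= b3 ->
      Rabs (x' - x) < d -> Rabs (y' - y) < d -> Rabs (z' - z) < d -> P d x' y' z') ->
  exists d, 0 < d /\ forall x y z,
    a1 <= x <= b1 -> a2 <= y <= b2 -> a3 <= z <= b3 -> P d x y z.
Proof.
  intros Hm Hl.
  destruct (compact_box4 a1 b1 a2 b2 a3 b3 0 0 (fun d x y z _ => P d x y z)) as [d [Hd H]].
  - intros d d' x y z w. apply Hm.
  - intros x y z w Hx Hy Hz _. destruct (Hl x y z Hx Hy Hz) as [d [Hd H]].
    exists d. split; [exact Hd |]. intros. now apply H.
  - exists d. split; [exact Hd |]. intros x y z Hx Hy Hz. apply (H x y z 0); auto; lra.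
Qed.

Lemma compact_box2 (a1 b1 a2 b2 : R) (P : R -> R -> R -> Prop) :
  (forall d d' x y, 0 < d' <= d -> P d x y -> P d' x y) ->
  (forall x y, a1 <= x <= b1 -> a2 <= y <= b2 ->
    exists d, 0 < d /\ forall x' y', a1 <= x' <= b1 -> a2 <= y' <= b2 ->
      Rabs (x' - x) < d -> Rabs (y' - y) < d -> P d x' y') ->
  exists d, 0 < d /\ forall x y, a1 <= x <= b1 -> a2 <= y <= b2 -> P d x y.
Proof.
  intros Hm Hl.
  destruct (compact_box3 a1 b1 a2 b2 0 0 (fun d x y _ => P d x y)) as [d [Hd H]].
  - intros d d' x y z. apply Hm.
  - intros x y z Hx Hy _. destruct (Hl x y Hx Hy) as [d [Hd H]].
    exists d. split; [exact Hd |]. intros. now apply H.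
  - exists d. split; [exact Hd |]. intros x y Hx Hy. apply (H x y 0); auto; lra.
Qed.

(** * Continuity relative to closed intervals and strips *)

Definition clamp (c d x : R) : R := Rmax c (Rmin d x).

Lemma clamp_in c d x : c <= d -> c <= clamp c d x <= d.
Proof. unfold clamp, Rmax, Rmin. intros; repeat destruct Rle_dec; lra. Qed.

Lemma clamp_id c d x : c <= x <= d -> clamp c d x = x.
Proof. unfold clamp, Rmax, Rmin. intros; repeat destruct Rle_dec; lra. Qed.

Lemma clamp_lip c d x y : Rabs (clamp c d y - clamp c d x) <= Rabs (y - x).
Proof.
  unfold clamp, Rmax, Rmin, Rabs.
  repeat (destruct Rle_dec || destruct Rcase_abs); lra.
Qed.

Lemma continuous_R_eps (f : R -> R) x :
  continuous f x <->
  (forall eps, 0 < eps -> exists d, 0 < d /\ forall y, Rabs (y - x) < d -> Rabs (f y - f x) < eps).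
Proof.
  split.
  - intros H eps He.
    destruct (proj1 (filterlim_locally f _) H (mkposreal eps He)) as [d Hd]. exists d. split; [apply cond_pos |].
    intros y Hy. apply Hd. exact Hy.
  - intros H. apply filterlim_locally. intros eps.
    destruct (H eps (cond_pos eps)) as [d [Hd Hd']]. exists (mkposreal d Hd).
    intros y Hy. apply Hd'. exact Hy.
Qed.

Lemma continuous_R2_eps (f : R * R -> R) x y :
  continuous f (x, y) <->
  (forall eps, 0 < eps -> exists d, 0 < d /\ forall x' y',
    Rabs (x' - x) < d -> Rabs (y' - y) < d -> Rabs (f (x', y') - f (x, y)) < eps).
Proof.
  split.
  - intros H eps He.
    destruct (proj1 (filterlim_locally f _) H (mkposreal eps He)) as [d Hd]. exists d. split; [apply cond_pos |].
    intros x' y' Hx Hy. apply (Hd (x', y')). split; assumption.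
  - intros H. apply filterlim_locally. intros eps.
    destruct (H eps (cond_pos eps)) as [d [Hd Hd']]. exists (mkposreal d Hd).
    intros [x' y'] [Hx Hy]. apply Hd'; assumption.
Qed.

Lemma continuous_R3_eps (f : R * (R * R) -> R) x y z :
  continuous f (x, (y, z)) <->
  (forall eps, 0 < eps -> exists d, 0 < d /\ forall x' y' z',
    Rabs (x' - x) < d -> Rabs (y' - y) < d -> Rabs (z' - z) < d ->
    Rabs (f (x', (y', z')) - f (x, (y, z))) < eps).
Proof.
  split.
  - intros H eps He.
    destruct (proj1 (filterlim_locally f _) H (mkposreal eps He)) as [d Hd]. exists d. split; [apply cond_pos |].
    intros x' y' z' Hx Hy Hz. apply (Hd (x', (y', z'))). repeat split; assumption.
  - intros H. apply filterlim_locally. intros eps.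
    destruct (H eps (cond_pos eps)) as [d [Hd Hd']]. exists (mkposreal d Hd).
    intros [x' [y' z']] [Hx [Hy Hz]]. apply Hd'; assumption.
Qed.

(* Continuity relative to [c,d] (resp. to [a,b] x [-1,1]), expressed through the retraction
   [clamp] so that the two-sided lemmas of Coquelicot apply at the boundary. *)
Definition ct1 (c d : R) (f : R -> R) : Prop :=
  forall x, continuous (fun x => f (clamp c d x)) x.

Definition ct2 (a b : R) (f : R -> R -> R) : Prop :=
  forall p : R * R,
    continuous (fun p : R * R => f (clamp a b (fst p)) (clamp (-1) 1 (snd p))) p.

Lemma clamp_continuous c d x : continuous (clamp c d) x.
Proof.
  apply continuous_R_eps. intros eps He. exists eps. split; [exact He |].
  intros y Hy. pose proof (clamp_lip c d x y). lra.
Qed.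

Lemma ct1_of_continuous c d f :
  c <= d -> (forall x, c <= x <= d -> continuous f x) -> ct1 c d f.
Proof.
  intros Hcd H x. apply (continuous_comp (clamp c d) f).
  - apply clamp_continuous.
  - apply H, clamp_in, Hcd.
Qed.

Lemma ct2_of_continuous a b (f : R -> R -> R) :
  a <= b ->
  (forall s r, a <= s <= b -> -1 <= r <= 1 ->
     continuous (fun p : R * R => f (fst p) (snd p)) (s, r)) -> ct2 a b f.
Proof.
  intros Hab H [s r].
  apply (continuous_comp_2 (fun p : R * R => clamp a b (fst p))
    (fun p : R * R => clamp (-1) 1 (snd p)) f).
  - apply (continuous_comp fst (clamp a b)); [apply continuous_fst | apply clamp_continuous].
  - apply (continuous_comp snd (clamp (-1) 1)); [apply continuous_snd | apply clamp_continuous].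
  - apply H; apply clamp_in; lra.
Qed.

Lemma ct1_eps c d f x : c <= x <= d -> ct1 c d f ->
  forall eps, 0 < eps -> exists del, 0 < del /\ forall y, c <= y <= d ->
    Rabs (y - x) < del -> Rabs (f y - f x) < eps.
Proof.
  intros Hx H eps He. destruct (proj1 (continuous_R_eps _ _) (H x) eps He) as [del [Hd H']].
  exists del. split; [exact Hd |]. intros y Hy Hyx. specialize (H' y Hyx).
  rewrite (clamp_id c d y Hy), (clamp_id c d x Hx) in H'. exact H'.
Qed.

Lemma ct2_eps a b f s r : a <= s <= b -> -1 <= r <= 1 -> ct2 a b f ->
  forall eps, 0 < eps -> exists del, 0 < del /\ forall s' r', a <= s' <= b -> -1 <= r' <= 1 ->
    Rabs (s' - s) < del -> Rabs (r' - r) < del -> Rabs (f s' r' - f s r) < eps.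
Proof.
  intros Hs Hr H eps He.
  destruct (proj1 (continuous_R2_eps _ _ _) (H (s, r)) eps He) as [del [Hd H']].
  exists del. split; [exact Hd |]. intros s' r' Hs' Hr' H1 H2. specialize (H' s' r' H1 H2).
  simpl in H'. rewrite !clamp_id in H' by lra. exact H'.
Qed.

Lemma ct1_ext c d f g : c <= d -> (forall x, c <= x <= d -> f x = g x) -> ct1 c d f -> ct1 c d g.
Proof.
  intros Hcd He H x. apply (continuous_ext (fun x => f (clamp c d x))); [| apply H].
  intros y. apply He, clamp_in, Hcd.
Qed.

Lemma ct2_ext a b f g : a <= b ->
  (forall s r, a <= s <= b -> -1 <= r <= 1 -> f s r = g s r) -> ct2 a b f -> ct2 a b g.
Proof.
  intros Hab He H p.
  apply (continuous_ext (fun p : R * R => f (clamp a b (fst p)) (clamp (-1) 1 (snd p)))).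
  - intros y. apply He; apply clamp_in; lra.
  - apply H.
Qed.

Lemma ct1_const c d k : ct1 c d (fun _ => k).
Proof. intros x. apply continuous_const. Qed.

Lemma ct1_id c d : ct1 c d (fun x => x).
Proof. intros x. apply clamp_continuous. Qed.

Lemma ct1_plus c d f g : ct1 c d f -> ct1 c d g -> ct1 c d (fun x => f x + g x).
Proof. intros Hf Hg x. exact (continuous_plus _ _ _ (Hf x) (Hg x)). Qed.

Lemma ct1_mult c d f g : ct1 c d f -> ct1 c d g -> ct1 c d (fun x => f x * g x).
Proof. intros Hf Hg x. exact (continuous_mult (K := R_AbsRing) _ _ _ (Hf x) (Hg x)). Qed.

Lemma ct1_pow c d f n : ct1 c d f -> ct1 c d (fun x => f x ^ n).
Proof.
  intros Hf. induction n as [| n IH]; [exact (ct1_const c d 1) |]. now apply (ct1_mult c d f).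
Qed.

Lemma ct1_scal c d k f : ct1 c d f -> ct1 c d (fun x => k * f x).
Proof. intros Hf. apply (ct1_mult c d (fun _ => k)); [apply ct1_const | exact Hf]. Qed.

Ltac ct1_tac := lazymatch goal with
  | H : ct1 ?c ?d ?f |- ct1 ?c ?d ?f => exact H
  | |- ct1 _ _ (fun _ => ?k) => exact (ct1_const _ _ k)
  | |- ct1 _ _ (fun x => x) => exact (ct1_id _ _)
  | |- ct1 ?c ?d (fun x => @?f x + @?g x) => refine (ct1_plus c d f g _ _); ct1_tac
  | |- ct1 ?c ?d (fun x => @?f x * @?g x) => refine (ct1_mult c d f g _ _); ct1_tac
  | |- ct1 ?c ?d (fun x => @?f x ^ ?n) => refine (ct1_pow c d f n _); ct1_tac
  | |- _ => try assumption
  end.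

Lemma ct2_const a b k : ct2 a b (fun _ _ => k).
Proof. intros x. apply continuous_const. Qed.

Lemma ct2_r a b : ct2 a b (fun _ r => r).
Proof.
  intros x. apply (continuous_comp snd (clamp (-1) 1));
    [apply continuous_snd | apply clamp_continuous].
Qed.

Lemma ct2_s a b f : ct1 a b f -> ct2 a b (fun s _ => f s).
Proof.
  intros H x. apply (continuous_comp fst (fun s => f (clamp a b s)));
    [apply continuous_fst | apply H].
Qed.

Lemma ct2_plus a b f g : ct2 a b f -> ct2 a b g -> ct2 a b (fun s r => f s r + g s r).
Proof. intros Hf Hg x. exact (continuous_plus _ _ _ (Hf x) (Hg x)). Qed.

Lemma ct2_minus a b f g : ct2 a b f -> ct2 a b g -> ct2 a b (fun s r => f s r - g s r).
Proof. intros Hf Hg x. exact (continuous_minus _ _ _ (Hf x) (Hg x)). Qed.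

Lemma ct2_opp a b f : ct2 a b f -> ct2 a b (fun s r => - f s r).
Proof. intros Hf x. exact (continuous_opp _ _ (Hf x)). Qed.

Lemma ct2_mult a b f g : ct2 a b f -> ct2 a b g -> ct2 a b (fun s r => f s r * g s r).
Proof. intros Hf Hg x. exact (continuous_mult (K := R_AbsRing) _ _ _ (Hf x) (Hg x)). Qed.

Lemma ct2_pow a b f n : ct2 a b f -> ct2 a b (fun s r => f s r ^ n).
Proof.
  intros Hf. induction n as [| n IH]; [exact (ct2_const a b 1) |]. now apply (ct2_mult a b f).
Qed.

Lemma ct2_inv a b f : a <= b -> ct2 a b f ->
  (forall s r, a <= s <= b -> -1 <= r <= 1 -> f s r <> 0) -> ct2 a b (fun s r => / f s r).
Proof.
  intros Hab Hf H0 x. apply (continuous_comp _ Rinv); [apply Hf |].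
  apply continuous_Rinv. apply H0; apply clamp_in; lra.
Qed.

Lemma ct2_sqrt a b f : ct2 a b f -> ct2 a b (fun s r => sqrt (f s r)).
Proof. intros Hf x. apply (continuous_comp _ sqrt); [apply Hf | apply continuous_sqrt]. Qed.

Lemma ct2_fix_s a b f s : a <= s <= b -> ct2 a b f -> ct1 (-1) 1 (f s).
Proof.
  intros Hs H r. apply continuous_R_eps. intros eps He.
  destruct (ct2_eps a b f s (clamp (-1) 1 r) Hs (clamp_in (-1) 1 r ltac:(lra)) H eps He)
    as [d [Hd H']].
  exists d. split; [exact Hd |]. intros y Hy. apply H'; auto.
  - apply clamp_in; lra.
  - rewrite Rminus_diag, Rabs_R0. exact Hd.
  - pose proof (clamp_lip (-1) 1 r y). lra.
Qed.

Lemma ct1_ex_RInt c d f : c <= d -> ct1 c d f -> ex_RInt f c d.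
Proof.
  intros Hcd H. apply (ex_RInt_ext (fun x => f (clamp c d x))).
  - intros x. rewrite Rmin_left, Rmax_right by lra. intros Hx. now rewrite clamp_id by lra.
  - apply (ex_RInt_continuous (V := R_CompleteNormedModule)). intros x _. apply H.
Qed.

Lemma ct2_bounded a b f : ct2 a b f ->
  exists M, 0 < M /\ forall s r, a <= s <= b -> -1 <= r <= 1 -> Rabs (f s r) <= M.
Proof.
  intros H.
  destruct (compact_box2 a b (-1) 1 (fun d s r => Rabs (f s r) <= / d)) as [d [Hd H']].
  - intros d d' s r [H1 H2] H3. apply Rle_trans with (/ d); [exact H3 |].
    apply Rinv_le_contravar; assumption.
  - intros s r Hs Hr. destruct (ct2_eps a b f s r Hs Hr H 1 Rlt_0_1) as [d [Hd H']].
    assert (H0 : 0 < Rabs (f s r) + 1) by (pose proof (Rabs_pos (f s r)); lra).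
    exists (Rmin d (/ (Rabs (f s r) + 1))). split.
    { apply Rmin_glb_lt; [exact Hd | now apply Rinv_0_lt_compat]. }
    intros s' r' Hs' Hr' H1 H2.
    assert (H3 : Rabs (f s' r') <= Rabs (f s r) + 1).
    { pose proof (Rmin_l d (/ (Rabs (f s r) + 1))).
      assert (Rabs (f s' r' - f s r) < 1) by (apply H'; auto; lra).
      pose proof (Rabs_triang_inv (f s' r') (f s r)). lra. }
    apply Rle_trans with (1 := H3).
    rewrite <- (Rinv_inv (Rabs (f s r) + 1)) at 1.
    apply Rinv_le_contravar; [| apply Rmin_r].
    apply Rmin_glb_lt; [exact Hd | now apply Rinv_0_lt_compat].
  - exists (/ d). split; [now apply Rinv_0_lt_compat |]. exact H'.
Qed.

(** Uniformity in [r] is what makes the integral over [r] continuous in [s]. *)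
Lemma ct2_unif a b f : ct2 a b f -> forall eps, 0 < eps ->
  exists d, 0 < d /\ forall s s' r, a <= s <= b -> a <= s' <= b -> -1 <= r <= 1 ->
    Rabs (s' - s) < d -> Rabs (f s' r - f s r) < eps.
Proof.
  intros H eps He.
  destruct (compact_box2 a b (-1) 1 (fun d s r => forall s', a <= s' <= b ->
    Rabs (s' - s) < d -> Rabs (f s' r - f s r) < eps)) as [d [Hd H']].
  - intros d d' s r Hd H1 s' Hs' H2. apply H1; [exact Hs' | lra].
  - intros s r Hs Hr. destruct (ct2_eps a b f s r Hs Hr H (eps / 2)) as [d [Hd H']]; [lra |].
    exists (d / 2). split; [lra |]. intros s1 r1 Hs1 Hr1 H1 H2 s2 Hs2 H3.
    assert (Rabs (f s1 r1 - f s r) < eps / 2) by (apply H'; auto; lra).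
    assert (Rabs (f s2 r1 - f s r) < eps / 2).
    { apply H'; auto; [| lra]. replace (s2 - s) with ((s2 - s1) + (s1 - s)) by ring.
      eapply Rle_lt_trans; [apply Rabs_triang | lra]. }
    replace (f s2 r1 - f s1 r1) with ((f s2 r1 - f s r) - (f s1 r1 - f s r)) by ring.
    eapply Rle_lt_trans; [apply Rabs_triang |]. rewrite Rabs_Ropp. lra.
  - exists d. split; [exact Hd |]. intros. now apply H'.
Qed.

Lemma ct2_inner a b f : a <= b -> ct2 a b f -> ct1 a b (fun s => RInt (f s) (-1) 1).
Proof.
  intros Hab H x. apply continuous_R_eps. intros eps He.
  destruct (ct2_unif a b f H (eps / 4)) as [d [Hd H']]; [lra |].
  exists d. split; [exact Hd |]. intros y Hy.
  pose proof (clamp_in a b x Hab) as Hx'. pose proof (clamp_in a b y Hab) as Hy'.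
  pose proof (clamp_lip a b x y) as Hl.
  set (s := clamp a b x) in *. set (s' := clamp a b y) in *.
  assert (E1 : ex_RInt (f s) (-1) 1) by (apply ct1_ex_RInt; [lra | now apply (ct2_fix_s a b)]).
  assert (E2 : ex_RInt (f s') (-1) 1) by (apply ct1_ex_RInt; [lra | now apply (ct2_fix_s a b)]).
  change (RInt (f s') (-1) 1 - RInt (f s) (-1) 1)
    with (minus (RInt (f s') (-1) 1) (RInt (f s) (-1) 1)).
  rewrite <- RInt_minus by assumption.
  eapply Rle_lt_trans.
  - apply (abs_RInt_le_const _ _ _ (eps / 4)); [lra | |].
    + apply (ex_RInt_minus (V := R_NormedModule)); assumption.
    + intros t Ht. apply Rlt_le, H'; auto. lra.
  - lra.
Qed.

Lemma RInt_ext_R (f g : R -> R) c d : c <= d -> (forall x, c <= x <= d -> f x = g x) ->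
  RInt f c d = RInt g c d.
Proof.
  intros Hcd H. apply (RInt_ext (V := R_CompleteNormedModule)).
  rewrite Rmin_left, Rmax_right by lra. intros x Hx. apply H. lra.
Qed.

(** * Iterated integrals over the normalized strip *)

(** Every integral over a thin strip is brought to this form by u2 = c(s) r, so that [beta] enters
    the integrand only. *)
Definition dbl (a b : R) (f : R -> R -> R) : R := RInt (fun s => RInt (f s) (-1) 1) a b.

Lemma dbl_ext a b f g : a <= b ->
  (forall s r, a <= s <= b -> -1 <= r <= 1 -> f s r = g s r) -> dbl a b f = dbl a b g.
Proof.
  intros Hab H. apply RInt_ext. rewrite Rmin_left, Rmax_right by lra. intros s Hs.
  apply RInt_ext. rewrite Rmin_left, Rmax_right by lra. intros r Hr. apply H; lra.
Qed.

Lemma ct2_ex_inner a b f s : a <= s <= b -> ct2 a b f -> ex_RInt (f s) (-1) 1.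
Proof. intros Hs H. apply ct1_ex_RInt; [lra |]. now apply (ct2_fix_s a b). Qed.

Lemma ct2_ex_outer a b f : a <= b -> ct2 a b f -> ex_RInt (fun s => RInt (f s) (-1) 1) a b.
Proof. intros Hab H. apply ct1_ex_RInt; [lra |]. now apply ct2_inner. Qed.

Lemma dbl_plus a b f g : a <= b -> ct2 a b f -> ct2 a b g ->
  dbl a b (fun s r => f s r + g s r) = dbl a b f + dbl a b g.
Proof.
  intros Hab Hf Hg. unfold dbl. symmetry.
  rewrite <- (RInt_plus (V := R_CompleteNormedModule)) by now apply ct2_ex_outer.
  apply RInt_ext. rewrite Rmin_left, Rmax_right by lra. intros s Hs. symmetry.
  apply (RInt_plus (V := R_CompleteNormedModule)); apply (ct2_ex_inner a b); auto; lra.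
Qed.

Lemma dbl_scal a b k f : a <= b -> ct2 a b f ->
  dbl a b (fun s r => k * f s r) = k * dbl a b f.
Proof.
  intros Hab Hf. unfold dbl.
  rewrite <- (RInt_scal (V := R_CompleteNormedModule)) by now apply ct2_ex_outer.
  apply RInt_ext. rewrite Rmin_left, Rmax_right by lra. intros s Hs.
  apply (RInt_scal (V := R_CompleteNormedModule)); apply (ct2_ex_inner a b); auto; lra.
Qed.

Lemma dbl_le a b f g : a <= b -> ct2 a b f -> ct2 a b g ->
  (forall s r, a <= s <= b -> -1 <= r <= 1 -> f s r <= g s r) -> dbl a b f <= dbl a b g.
Proof.
  intros Hab Hf Hg H. apply RInt_le; [lra | now apply ct2_ex_outer .. |].
  intros s Hs. apply RInt_le; [lra | apply (ct2_ex_inner a b); auto; lra .. |].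
  intros r Hr. apply H; lra.
Qed.

Lemma dbl_const a b k : dbl a b (fun _ _ => k) = (b - a) * (2 * k).
Proof.
  unfold dbl. rewrite (RInt_ext _ (fun _ => 2 * k)).
  - apply (RInt_const (V := R_CompleteNormedModule)).
  - intros s _. rewrite (RInt_const (V := R_CompleteNormedModule)). unfold scal; simpl; unfold mult; simpl. ring.
Qed.

Lemma ct1_RInt_eq0 c d f : c < d -> ct1 c d f -> (forall x, c <= x <= d -> 0 <= f x) ->
  RInt f c d <= 0 -> forall x, c <= x <= d -> f x = 0.
Proof.
  intros Hcd Hf Hpos Hint x Hx.
  destruct (Rle_lt_or_eq_dec _ _ (Hpos x Hx)) as [Hfx | Hfx]; [| now symmetry].
  exfalso. destruct (ct1_eps c d f x Hx Hf (f x / 2)) as [del [Hdel Hc]]; [lra |].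
  (* A nondegenerate interval inside [c, d] around [x], one-sided if [x] is an endpoint, on which
     [f] exceeds f x / 2. *)
  set (u := Rmax c (x - del / 2)). set (v := Rmin d (x + del / 2)).
  assert (Huv : c <= u /\ u < v /\ v <= d /\ x - del < u /\ v < x + del).
  { unfold u, v, Rmax, Rmin. repeat destruct Rle_dec; lra. }
  assert (He : forall p q, c <= p -> p <= q -> q <= d -> ex_RInt f p q).
  { intros p q H1 H2 H3. apply (ex_RInt_ext (fun x => f (clamp c d x))).
    - intros y. rewrite Rmin_left, Rmax_right by lra. intros Hy. now rewrite clamp_id by lra.
    - apply (ex_RInt_continuous (V := R_CompleteNormedModule)). intros y _. apply Hf. }
  assert (H0 : forall p q, c <= p -> p <= q -> q <= d -> 0 <= RInt f p q).
  { intros p q H1 H2 H3. apply RInt_ge_0; [lra | now apply He |]. intros y Hy. apply Hpos. lra. }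
  rewrite <- (RInt_Chasles f c u d) in Hint by (apply He; lra).
  rewrite <- (RInt_Chasles f u v d) in Hint by (apply He; lra).
  unfold plus in Hint; simpl in Hint.
  pose proof (H0 c u ltac:(lra) ltac:(lra) ltac:(lra)).
  pose proof (H0 v d ltac:(lra) ltac:(lra) ltac:(lra)).
  assert (H3 : RInt (fun _ => f x / 2) u v <= RInt f u v).
  { apply RInt_le; [lra | apply ex_RInt_const | apply He; lra |].
    intros y Hy. assert (Hy' : Rabs (f y - f x) < f x / 2).
    { apply Hc; [lra |]. apply Rabs_def1; lra. }
    apply Rabs_def2 in Hy'. lra. }
  rewrite RInt_const in H3. unfold scal in H3; simpl in H3; unfold mult in H3; simpl in H3.
  assert (0 < (v - u) * (f x / 2)) by (apply Rmult_lt_0_compat; lra). lra.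
Qed.

Lemma dbl_eq0 a b f : a < b -> ct2 a b f ->
  (forall s r, a <= s <= b -> -1 <= r <= 1 -> 0 <= f s r) -> dbl a b f <= 0 ->
  forall s r, a <= s <= b -> -1 <= r <= 1 -> f s r = 0.
Proof.
  intros Hab Hf Hpos Hint s r Hs Hr.
  apply (ct1_RInt_eq0 (-1) 1 (f s)); auto; [lra | now apply (ct2_fix_s a b) |].
  apply Req_le. revert s Hs. apply (ct1_RInt_eq0 a b); auto; [apply ct2_inner; auto; lra |].
  intros s Hs. apply RInt_ge_0; [lra | now apply (ct2_ex_inner a b) |].
  intros y Hy. apply Hpos; auto; lra.
Qed.

(** * Functions with vanishing moments *)

Lemma RInt_plus_R (f g : R -> R) c d : ex_RInt f c d -> ex_RInt g c d ->
  RInt (fun x => f x + g x) c d = RInt f c d + RInt g c d.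
Proof. exact (RInt_plus (V := R_CompleteNormedModule) f g c d). Qed.

Lemma RInt_scal_R (f : R -> R) k c d : ex_RInt f c d ->
  RInt (fun x => k * f x) c d = k * RInt f c d.
Proof. exact (RInt_scal (V := R_CompleteNormedModule) f c d k). Qed.

Lemma RInt_const_R k c d : RInt (fun _ => k) c d = (d - c) * k.
Proof. exact (RInt_const (V := R_CompleteNormedModule) c d k). Qed.

(** The factor x^m strengthens the induction: one more power of the quadratic turns the m-th moment
    into a combination of those of orders m, m + 1 and m + 2. *)
Lemma moments_poly c d f : c <= d -> ct1 c d f ->
  (forall m, RInt (fun x => f x * x ^ m) c d = 0) ->
  forall p0 p1 p2 N m, RInt (fun x => f x * (p0 + p1 * x + p2 * x ^ 2) ^ N * x ^ m) c d = 0.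
Proof.
  intros Hcd Hf Hm p0 p1 p2 N. induction N as [| N IH]; intros m.
  - rewrite <- (Hm m). apply RInt_ext. intros x _. simpl. ring.
  - assert (Hc : forall n, ct1 c d (fun x => f x * (p0 + p1 * x + p2 * x ^ 2) ^ N * x ^ n)).
    { intros n. ct1_tac. }
    set (F := fun n x => f x * (p0 + p1 * x + p2 * x ^ 2) ^ N * x ^ n) in *.
    rewrite (RInt_ext_R _ (fun x => (p0 * F m x + p1 * F (S m) x) + p2 * F (S (S m)) x)); [| exact Hcd |].
    + assert (E : forall k n, ct1 c d (fun x => k * F n x)) by (intros; apply ct1_scal, Hc).
      rewrite (RInt_plus_R (fun x => p0 * F m x + p1 * F (S m) x)), RInt_plus_R;
        try (apply ct1_ex_RInt; [exact Hcd | apply E]).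
      2: { apply ct1_ex_RInt; [exact Hcd |]. apply ct1_plus; apply E. }
      rewrite !RInt_scal_R by (apply ct1_ex_RInt; [exact Hcd | apply Hc]). unfold F. rewrite !IH. rewrite !Rmult_0_r, !Rplus_0_r. reflexivity.
    + intros x _. unfold F. simpl. ring.
Qed.

(* If f >= eta > 0 on [u,v], test with powers of 1 + (x-u)(v-x)/(d-c)^2: they are at most 1
   outside [u,v] and grow without bound inside. *)
Lemma moments_nonpos c d f : c < d -> ct1 c d f ->
  (forall m, RInt (fun x => f x * x ^ m) c d = 0) ->
  forall x, c <= x <= d -> f x <= 0.
Proof.
  intros Hcd Hf Hm x Hx. apply Rnot_lt_le. intros Hfx.
  destruct (ct1_eps c d f x Hx Hf (f x / 2)) as [del [Hdel Hc]]; [lra |].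
  set (u := Rmax c (x - del / 2)). set (v := Rmin d (x + del / 2)).
  assert (Huv : c <= u /\ u < v /\ v <= d /\ x - del < u /\ v < x + del).
  { unfold u, v, Rmax, Rmin. repeat destruct Rle_dec; lra. }
  assert (Hfuv : forall y, u <= y <= v -> f x / 2 <= f y).
  { intros y Hy. assert (Hy' : Rabs (f y - f x) < f x / 2).
    { apply Hc; [lra |]. apply Rabs_def1; lra. }
    apply Rabs_def2 in Hy'. lra. }
  clearbody u v. clear Hc.
  destruct (ct2_bounded c d (fun s _ => f s) (ct2_s _ _ _ Hf)) as [M [HM HM']].
  (* With this scale (y - u)(v - y) / [L] is at least -1 on [c, d], so the base 1 + w of the powers
     stays nonnegative. *)
  set (L := (d - c) ^ 2). assert (HL : 0 < L) by (unfold L; nra).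
  set (w := fun y => (y - u) * (v - y) / L).
  set (wp := fun y => Rmax 0 (w y)).
  assert (Hwc : ct1 c d wp).
  { intros y. apply (continuous_comp (fun y => w (clamp c d y)) (fun z => Rmax 0 z)).
    - apply (ct1_mult c d (fun y => (y - u) * (v - y)) (fun _ => / L)); [| apply ct1_const].
      apply ct1_mult; [apply (ct1_plus c d (fun y => y) (fun _ => - u)) |
        apply (ct1_ext c d (fun y => v + (-1) * y)); [lra | intros; ring |];
        apply (ct1_plus c d (fun _ => v)); [| apply ct1_scal]];
      apply ct1_const || apply ct1_id.
    - apply continuous_R_eps. intros eps He. exists eps. split; [exact He |].
      intros z Hz. eapply Rle_lt_trans; [| exact Hz].
      unfold Rmax, Rabs. repeat (destruct Rle_dec || destruct Rcase_abs); lra. }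
  assert (Hwpos : 0 < RInt wp c d).
  { apply Rnot_le_lt. intros H. pose proof (ct1_RInt_eq0 c d wp Hcd Hwc) as H1.
    assert (H2 : wp ((u + v) / 2) = 0).
    { apply H1; auto; [| lra]. intros y _. apply Rmax_l. }
    unfold wp, w in H2.
    replace (((u + v) / 2 - u) * (v - (u + v) / 2) / L) with ((v - u) ^ 2 / (4 * L)) in H2
      by (field; lra).
    assert (0 < (v - u) ^ 2 / (4 * L)) by (apply Rdiv_lt_0_compat; nra).
    rewrite Rmax_right in H2 by lra. lra. }
  assert (Hbase : forall y, c <= y <= d -> 0 <= 1 + w y).
  { intros y Hy. unfold w. assert (- L <= (y - u) * (v - y)) by (unfold L; nra).
    assert (-1 <= (y - u) * (v - y) / L); [| lra].
    apply Rmult_le_reg_r with L; [exact HL |]. unfold Rdiv. rewrite Rmult_assoc, Rinv_l by lra. lra. }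
  (* On [u, v] Bernoulli's inequality makes the integrand grow at least linearly in N; elsewhere it
     is at least -[M], the power lying in [0, 1]. Letting N grow gives the contradiction. *)
  assert (Hkey : forall N, 0 <= M * (d - c) - INR N * (f x / 2) * RInt wp c d).
  { intros N.
    pose proof (moments_poly c d f ltac:(lra) Hf Hm (1 - u * v / L) ((u + v) / L) (- / L) N 0) as H0.
    assert (H1 : RInt (fun y => - M + INR N * (f x / 2) * wp y) c d <= 0).
    { rewrite <- H0. apply RInt_le; [lra | | |].
      - apply ct1_ex_RInt; [lra |]. apply (ct1_plus c d (fun _ => - M)); [apply ct1_const |].
        now apply ct1_scal.
      - apply ct1_ex_RInt; [lra |].
        ct1_tac.
      - intros y Hy.
        replace (1 - u * v / L + (u + v) / L * y + - / L * y ^ 2) with (1 + w y)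
          by (unfold w; field; lra).
        rewrite pow_O, Rmult_1_r. pose proof (Hbase y ltac:(lra)) as Hb.
        pose proof (HM' y 0 ltac:(lra) ltac:(lra)) as Hfy. apply Rabs_le_between in Hfy.
        destruct (Rle_dec u y) as [H2 | H2]; [destruct (Rle_dec y v) as [H3 | H3] |].
        + assert (Hw0 : 0 <= w y).
          { unfold w. apply Rmult_le_pos; [nra | apply Rlt_le, Rinv_0_lt_compat, HL]. }
          unfold wp. rewrite Rmax_right by exact Hw0.
          pose proof (Hfuv y (conj H2 H3)) as H4.
          assert (H5 : 1 + INR N * w y <= (1 + w y) ^ N).
          { clear - Hw0. induction N as [| N IH]; [simpl; lra |].
            rewrite S_INR. simpl. pose proof (pos_INR N).
            assert (0 <= INR N * w y) by (now apply Rmult_le_pos).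
            apply Rle_trans with ((1 + w y) * (1 + INR N * w y)); [nra |].
            apply Rmult_le_compat_l; lra. }
          pose proof (pos_INR N). assert (0 <= INR N * w y) by (now apply Rmult_le_pos).
          apply Rle_trans with ((f x / 2) * (1 + INR N * w y)); [nra |].
          apply Rmult_le_compat; lra.
        + assert (Hw0 : w y <= 0).
          { unfold w. apply Rmult_le_reg_r with L; [exact HL |].
            unfold Rdiv. rewrite Rmult_assoc, Rinv_l by lra. nra. }
          unfold wp. rewrite Rmax_left by exact Hw0. rewrite Rmult_0_r, Rplus_0_r.
          assert (0 <= (1 + w y) ^ N <= 1) by (split; [now apply pow_le |];
            apply Rle_trans with (1 ^ N); [apply pow_incr; lra | rewrite pow1; lra]). nra.
        + assert (Hw0 : w y <= 0).
          { unfold w. apply Rmult_le_reg_r with L; [exact HL |].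
            unfold Rdiv. rewrite Rmult_assoc, Rinv_l by lra. nra. }
          unfold wp. rewrite Rmax_left by exact Hw0. rewrite Rmult_0_r, Rplus_0_r.
          assert (0 <= (1 + w y) ^ N <= 1) by (split; [now apply pow_le |];
            apply Rle_trans with (1 ^ N); [apply pow_incr; lra | rewrite pow1; lra]). nra. }
    rewrite (RInt_plus_R (fun _ => - M)) in H1; [| apply ex_RInt_const |
      apply ct1_ex_RInt; [lra |]; now apply ct1_scal].
    rewrite RInt_const_R, RInt_scal_R in H1 by (apply ct1_ex_RInt; auto; lra). lra. }
  assert (Hp : 0 < f x / 2 * RInt wp c d) by (apply Rmult_lt_0_compat; lra).
  destruct (INR_unbounded (M * (d - c) / (f x / 2 * RInt wp c d))) as [N HN].
  specialize (Hkey N). apply (Rmult_lt_compat_r (f x / 2 * RInt wp c d)) in HN; [| exact Hp].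
  unfold Rdiv at 1 in HN. rewrite Rmult_assoc, Rinv_l in HN by lra. lra.
Qed.

(** The one-sided bound applied to f and to -f. This serves as the fundamental lemma of the calculus
    of variations, with monomials as test functions: they are smooth at once and their derivatives
    are again monomials up to constants. *)
Lemma moments_zero c d f : c < d -> ct1 c d f ->
  (forall m, RInt (fun x => f x * x ^ m) c d = 0) ->
  forall x, c <= x <= d -> f x = 0.
Proof.
  intros Hcd Hf Hm x Hx. apply Rle_antisym; [now apply (moments_nonpos c d) |].
  assert (H : -1 * f x <= 0); [| lra].
  apply (moments_nonpos c d (fun x => -1 * f x)); auto; [now apply ct1_scal |].
  intros m. rewrite (RInt_ext_R _ (fun x => -1 * (f x * x ^ m))); [| lra | intros; simpl; ring].
  rewrite RInt_scal_R, Hm; [apply Rmult_0_r |].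
  apply ct1_ex_RInt; [lra |]. apply ct1_mult; [exact Hf | apply ct1_pow, ct1_id].
Qed.

(** * Smooth functions on open sets *)

(** The derivative of the difference is a limit of quotients that can be taken from inside [c, d],
    where they vanish, even if [x] is an endpoint. The identities between the data hold on closed
    sets, while [Derive] is two-sided and sees the extension; this lemma transports them up to the
    boundary. *)
Lemma Derive_eq_on_interval c d (f g : R -> R) x :
  c < d -> c <= x <= d -> ex_derive f x -> ex_derive g x ->
  (forall y, c <= y <= d -> f y = g y) -> Derive f x = Derive g x.
Proof.
  intros Hcd Hx Hf Hg He.
  assert (Hd : is_derive (fun y => f y - g y) x (Derive f x - Derive g x)).
  { apply (is_derive_minus (V := R_NormedModule)); now apply Derive_correct. }
  apply is_derive_Reals in Hd.
  destruct (Req_dec (Derive f x) (Derive g x)) as [H | H]; [exact H | exfalso].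
  set (l := Derive f x - Derive g x) in *.
  assert (Hl : 0 < Rabs l) by (apply Rabs_pos_lt; unfold l; lra).
  destruct (Hd _ Hl) as [del Hdel]. pose proof (cond_pos del) as Hp.
  assert (Hh : exists h, h <> 0 /\ Rabs h < del /\ c <= x + h <= d).
  { destruct (Rlt_dec x d) as [H1 | H1].
    - exists (Rmin (del / 2) (d - x)).
      assert (0 < Rmin (del / 2) (d - x)) by (apply Rmin_glb_lt; lra).
      pose proof (Rmin_l (del / 2) (d - x)). pose proof (Rmin_r (del / 2) (d - x)).
      rewrite Rabs_pos_eq by lra. lra.
    - exists (- Rmin (del / 2) (x - c)).
      assert (0 < Rmin (del / 2) (x - c)) by (apply Rmin_glb_lt; lra).
      pose proof (Rmin_l (del / 2) (x - c)). pose proof (Rmin_r (del / 2) (x - c)).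
      rewrite Rabs_Ropp, Rabs_pos_eq by lra. lra. }
  destruct Hh as [h [H1 [H2 H3]]]. specialize (Hdel h H1 H2).
  rewrite (He (x + h) H3), (He x Hx) in Hdel.
  replace ((g (x + h) - g (x + h) - (g x - g x)) / h - l) with (- l) in Hdel by (field; exact H1).
  rewrite Rabs_Ropp in Hdel. lra.
Qed.

(** The order is bounded so that the product rule can be proved by induction on it. *)
Definition smooth2_upto (n : nat) (U : R * R -> Prop) (f : R -> R -> R) : Prop :=
  forall (l : list nat) x y, (length l <= n)%nat -> U (x, y) ->
    continuous (fun p : R * R => dpart2 l f (fst p) (snd p)) (x, y) /\
    ex_derive (fun t => dpart2 l f t y) x /\
    ex_derive (fun t => dpart2 l f x t) y.

Definition smooth2_open (U : R * R -> Prop) (f : R -> R -> R) : Prop :=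
  forall n, smooth2_upto n U f.

Lemma open_box2 (U : R * R -> Prop) x y : open U -> U (x, y) ->
  exists d, 0 < d /\ forall x' y', Rabs (x' - x) < d -> Rabs (y' - y) < d -> U (x', y').
Proof.
  intros HU H. destruct (HU _ H) as [d Hd]. exists d. split; [apply cond_pos |].
  intros x' y' H1 H2. apply (Hd (x', y')). split; assumption.
Qed.

Lemma open_line2 (U : R * R -> Prop) x y : open U -> U (x, y) ->
  locally x (fun t => U (t, y)) /\ locally y (fun t => U (x, t)).
Proof.
  intros HU H. destruct (open_box2 U x y HU H) as [d [Hd H']].
  split; exists (mkposreal d Hd); intros t Ht; apply H'; try exact Ht;
    rewrite Rminus_diag, Rabs_R0; exact Hd.
Qed.

Lemma dpart2_ext_open U f g : open U -> (forall x y, U (x, y) -> f x y = g x y) ->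
  forall l x y, U (x, y) -> dpart2 l f x y = dpart2 l g x y.
Proof.
  intros HU He l. induction l as [| d l IH]; intros x y H; [now apply He |].
  destruct (open_line2 U x y HU H) as [H1 H2]. simpl. unfold pd2.
  destruct (Nat.eqb d 0); apply Derive_ext_loc.
  - revert H1. apply filter_imp. intros t. apply IH.
  - revert H2. apply filter_imp. intros t. apply IH.
Qed.

Lemma dpart2_app l l' f : dpart2 (l ++ l') f = dpart2 l (dpart2 l' f).
Proof. induction l as [| d l IH]; simpl; [reflexivity | now rewrite IH]. Qed.

Lemma smooth2_upto_ext n U f g : open U -> (forall x y, U (x, y) -> f x y = g x y) ->
  smooth2_upto n U f -> smooth2_upto n U g.
Proof.
  intros HU He Hf l x y Hl H. destruct (Hf l x y Hl H) as [H1 [H2 H3]].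
  pose proof (dpart2_ext_open U f g HU He l) as E.
  destruct (open_line2 U x y HU H) as [L1 L2]. split; [| split].
  - apply (continuous_ext_loc _ (fun p : R * R => dpart2 l f (fst p) (snd p))); [| exact H1].
    apply (filter_imp U); [| now apply HU]. intros [u v] Hp. now apply E.
  - revert H2. apply ex_derive_ext_loc. revert L1. apply filter_imp. intros t. apply E.
  - revert H3. apply ex_derive_ext_loc. revert L2. apply filter_imp. intros t. apply E.
Qed.

Lemma smooth2_open_sub (U U' : R * R -> Prop) f : (forall p, U' p -> U p) ->
  smooth2_open U f -> smooth2_open U' f.
Proof. intros H Hf n l x y Hl Hp. apply (Hf n); auto. Qed.

Lemma smooth2_upto_pd2 n U f d : smooth2_upto (S n) U f -> smooth2_upto n U (pd2 d f).
Proof.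
  intros Hf l x y Hl H. change (pd2 d f) with (dpart2 [d] f). rewrite <- dpart2_app.
  apply Hf; [rewrite length_app; simpl; lia | exact H].
Qed.

Lemma smooth2_open_pd2 U f d : smooth2_open U f -> smooth2_open U (pd2 d f).
Proof. intros Hf n. apply smooth2_upto_pd2, Hf. Qed.

Lemma smooth2_upto_ex n U f x y : smooth2_upto n U f -> U (x, y) ->
  ex_derive (fun t => f t y) x /\ ex_derive (fun t => f x t) y.
Proof. intros Hf H. destruct (Hf [] x y) as [_ Hd]; [simpl; lia | exact H | exact Hd]. Qed.

Lemma smooth2_open_ex U f x y : smooth2_open U f -> U (x, y) ->
  ex_derive (fun t => f t y) x /\ ex_derive (fun t => f x t) y.
Proof. intros Hf. exact (smooth2_upto_ex 0 U f x y (Hf 0%nat)). Qed.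

Lemma smooth2_open_continuous U f x y : smooth2_open U f -> U (x, y) ->
  continuous (fun p : R * R => f (fst p) (snd p)) (x, y).
Proof. intros Hf H. destruct (Hf 0%nat [] x y) as [Hd _]; [simpl; lia | exact H | exact Hd]. Qed.

Lemma pd2_plus (f g : R -> R -> R) d (x y : R) :
  ex_derive (fun t => f t y) x /\ ex_derive (fun t => f x t) y ->
  ex_derive (fun t => g t y) x /\ ex_derive (fun t => g x t) y ->
  pd2 d (fun x y => f x y + g x y) x y = pd2 d f x y + pd2 d g x y.
Proof. intros [] []. unfold pd2. destruct (Nat.eqb d 0); apply (Derive_plus (fun t => _) (fun t => _)); assumption. Qed.

Lemma pd2_mult (f g : R -> R -> R) d (x y : R) :
  ex_derive (fun t => f t y) x /\ ex_derive (fun t => f x t) y ->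
  ex_derive (fun t => g t y) x /\ ex_derive (fun t => g x t) y ->
  pd2 d (fun x y => f x y * g x y) x y = pd2 d f x y * g x y + f x y * pd2 d g x y.
Proof. intros [] []. unfold pd2. destruct (Nat.eqb d 0); apply (Derive_mult (fun t => _) (fun t => _)); assumption. Qed.

Lemma dpart2_plus n U f g : open U -> smooth2_upto n U f -> smooth2_upto n U g ->
  forall l x y, (length l <= n)%nat -> U (x, y) ->
    dpart2 l (fun x y => f x y + g x y) x y = dpart2 l f x y + dpart2 l g x y.
Proof.
  intros HU Hf Hg l. induction l as [| d l IH]; intros x y Hl H; [reflexivity |].
  simpl in Hl.
  destruct (Hf l x y) as [_ F]; [lia | exact H |].
  destruct (Hg l x y) as [_ G]; [lia | exact H |].
  transitivity (pd2 d (fun x y => dpart2 l f x y + dpart2 l g x y) x y).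
  - refine (dpart2_ext_open U _ _ HU _ [d] x y H). intros u v. apply IH. lia.
  - exact (pd2_plus (dpart2 l f) (dpart2 l g) d x y F G).
Qed.

Lemma smooth2_upto_plus n U f g : open U -> smooth2_upto n U f -> smooth2_upto n U g ->
  smooth2_upto n U (fun x y => f x y + g x y).
Proof.
  intros HU Hf Hg l x y Hl H.
  assert (E : forall x y, U (x, y) -> dpart2 l f x y + dpart2 l g x y =
    dpart2 l (fun x y => f x y + g x y) x y).
  { intros u v Hp. symmetry. now apply (dpart2_plus n U). }
  destruct (open_line2 U x y HU H) as [L1 L2].
  destruct (Hf l x y Hl H) as [F1 [F2 F3]]. destruct (Hg l x y Hl H) as [G1 [G2 G3]].
  split; [| split].
  - apply (continuous_ext_loc _
      (fun p : R * R => dpart2 l f (fst p) (snd p) + dpart2 l g (fst p) (snd p))).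
    + apply (filter_imp U); [| now apply HU]. intros [u v] Hp. now apply E.
    + exact (continuous_plus _ _ _ F1 G1).
  - apply (ex_derive_ext_loc (fun t => dpart2 l f t y + dpart2 l g t y)).
    + revert L1. apply filter_imp. intros t Ht. now apply E.
    + exact (ex_derive_plus (V := R_NormedModule) _ _ _ F2 G2).
  - apply (ex_derive_ext_loc (fun t => dpart2 l f x t + dpart2 l g x t)).
    + revert L2. apply filter_imp. intros t Ht. now apply E.
    + exact (ex_derive_plus (V := R_NormedModule) _ _ _ F3 G3).
Qed.

(** Induction on the order, peeling off the innermost derivative: after one use of Leibniz' rule
    both summands are products of functions that are smooth to the lower order. *)
Lemma smooth2_upto_mult n U f g : open U -> smooth2_upto n U f -> smooth2_upto n U g ->
  smooth2_upto n U (fun x y => f x y * g x y).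
Proof.
  intros HU. revert f g. induction n as [| n IH]; intros f g Hf Hg l x y Hl H;
    (destruct l as [| d l _] using rev_ind;
    [destruct (Hf [] x y) as [F1 [F2 F3]]; [simpl; lia | exact H |];
     destruct (Hg [] x y) as [G1 [G2 G3]]; [simpl; lia | exact H |];
     simpl in *; split; [| split];
     [exact (continuous_mult (K := R_AbsRing) _ _ _ F1 G1) | now apply ex_derive_mult ..] |]);
    rewrite length_app in Hl; simpl in Hl; [lia |].
  rewrite dpart2_app. simpl.
  apply (smooth2_upto_ext n U (fun x y => pd2 d f x y * g x y + f x y * pd2 d g x y)); auto.
  - intros u v Hp. symmetry. apply pd2_mult; now apply (smooth2_upto_ex (S n) U).
  - apply smooth2_upto_plus; auto; apply IH; try now apply smooth2_upto_pd2.
    + intros l' u v Hl'. apply Hg. lia.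
    + intros l' u v Hl'. apply Hf. lia.
  - lia.
Qed.

Lemma smooth2_open_plus U f g : open U -> smooth2_open U f -> smooth2_open U g ->
  smooth2_open U (fun x y => f x y + g x y).
Proof. intros HU Hf Hg n. now apply smooth2_upto_plus. Qed.

Lemma smooth2_open_mult U f g : open U -> smooth2_open U f -> smooth2_open U g ->
  smooth2_open U (fun x y => f x y * g x y).
Proof. intros HU Hf Hg n. now apply smooth2_upto_mult. Qed.

Lemma smooth2_open_const U k : smooth2_open U (fun _ _ => k).
Proof.
  intros n l x y _ _. revert k.
  induction l as [| d l IH] using rev_ind; intros k.
  - simpl. split; [apply continuous_const | split; apply ex_derive_const].
  - rewrite dpart2_app. simpl.
    replace (pd2 d (fun _ _ : R => k)) with (fun _ _ : R => 0); [apply IH |].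
    apply functional_extensionality; intros u. apply functional_extensionality; intros v.
    unfold pd2. destruct (Nat.eqb d 0); now rewrite Derive_const.
Qed.

Lemma smooth2_open_of_pd2 U f :
  (forall x y, U (x, y) -> continuous (fun p : R * R => f (fst p) (snd p)) (x, y)) ->
  (forall x y, U (x, y) -> ex_derive (fun t => f t y) x /\ ex_derive (fun t => f x t) y) ->
  (forall d, smooth2_open U (pd2 d f)) -> smooth2_open U f.
Proof.
  intros Hc He Hd n l x y _ H. destruct l as [| d l _] using rev_ind.
  - simpl. split; [now apply Hc | now apply He].
  - rewrite dpart2_app. now apply (Hd d (length l)).
Qed.

Lemma smooth2_open_x U : smooth2_open U (fun x _ => x).
Proof.
  apply smooth2_open_of_pd2.
  - intros x y _. apply continuous_fst.
  - intros x y _. split; [apply ex_derive_id | apply ex_derive_const].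
  - intros d. replace (pd2 d (fun x _ => x)) with (fun _ _ : R => if Nat.eqb d 0 then 1 else 0).
    + apply smooth2_open_const.
    + apply functional_extensionality; intros u. apply functional_extensionality; intros v.
      unfold pd2. destruct (Nat.eqb d 0); [now rewrite Derive_id | now rewrite Derive_const].
Qed.

Lemma smooth2_open_y U : smooth2_open U (fun _ y => y).
Proof.
  apply smooth2_open_of_pd2.
  - intros x y _. apply continuous_snd.
  - intros x y _. split; [apply ex_derive_const | apply ex_derive_id].
  - intros d. replace (pd2 d (fun _ y => y)) with (fun _ _ : R => if Nat.eqb d 0 then 0 else 1).
    + apply smooth2_open_const.
    + apply functional_extensionality; intros u. apply functional_extensionality; intros v.
      unfold pd2. destruct (Nat.eqb d 0); [now rewrite Derive_const | now rewrite Derive_id].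
Qed.

Lemma smooth2_open_pow U f n : open U -> smooth2_open U f ->
  smooth2_open U (fun x y => f x y ^ n).
Proof.
  intros HU Hf. induction n as [| n IH]; [exact (smooth2_open_const U 1) |].
  now apply (smooth2_open_mult U f).
Qed.

Lemma smooth2_open_scal U k f : open U -> smooth2_open U f ->
  smooth2_open U (fun x y => k * f x y).
Proof. intros HU Hf. apply (smooth2_open_mult U (fun _ _ => k)); auto. apply smooth2_open_const. Qed.

Lemma smooth2_on_open S f :
  smooth2_on S f <-> exists U, open U /\ (forall x y, S x y -> U (x, y)) /\ smooth2_open U f.
Proof.
  split; intros [U [HU [HS Hf]]]; exists U; split; auto; split; auto.
  - intros n l x y _. apply Hf.
  - intros l x y. now apply (Hf (length l)).
Qed.

Lemma smooth2_open_differentiable U f x y : open U -> smooth2_open U f -> U (x, y) ->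
  differentiable_pt_lim f x y (pd2 0 f x y) (pd2 1 f x y).
Proof.
  intros HU Hf H. apply filterdiff_differentiable_pt_lim.
  apply (is_derive_filterdiff f x y (pd2 0 f) (pd2 1 f x y)).
  - apply (filter_imp U); [| now apply HU]. intros [u v] Hp.
    apply Derive_correct, (smooth2_open_ex U f u v Hf Hp).
  - apply Derive_correct, (smooth2_open_ex U f x y Hf H).
  - apply (smooth2_open_continuous U); [now apply smooth2_open_pd2 | exact H].
Qed.

Lemma smooth2_open_chain U f (q : R -> R) s dq : open U -> smooth2_open U f -> U (s, q s) ->
  is_derive q s dq ->
  is_derive (fun t => f t (q t)) s (pd2 0 f s (q s) + pd2 1 f s (q s) * dq).
Proof.
  intros HU Hf H Hq. apply is_derive_Reals. apply is_derive_Reals in Hq.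
  replace (pd2 0 f s (q s) + pd2 1 f s (q s) * dq)
    with (pd2 0 f s (q s) * 1 + pd2 1 f s (q s) * dq) by ring.
  apply (derivable_pt_lim_comp_2d f (fun t => t) q); auto.
  - now apply (smooth2_open_differentiable U).
  - apply derivable_pt_lim_id.
Qed.

(** * Smooth functions of three variables *)

Definition smooth3_open (U : R * (R * R) -> Prop) (f : R -> R -> R -> R) : Prop :=
  forall (l : list nat) x y z, U (x, (y, z)) ->
      continuous (fun p : R * (R * R) =>
                    dpart3 l f (fst p) (fst (snd p)) (snd (snd p))) (x, (y, z)) /\
      ex_derive (fun t => dpart3 l f t y z) x /\
      ex_derive (fun t => dpart3 l f x t z) y /\
      ex_derive (fun t => dpart3 l f x y t) z.

Lemma open_box3 (U : R * (R * R) -> Prop) x y z : open U -> U (x, (y, z)) ->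
  exists d, 0 < d /\ forall x' y' z',
    Rabs (x' - x) < d -> Rabs (y' - y) < d -> Rabs (z' - z) < d -> U (x', (y', z')).
Proof.
  intros HU H. destruct (HU _ H) as [d Hd]. exists d. split; [apply cond_pos |].
  intros x' y' z' H1 H2 H3. apply (Hd (x', (y', z'))). repeat split; assumption.
Qed.

Lemma dpart3_ext_open U f g : open U -> (forall x y z, U (x, (y, z)) -> f x y z = g x y z) ->
  forall l x y z, U (x, (y, z)) -> dpart3 l f x y z = dpart3 l g x y z.
Proof.
  intros HU He l. induction l as [| d l IH]; intros x y z H; [now apply He |].
  destruct (open_box3 U x y z HU H) as [e [Hpos Hb]]. simpl. unfold pd3.
  destruct (Nat.eqb d 0); [| destruct (Nat.eqb d 1)]; apply Derive_ext_loc;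
    exists (mkposreal e Hpos); intros t Ht; apply IH, Hb; try exact Ht;
    rewrite Rminus_diag, Rabs_R0; exact Hpos.
Qed.

Lemma dpart3_swap_0_2 U f l x y z : open U -> smooth3_open U f -> U (x, (y, z)) ->
  dpart3 (0 :: 2 :: l)%nat f x y z = dpart3 (2 :: 0 :: l)%nat f x y z.
Proof.
  intros HU Hf H. destruct (open_box3 U x y z HU H) as [e [Hpos Hb]].
  simpl. unfold pd3; simpl.
  assert (C : forall l', continuity_2d_pt (fun u v => dpart3 l' f u y v) x z).
  { intros l'. intros eps. destruct (Hf l' x y z H) as [Hc _].
    destruct (proj1 (continuous_R3_eps _ _ _ _) Hc eps (cond_pos eps)) as [d [Hd Hd']].
    exists (mkposreal d Hd). intros u v Hu Hv. apply (Hd' u y v); auto.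
    rewrite Rminus_diag, Rabs_R0. exact Hd. }
  apply (Schwarz (fun u v => dpart3 l f u y v) x z).
  - exists (mkposreal e Hpos). intros u v Hu Hv. simpl in Hu, Hv.
    assert (Hp : U (u, (y, v))) by (apply Hb; auto; rewrite Rminus_diag, Rabs_R0; exact Hpos).
    split; [| split; [| split]].
    + exact (proj1 (proj2 (Hf l u y v Hp))).
    + exact (proj2 (proj2 (proj2 (Hf l u y v Hp)))).
    + exact (proj1 (proj2 (Hf (2%nat :: l) u y v Hp))).
    + exact (proj2 (proj2 (proj2 (Hf (0%nat :: l) u y v Hp)))).
  - apply (C (0 :: 2 :: l)%nat).
  - apply (C (2 :: 0 :: l)%nat).
Qed.

(** * Perturbations of embeddings *)

Lemma ct2_smooth a b (c : R -> R) U f : a <= b -> ct1 a b c -> smooth2_open U f ->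
  (forall s r, a <= s <= b -> -1 <= r <= 1 -> U (s, c s * r)) ->
  ct2 a b (fun s r => f s (c s * r)).
Proof.
  intros Hab Hc Hf HU [s r].
  apply (continuous_comp_2 (fun p : R * R => clamp a b (fst p))
    (fun p : R * R => c (clamp a b (fst p)) * clamp (-1) 1 (snd p)) f).
  - apply (ct2_s a b (fun s => s) (ct1_id a b) (s, r)).
  - apply (ct2_mult a b (fun s _ => c s) (fun _ r => r)); [now apply ct2_s | apply ct2_r].
  - apply (smooth2_open_continuous U); [exact Hf |]. apply HU; apply clamp_in; lra.
Qed.

Lemma RInt_strip a b (c : R -> R) f : a <= b -> ct1 a b c ->
  (forall s, a <= s <= b -> 0 < c s) -> ct2 a b (fun s r => f s (c s * r)) ->
  RInt (fun x => RInt (f x) (- c x) (c x)) a b = dbl a b (fun s r => f s (c s * r) * c s).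
Proof.
  intros Hab Hc Hpos Hf. apply RInt_ext_R; [exact Hab |]. intros s Hs.
  pose proof (Hpos s Hs) as Hp.
  pose proof (RInt_comp_lin (V := R_CompleteNormedModule) (fun r => f s (c s * r) * c s)
    (/ c s) 0 (- c s) (c s)) as E.
  replace (/ c s * - c s + 0) with (-1) in E by (field; lra).
  replace (/ c s * c s + 0) with 1 in E by (field; lra).
  rewrite <- E.
  - apply RInt_ext_R; [lra |]. intros y Hy. unfold scal; simpl; unfold mult; simpl.
    replace (c s * (/ c s * y + 0)) with y by (field; lra). field. lra.
  - apply (ct2_ex_inner a b (fun s r => f s (c s * r) * c s)); [exact Hs |].
    apply (ct2_mult a b (fun s r => f s (c s * r)) (fun s _ => c s)); [exact Hf | now apply ct2_s].
Qed.

(** The entries vary independently because the mean value theorem will evaluate the four partial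
    derivatives at different points. If the perturbed determinant vanished, the original one would
    be a sum of four products, each containing a factor smaller than [eta]. *)
Lemma det_near (A B C D : R) : A * D - B * C <> 0 ->
  exists eta, 0 < eta /\ forall A' B' C' D',
    Rabs (A' - A) < eta -> Rabs (B' - B) < eta -> Rabs (C' - C) < eta -> Rabs (D' - D) < eta ->
    A' * D' - B' * C' <> 0.
Proof.
  intros H. set (M := Rabs A + Rabs B + Rabs C + Rabs D + 1).
  pose proof (Rabs_pos A); pose proof (Rabs_pos B); pose proof (Rabs_pos C); pose proof (Rabs_pos D).
  pose proof (Rabs_pos_lt _ H) as Hd.
  (* The bound 1 keeps the perturbed entries below [M]; the other one makes the four error products
     together smaller than the determinant. *)
  exists (Rmin 1 (Rabs (A * D - B * C) / (4 * M))).
  assert (HM : 1 <= M) by (unfold M; lra).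
  assert (He : 0 < Rmin 1 (Rabs (A * D - B * C) / (4 * M))).
  { apply Rmin_glb_lt; [lra |]. apply Rdiv_lt_0_compat; lra. }
  split; [exact He |]. set (eta := Rmin _ _) in *.
  assert (Hle1 : eta <= 1) by apply Rmin_l.
  assert (Hle2 : eta * (4 * M) <= Rabs (A * D - B * C)).
  { apply Rle_trans with (Rabs (A * D - B * C) / (4 * M) * (4 * M)).
    - apply Rmult_le_compat_r; [lra | apply Rmin_r].
    - unfold Rdiv. rewrite Rmult_assoc, Rinv_l by lra. lra. }
  intros A' B' C' D' HA HB HC HD Hz.
  assert (E : Rabs ((A' - A) * D' + A * (D' - D) - (B' - B) * C' - B * (C' - C)) < eta * (4 * M)).
  { assert (T : forall y z, Rabs y < eta -> Rabs z <= M -> Rabs (y * z) <= eta * M).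
    { intros y z Hy Hw. rewrite Rabs_mult. apply Rmult_le_compat; try apply Rabs_pos; lra. }
    assert (HD' : Rabs D' <= M).
    { replace D' with (D + (D' - D)) by ring. eapply Rle_trans; [apply Rabs_triang |].
      unfold M. lra. }
    assert (HC' : Rabs C' <= M).
    { replace C' with (C + (C' - C)) by ring. eapply Rle_trans; [apply Rabs_triang |].
      unfold M. lra. }
    assert (T1 := T (A' - A) D' HA HD').
    assert (T2 := T (B' - B) C' HB HC').
    assert (T3 : Rabs (A * (D' - D)) <= eta * (M - 1)).
    { rewrite Rabs_mult, Rmult_comm. apply Rmult_le_compat; try apply Rabs_pos; unfold M; lra. }
    assert (T4 : Rabs (B * (C' - C)) <= eta * (M - 1)).
    { rewrite Rabs_mult, Rmult_comm. apply Rmult_le_compat; try apply Rabs_pos; unfold M; lra. }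
    apply Rabs_le_between in T1, T2, T3, T4. apply Rabs_def1; nra. }
  replace ((A' - A) * D' + A * (D' - D) - (B' - B) * C' - B * (C' - C))
    with (- (A * D - B * C)) in E by lra.
  rewrite Rabs_Ropp in E. lra.
Qed.

Lemma pencil_near (f g : R -> R -> R) x y :
  continuous (fun p : R * R => f (fst p) (snd p)) (x, y) ->
  continuous (fun p : R * R => g (fst p) (snd p)) (x, y) ->
  forall eta, 0 < eta -> exists d, 0 < d /\ forall t x' y',
    Rabs t < d -> Rabs (x' - x) < d -> Rabs (y' - y) < d ->
    Rabs (f x' y' + t * g x' y' - f x y) < eta.
Proof.
  intros Hf Hg eta He.
  destruct (proj1 (continuous_R2_eps _ _ _) Hf (eta / 2)) as [d1 [Hd1 H1]]; [lra |].
  destruct (proj1 (continuous_R2_eps _ _ _) Hg 1) as [d2 [Hd2 H2]]; [lra |].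
  simpl in H1, H2. pose proof (Rabs_pos (g x y)) as Hg0.
  set (d3 := eta / 2 / (Rabs (g x y) + 1)).
  assert (Hd3 : 0 < d3) by (unfold d3; apply Rdiv_lt_0_compat; lra).
  exists (Rmin d1 (Rmin d2 d3)). split; [repeat apply Rmin_glb_lt; assumption |].
  intros t x' y' Ht Hx Hy.
  pose proof (Rmin_l d1 (Rmin d2 d3)); pose proof (Rmin_r d1 (Rmin d2 d3)).
  pose proof (Rmin_l d2 d3); pose proof (Rmin_r d2 d3).
  specialize (H1 x' y' ltac:(lra) ltac:(lra)). specialize (H2 x' y' ltac:(lra) ltac:(lra)).
  assert (K3 : Rabs (g x' y') <= Rabs (g x y) + 1).
  { pose proof (Rabs_triang_inv (g x' y') (g x y)). lra. }
  assert (K4 : Rabs (t * g x' y') <= eta / 2).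
  { rewrite Rabs_mult. apply Rle_trans with (d3 * (Rabs (g x y) + 1)).
    - apply Rmult_le_compat; try apply Rabs_pos; lra.
    - unfold d3. right. field. lra. }
  apply Rabs_def2 in H1. apply Rabs_le_between in K4. apply Rabs_def1; lra.
Qed.

Lemma ex_derive_continuity_pt (f : R -> R) x : ex_derive f x -> continuity_pt f x.
Proof.
  intros H. apply continuity_pt_filterlim. exact (ex_derive_continuous (V := R_NormedModule) f x H).
Qed.

(** The two points are joined by a horizontal and a vertical segment and the one-variable theorem is
    used on each, so the two partial derivatives sit at different points. *)
Lemma mean_value_2d (f : R -> R -> R) x0 y0 d :
  (forall x y, Rabs (x - x0) < d -> Rabs (y - y0) < d ->
     ex_derive (fun t => f t y) x /\ ex_derive (fun t => f x t) y) ->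
  forall x y x' y', Rabs (x - x0) < d -> Rabs (y - y0) < d ->
    Rabs (x' - x0) < d -> Rabs (y' - y0) < d ->
    exists p q p' q', (Rabs (p - x0) < d /\ Rabs (q - y0) < d) /\
      (Rabs (p' - x0) < d /\ Rabs (q' - y0) < d) /\
      f x' y' - f x y = pd2 0 f p q * (x' - x) + pd2 1 f p' q' * (y' - y).
Proof.
  intros Hf x y x' y' Hx Hy Hx' Hy'.
  assert (B : forall u v w z, Rabs (u - z) < d -> Rabs (v - z) < d ->
    Rmin u v <= w <= Rmax u v -> Rabs (w - z) < d).
  { intros u v w z Hu Hv. apply Rabs_def2 in Hu, Hv. unfold Rmin, Rmax.
    destruct Rle_dec; intros; apply Rabs_def1; lra. }
  pose proof (fun t H => proj1 (Hf t y' H Hy')) as Dx.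
  pose proof (fun t H => proj2 (Hf x t Hx H)) as Dy.
  destruct (MVT_gen (fun t => f t y') x x' (fun t => pd2 0 f t y')) as [p [Hp Ep]].
  - intros t Ht. apply Derive_correct, Dx. apply (B x x'); auto. lra.
  - intros t Ht. apply (ex_derive_continuity_pt (fun t => f t y')), Dx.
    now apply (B x x').
  - destruct (MVT_gen (fun t => f x t) y y' (fun t => pd2 1 f x t)) as [q [Hq Eq]].
    + intros t Ht. apply Derive_correct, Dy. apply (B y y'); auto. lra.
    + intros t Ht. apply (ex_derive_continuity_pt (fun t => f x t)), Dy.
      now apply (B y y').
    + exists p, y', x, q. repeat split; auto; [now apply (B x x') | now apply (B y y') |].
      rewrite <- Ep, <- Eq. ring.
Qed.

Lemma common_lower_bound d1 d2 d3 d4 d5 : 0 < d1 -> 0 < d2 -> 0 < d3 -> 0 < d4 -> 0 < d5 ->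
  exists d, 0 < d /\ d <= d1 /\ d <= d2 /\ d <= d3 /\ d <= d4 /\ d <= d5.
Proof.
  intros. exists (Rmin d1 (Rmin d2 (Rmin d3 (Rmin d4 d5)))).
  split; [repeat apply Rmin_glb_lt; assumption |].
  pose proof (Rmin_l d1 (Rmin d2 (Rmin d3 (Rmin d4 d5)))).
  pose proof (Rmin_r d1 (Rmin d2 (Rmin d3 (Rmin d4 d5)))).
  pose proof (Rmin_l d2 (Rmin d3 (Rmin d4 d5))). pose proof (Rmin_r d2 (Rmin d3 (Rmin d4 d5))).
  pose proof (Rmin_l d3 (Rmin d4 d5)). pose proof (Rmin_r d3 (Rmin d4 d5)).
  pose proof (Rmin_l d4 d5). pose proof (Rmin_r d4 d5). repeat split; lra.
Qed.

Section OpenEmbeddings.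

Variables (a b beta : R) (B : R -> R).
Let c := fun x => beta * B x.
Hypothesis Hab : a < b.
Hypothesis Hc : ct1 a b c.
Hypothesis Hcpos : forall s, a <= s <= b -> 0 < c s.
Variables (U : R * R -> Prop) (Phi1 Phi2 V1 V2 : R -> R -> R).
Hypothesis HU : open U.
Hypothesis HDU : forall x y, InDbeta a b B beta x y -> U (x, y).
Hypothesis HP1 : smooth2_open U Phi1.
Hypothesis HP2 : smooth2_open U Phi2.
Hypothesis HV1 : smooth2_open U V1.
Hypothesis HV2 : smooth2_open U V2.
Hypothesis Hemb : is_embedding a b B beta Phi1 Phi2.

Lemma strip_in s r : a <= s <= b -> -1 <= r <= 1 -> InDbeta a b B beta s (c s * r).
Proof.
  intros Hs Hr. split; [exact Hs |]. pose proof (Hcpos s Hs). fold (c s).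
  rewrite Rabs_mult, (Rabs_pos_eq (c s)) by lra.
  assert (Rabs r <= 1) by (apply Rabs_le; lra). nra.
Qed.

Lemma strip_out x y : InDbeta a b B beta x y ->
  exists r, -1 <= r <= 1 /\ y = c x * r.
Proof.
  intros [Hx Hy]. fold (c x) in Hy. pose proof (Hcpos x Hx) as Hp.
  exists (y / c x). split; [| field; lra].
  apply Rabs_le_between in Hy. split.
  - apply Rmult_le_reg_r with (c x); [exact Hp |]. unfold Rdiv. rewrite Rmult_assoc, Rinv_l; lra.
  - apply Rmult_le_reg_r with (c x); [exact Hp |]. unfold Rdiv. rewrite Rmult_assoc, Rinv_l; lra.
Qed.

Lemma strip_near s r : a <= s <= b -> -1 <= r <= 1 -> forall eps, 0 < eps ->
  exists d, 0 < d /\ d <= eps /\ forall s' r', a <= s' <= b -> -1 <= r' <= 1 ->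
    Rabs (s' - s) < d -> Rabs (r' - r) < d -> Rabs (c s' * r' - c s * r) < eps.
Proof.
  intros Hs Hr eps He.
  destruct (ct2_eps a b (fun s r => c s * r) s r Hs Hr) with (eps := eps) as [d [Hd H]]; auto.
  { apply (ct2_mult a b (fun s _ => c s) (fun _ r => r)); [now apply ct2_s | apply ct2_r]. }
  exists (Rmin d eps). split; [now apply Rmin_glb_lt |]. split; [apply Rmin_r |].
  intros s' r' Hs' Hr' H1 H2. pose proof (Rmin_l d eps). apply H; auto; lra.
Qed.

Lemma pd2_pencil i (f g : R -> R -> R) t x y : smooth2_open U f -> smooth2_open U g -> U (x, y) ->
  pd2 i (fun x y => f x y + t * g x y) x y = pd2 i f x y + t * pd2 i g x y.
Proof.
  intros Hf Hg H. rewrite (pd2_plus f (fun x y => t * g x y)).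
  - f_equal. unfold pd2. destruct (Nat.eqb i 0); apply Derive_scal.
  - now apply (smooth2_open_ex U).
  - apply (smooth2_open_ex U (fun x y => t * g x y)); [now apply smooth2_open_scal | exact H].
Qed.

Lemma pencil_pd2_near i (f g : R -> R -> R) x y : smooth2_open U f -> smooth2_open U g -> U (x, y) ->
  forall eta, 0 < eta -> exists d, 0 < d /\ forall t x' y',
    Rabs t < d -> Rabs (x' - x) < d -> Rabs (y' - y) < d -> U (x', y') /\
    Rabs (pd2 i (fun x y => f x y + t * g x y) x' y' - pd2 i f x y) < eta.
Proof.
  intros Hf Hg H eta He.
  destruct (pencil_near (pd2 i f) (pd2 i g) x y) with (eta := eta) as [d [Hd H']]; auto.
  - apply (smooth2_open_continuous U); auto. now apply smooth2_open_pd2.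
  - apply (smooth2_open_continuous U); auto. now apply smooth2_open_pd2.
  - destruct (open_box2 U x y HU H) as [d' [Hd' H'']]. exists (Rmin d d').
    split; [now apply Rmin_glb_lt |]. intros t x' y' Ht Hx Hy.
    pose proof (Rmin_l d d'); pose proof (Rmin_r d d').
    assert (HUp : U (x', y')) by (apply H''; lra). split; [exact HUp |].
    rewrite pd2_pencil by assumption. apply H'; lra.
Qed.

(** Taken at four equal points this is the immersion property of Phi + t V; at distinct points it is
    the determinant that the mean value theorem produces in the proof of injectivity. *)
Lemma jacobian_near x y : InDbeta a b B beta x y ->
  exists d, 0 < d /\ (forall x' y', Rabs (x' - x) < d -> Rabs (y' - y) < d -> U (x', y')) /\
  forall t x1 y1 x2 y2 x3 y3 x4 y4, Rabs t < d ->
    Rabs (x1 - x) < d -> Rabs (y1 - y) < d -> Rabs (x2 - x) < d -> Rabs (y2 - y) < d ->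
    Rabs (x3 - x) < d -> Rabs (y3 - y) < d -> Rabs (x4 - x) < d -> Rabs (y4 - y) < d ->
    pd2 0 (fun x y => Phi1 x y + t * V1 x y) x1 y1 * pd2 1 (fun x y => Phi2 x y + t * V2 x y) x4 y4
    - pd2 1 (fun x y => Phi1 x y + t * V1 x y) x2 y2 * pd2 0 (fun x y => Phi2 x y + t * V2 x y) x3 y3
    <> 0.
Proof.
  intros H. pose proof (HDU x y H) as HUp.
  destruct Hemb as [_ [_ [_ Hdet]]].
  destruct (det_near _ _ _ _ (Hdet x y H)) as [eta [He Hn]].
  destruct (pencil_pd2_near 0 Phi1 V1 x y HP1 HV1 HUp eta He) as [d1 [Hd1 H1]].
  destruct (pencil_pd2_near 1 Phi1 V1 x y HP1 HV1 HUp eta He) as [d2 [Hd2 H2]].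
  destruct (pencil_pd2_near 0 Phi2 V2 x y HP2 HV2 HUp eta He) as [d3 [Hd3 H3]].
  destruct (pencil_pd2_near 1 Phi2 V2 x y HP2 HV2 HUp eta He) as [d4 [Hd4 H4]].
  destruct (common_lower_bound d1 d2 d3 d4 1) as [d [Hd [L1 [L2 [L3 [L4 _]]]]]]; auto; [lra |].
  exists d. split; [exact Hd |]. split.
  - intros x' y' Hx Hy. apply (H1 0 x' y'); try lra. rewrite Rabs_R0. exact Hd1.
  - intros. apply Hn; [apply H1 | apply H2 | apply H3 | apply H4]; lra.
Qed.

(** Embeddings of a compact strip form an open set in the C^1 sense. Near the diagonal of the set of
    pairs, injectivity follows from the nonvanishing determinant of mean-value derivatives; away
    from it the images are separated already at t = 0. Compactness makes the bound on t uniform over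
    pairs; it may depend on [beta] and on the field. *)
Lemma embedding_open : exists t0, 0 < t0 /\ forall t, Rabs t < t0 ->
  is_embedding a b B beta (fun x y => Phi1 x y + t * V1 x y) (fun x y => Phi2 x y + t * V2 x y).
Proof.
  destruct (compact_box2 a b (-1) 1 (fun d s r => forall t, Rabs t < d ->
    pd2 0 (fun x y => Phi1 x y + t * V1 x y) s (c s * r)
    * pd2 1 (fun x y => Phi2 x y + t * V2 x y) s (c s * r)
    - pd2 1 (fun x y => Phi1 x y + t * V1 x y) s (c s * r)
    * pd2 0 (fun x y => Phi2 x y + t * V2 x y) s (c s * r) <> 0)) as [d1 [Hd1 J]].
  { intros d d' s r Hd H t Ht. apply H. lra. }
  { intros s r Hs Hr. destruct (jacobian_near _ _ (strip_in s r Hs Hr)) as [d [Hd [_ H]]].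
    destruct (strip_near s r Hs Hr d Hd) as [d' [Hd' [Hle H']]]. exists d'. split; [exact Hd' |].
    intros s' r' Hs' Hr' H1 H2 t Ht. specialize (H' s' r' Hs' Hr' H1 H2). apply H; lra. }
  destruct (compact_box4 a b (-1) 1 a b (-1) 1 (fun d s r s' r' => forall t, Rabs t < d ->
    Phi1 s (c s * r) + t * V1 s (c s * r) = Phi1 s' (c s' * r') + t * V1 s' (c s' * r') ->
    Phi2 s (c s * r) + t * V2 s (c s * r) = Phi2 s' (c s' * r') + t * V2 s' (c s' * r') ->
    s = s' /\ c s * r = c s' * r')) as [d2 [Hd2 I]].
  { intros d d' s r s' r' Hd H t Ht. apply H. lra. }
  { intros s r s' r' Hs Hr Hs' Hr'.
    pose proof (strip_in s r Hs Hr) as Hp. pose proof (strip_in s' r' Hs' Hr') as Hp'.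
    destruct (classic (s = s' /\ c s * r = c s' * r')) as [[Es Er] | Hne].
    - destruct (jacobian_near _ _ Hp) as [d [Hd [HUd H]]].
      destruct (strip_near s r Hs Hr d Hd) as [e1 [He1 [Hle1 H1]]].
      destruct (strip_near s' r' Hs' Hr' d Hd) as [e2 [He2 [Hle2 H2]]].
      rewrite <- Er in H2.
      destruct (common_lower_bound e1 e2 1 1 1) as [e [He [L1 [L2 _]]]]; try lra.
      exists e. split; [exact He |].
      intros x q x' q' Hx Hq Hx' Hq' N1 N2 N3 N4 t Ht E1 E2.
      specialize (H1 x q Hx Hq ltac:(lra) ltac:(lra)).
      specialize (H2 x' q' Hx' Hq' ltac:(lra) ltac:(lra)).
      set (y := c x * q) in *. set (y' := c x' * q') in *.
      assert (Hsm1 : smooth2_open U (fun x y => Phi1 x y + t * V1 x y))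
        by (apply smooth2_open_plus; auto; now apply smooth2_open_scal).
      assert (Hsm2 : smooth2_open U (fun x y => Phi2 x y + t * V2 x y))
        by (apply smooth2_open_plus; auto; now apply smooth2_open_scal).
      (* The mean value theorem is applied in a box contained in [U] rather than in the strip, which
         need not be convex. *)
      destruct (mean_value_2d (fun x y => Phi1 x y + t * V1 x y) s (c s * r) d)
        with (x := x) (y := y) (x' := x') (y' := y')
        as [p1 [q1 [p2 [q2 [[A1 A2] [[A3 A4] F1]]]]]]; try lra;
        [intros u v Hu Hv; apply (smooth2_open_ex U _ u v Hsm1); auto | rewrite Es; lra |].
      destruct (mean_value_2d (fun x y => Phi2 x y + t * V2 x y) s (c s * r) d)
        with (x := x) (y := y) (x' := x') (y' := y')
        as [p3 [q3 [p4 [q4 [[A5 A6] [[A7 A8] F2]]]]]]; try lra;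
        [intros u v Hu Hv; apply (smooth2_open_ex U _ u v Hsm2); auto | rewrite Es; lra |].
      specialize (H t p1 q1 p2 q2 p3 q3 p4 q4 ltac:(lra) A1 A2 A3 A4 A5 A6 A7 A8).
      simpl in F1, F2. rewrite E1, Rminus_diag in F1. rewrite E2, Rminus_diag in F2.
      set (m1 := pd2 0 _ p1 q1) in *. set (m2 := pd2 1 _ p2 q2) in *.
      set (m3 := pd2 0 _ p3 q3) in *. set (m4 := pd2 1 _ p4 q4) in *.
      (* Cramer's rule: the difference of the two points lies in the kernel of an invertible
         matrix. *)
      assert (G1 : (m1 * m4 - m2 * m3) * (x' - x) = 0).
      { replace ((m1 * m4 - m2 * m3) * (x' - x)) with
          (m4 * (m1 * (x' - x) + m2 * (y' - y)) - m2 * (m3 * (x' - x) + m4 * (y' - y))) by ring.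
        rewrite <- F1, <- F2. ring. }
      assert (G2 : (m1 * m4 - m2 * m3) * (y' - y) = 0).
      { replace ((m1 * m4 - m2 * m3) * (y' - y)) with
          (m1 * (m3 * (x' - x) + m4 * (y' - y)) - m3 * (m1 * (x' - x) + m2 * (y' - y))) by ring.
        rewrite <- F1, <- F2. ring. }
      apply Rmult_integral in G1, G2. split; [destruct G1 | destruct G2]; lra.
    - assert (Hdiff : Phi1 s (c s * r) <> Phi1 s' (c s' * r') \/
                      Phi2 s (c s * r) <> Phi2 s' (c s' * r')).
      { apply NNPP. intros Hn. apply not_or_and in Hn. destruct Hn as [N1 N2].
        apply NNPP in N1, N2. apply Hne. destruct Hemb as [_ [_ [Hinj _]]].
        now apply Hinj. }
      (* One component of the map already separates the two images, and the gap survives on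
         neighbourhoods and for small [t]. *)
      assert (K : forall f g, smooth2_open U f -> smooth2_open U g ->
        f s (c s * r) <> f s' (c s' * r') -> exists d, 0 < d /\
        forall x q x' q', a <= x <= b -> -1 <= q <= 1 -> a <= x' <= b -> -1 <= q' <= 1 ->
        Rabs (x - s) < d -> Rabs (q - r) < d -> Rabs (x' - s') < d -> Rabs (q' - r') < d ->
        forall t, Rabs t < d ->
        f x (c x * q) + t * g x (c x * q) <> f x' (c x' * q') + t * g x' (c x' * q')).
      { intros f g Hf Hg Hfg.
        assert (Hz : 0 < Rabs (f s (c s * r) - f s' (c s' * r')) / 2)
          by (assert (0 < Rabs (f s (c s * r) - f s' (c s' * r'))) by (apply Rabs_pos_lt; lra); lra).
        destruct (pencil_near f g s (c s * r)
          (smooth2_open_continuous U f _ _ Hf (HDU _ _ Hp))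
          (smooth2_open_continuous U g _ _ Hg (HDU _ _ Hp)) _ Hz) as [e1 [He1 K1]].
        destruct (pencil_near f g s' (c s' * r')
          (smooth2_open_continuous U f _ _ Hf (HDU _ _ Hp'))
          (smooth2_open_continuous U g _ _ Hg (HDU _ _ Hp')) _ Hz) as [e2 [He2 K2]].
        destruct (strip_near s r Hs Hr e1 He1) as [e3 [He3 [Hle3 H3]]].
        destruct (strip_near s' r' Hs' Hr' e2 He2) as [e4 [He4 [Hle4 H4]]].
        destruct (common_lower_bound e3 e4 1 1 1) as [e [He [L1 [L2 _]]]]; try lra.
        exists e. split; [exact He |]. intros x q x' q' Hx Hq Hx' Hq' N1 N2 N3 N4 t Ht E.
        specialize (H3 x q Hx Hq ltac:(lra) ltac:(lra)).
        specialize (H4 x' q' Hx' Hq' ltac:(lra) ltac:(lra)).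
        specialize (K1 t x (c x * q) ltac:(lra) ltac:(lra) ltac:(lra)).
        specialize (K2 t x' (c x' * q') ltac:(lra) ltac:(lra) ltac:(lra)).
        rewrite E in K1. apply Rabs_def2 in K1, K2.
        destruct (Rle_dec 0 (f s (c s * r) - f s' (c s' * r'))).
        - rewrite Rabs_pos_eq in K1, K2 by lra. lra.
        - rewrite Rabs_left in K1, K2 by lra. lra. }
      destruct Hdiff as [Hd | Hd].
      + destruct (K Phi1 V1 HP1 HV1 Hd) as [d [Hd0 K']]. exists d. split; [exact Hd0 |].
        intros x q x' q' Hx Hq Hx' Hq' N1 N2 N3 N4 t Ht E1 E2.
        exfalso. now apply (K' x q x' q' Hx Hq Hx' Hq' N1 N2 N3 N4 t Ht).
      + destruct (K Phi2 V2 HP2 HV2 Hd) as [d [Hd0 K']]. exists d. split; [exact Hd0 |].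
        intros x q x' q' Hx Hq Hx' Hq' N1 N2 N3 N4 t Ht E1 E2.
        exfalso. now apply (K' x q x' q' Hx Hq Hx' Hq' N1 N2 N3 N4 t Ht). }
  exists (Rmin d1 d2). split; [now apply Rmin_glb_lt |]. intros t Ht.
  pose proof (Rmin_l d1 d2); pose proof (Rmin_r d1 d2).
  split; [| split; [| split]].
  - apply smooth2_on_open. exists U. split; [exact HU |]. split; [exact HDU |].
    apply smooth2_open_plus; auto. now apply smooth2_open_scal.
  - apply smooth2_on_open. exists U. split; [exact HU |]. split; [exact HDU |].
    apply smooth2_open_plus; auto. now apply smooth2_open_scal.
  - intros x y x' y' Hp Hp' E1 E2.
    destruct (strip_out x y Hp) as [r [Hr ->]]. destruct (strip_out x' y' Hp') as [r' [Hr' ->]].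
    destruct Hp as [Hx _]. destruct Hp' as [Hx' _].
    apply (I x r x' r' Hx Hr Hx' Hr' t); auto. lra.
  - intros x y Hp. destruct (strip_out x y Hp) as [r [Hr ->]]. destruct Hp as [Hx _].
    apply J; auto. lra.
Qed.

End OpenEmbeddings.

(** * First variation of the strain energy *)

Definition e00 (g11 P1 P2 : R -> R -> R) x y :=
  / 2 * (pd2 0 P1 x y ^ 2 + pd2 0 P2 x y ^ 2 - g11 x y).
Definition e01 (P1 P2 : R -> R -> R) x y :=
  / 2 * (pd2 0 P1 x y * pd2 1 P1 x y + pd2 0 P2 x y * pd2 1 P2 x y).
Definition e11 (P1 P2 : R -> R -> R) x y :=
  / 2 * (pd2 1 P1 x y ^ 2 + pd2 1 P2 x y ^ 2 - 1).

(** The polarized stiffness form C^{ijkl} E_ij E'_kl for the metric diag(G, 1), with A, B, C the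
    components 11, 12, 22 of E. The 4 is the 2 of the shear modulus term times 2 for the two equal
    off-diagonal entries. *)
Definition bilin (lam mu G A B C A' B' C' : R) : R :=
  (lam + 2 * mu) * (A * A' / G ^ 2 + C * C') + lam * (A * C' + A' * C) / G + 4 * mu * B * B' / G.

(** The contravariant components S^11, S^12, S^22 of the second Piola-Kirchhoff stress in the chart,
    for the metric diag(g11, 1). *)
Definition s00 lam mu (g11 P1 P2 : R -> R -> R) x y :=
  (lam + 2 * mu) * e00 g11 P1 P2 x y / g11 x y ^ 2 + lam * e11 P1 P2 x y / g11 x y.
Definition s01 (mu : R) (g11 P1 P2 : R -> R -> R) x y := 2 * mu * e01 P1 P2 x y / g11 x y.
Definition s11 lam mu (g11 P1 P2 : R -> R -> R) x y :=
  (lam + 2 * mu) * e11 P1 P2 x y + lam * e00 g11 P1 P2 x y / g11 x y.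

Lemma strain_diag g11 g12 g22 P1 P2 x y : g12 x y = 0 -> g22 x y = 1 ->
  strain g11 g12 g22 P1 P2 0 0 x y = e00 g11 P1 P2 x y /\
  strain g11 g12 g22 P1 P2 0 1 x y = e01 P1 P2 x y /\
  strain g11 g12 g22 P1 P2 1 0 x y = e01 P1 P2 x y /\
  strain g11 g12 g22 P1 P2 1 1 x y = e11 P1 P2 x y.
Proof.
  intros H1 H2. unfold strain, gm, e00, e01, e11. rewrite H1, H2. repeat split; ring.
Qed.

Lemma ginv_diag g11 g12 g22 x y : g12 x y = 0 -> g22 x y = 1 -> 0 < g11 x y ->
  ginv g11 g12 g22 0 0 x y = / g11 x y /\ ginv g11 g12 g22 0 1 x y = 0 /\
  ginv g11 g12 g22 1 0 x y = 0 /\ ginv g11 g12 g22 1 1 x y = 1.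
Proof.
  intros H1 H2 H3. unfold ginv, detg. rewrite H1, H2. repeat split; field; lra.
Qed.

Lemma energy_density_diag Y nu g11 g12 g22 P1 P2 x y :
  g12 x y = 0 -> g22 x y = 1 -> 0 < g11 x y ->
  energy_density Y nu g11 g12 g22 P1 P2 x y * sqrt (detg g11 g12 g22 x y) =
  / 2 * bilin (lame_lambda Y nu) (lame_mu Y nu) (g11 x y)
    (e00 g11 P1 P2 x y) (e01 P1 P2 x y) (e11 P1 P2 x y)
    (e00 g11 P1 P2 x y) (e01 P1 P2 x y) (e11 P1 P2 x y) * sqrt (g11 x y).
Proof.
  intros H1 H2 H3.
  destruct (strain_diag g11 g12 g22 P1 P2 x y H1 H2) as [E1 [E2 [E3 E4]]].
  destruct (ginv_diag g11 g12 g22 x y H1 H2 H3) as [G1 [G2 [G3 G4]]].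
  replace (detg g11 g12 g22 x y) with (g11 x y) by (unfold detg; rewrite H1, H2; ring).
  f_equal. unfold energy_density, Cst, sum2. rewrite E1, E2, E3, E4, G1, G2, G3, G4.
  unfold bilin. field. lra.
Qed.

Lemma stress_diag Y nu g11 g12 g22 P1 P2 x y :
  g12 x y = 0 -> g22 x y = 1 -> 0 < g11 x y ->
  stress Y nu g11 g12 g22 P1 P2 0 0 x y
    = s00 (lame_lambda Y nu) (lame_mu Y nu) g11 P1 P2 x y /\
  stress Y nu g11 g12 g22 P1 P2 0 1 x y = s01 (lame_mu Y nu) g11 P1 P2 x y /\
  stress Y nu g11 g12 g22 P1 P2 1 0 x y = s01 (lame_mu Y nu) g11 P1 P2 x y /\
  stress Y nu g11 g12 g22 P1 P2 1 1 x y
    = s11 (lame_lambda Y nu) (lame_mu Y nu) g11 P1 P2 x y.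
Proof.
  intros H1 H2 H3.
  destruct (strain_diag g11 g12 g22 P1 P2 x y H1 H2) as [E1 [E2 [E3 E4]]].
  destruct (ginv_diag g11 g12 g22 x y H1 H2 H3) as [G1 [G2 [G3 G4]]].
  unfold stress, Cst, sum2. rewrite E1, E2, E3, E4, G1, G2, G3, G4.
  unfold s00, s01, s11. repeat split; field; lra.
Qed.

Ltac ct2_tac := lazymatch goal with
  | H : ct2 ?a ?b ?f |- ct2 ?a ?b ?f => exact H
  | |- ct2 _ _ (fun _ _ => ?k) => exact (ct2_const _ _ k)
  | |- ct2 _ _ (fun _ r => r) => exact (ct2_r _ _)
  | |- ct2 ?a ?b (fun s r => @?f s r + @?g s r) => refine (ct2_plus a b f g _ _); ct2_tac
  | |- ct2 ?a ?b (fun s r => @?f s r - @?g s r) => refine (ct2_minus a b f g _ _); ct2_tac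
  | |- ct2 ?a ?b (fun s r => - @?f s r) => refine (ct2_opp a b f _); ct2_tac
  | |- ct2 ?a ?b (fun s r => @?f s r * @?g s r) => refine (ct2_mult a b f g _ _); ct2_tac
  | |- ct2 ?a ?b (fun s r => @?f s r ^ ?n) => refine (ct2_pow a b f n _); ct2_tac
  | |- ct2 ?a ?b (fun s r => sqrt (@?f s r)) => refine (ct2_sqrt a b f _); ct2_tac
  | |- _ => idtac
  end.

(** The strain is quadratic in the map, so the energy along Phi + t V is a quartic polynomial in t
    and its derivative at 0 is the coefficient [w1]. For small t of sign opposite to [w1] the linear
    term would win. *)
Lemma quartic_min w0 w1 w2 w3 w4 t0 : 0 < t0 ->
  (forall t, Rabs t < t0 -> w0 <= w0 + t * w1 + t ^ 2 * w2 + t ^ 3 * w3 + t ^ 4 * w4) -> w1 = 0.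
Proof.
  intros Ht H. destruct (Req_dec w1 0) as [E | E]; [exact E | exfalso].
  set (M := Rabs w2 + Rabs w3 + Rabs w4 + 1).
  pose proof (Rabs_pos w2); pose proof (Rabs_pos w3); pose proof (Rabs_pos w4).
  pose proof (Rabs_pos_lt w1 E) as Hw.
  (* t <= 1 bounds the terms of degree 2 to 4 by t^2 [M], and t [M] < |w1| lets the linear term
     dominate them. *)
  set (t := Rmin (Rmin 1 (t0 / 2)) (Rabs w1 / (2 * M))).
  assert (Hp : 0 < t).
  { unfold t. repeat apply Rmin_glb_lt; try lra. apply Rdiv_lt_0_compat; unfold M; lra. }
  assert (L1 : t <= 1) by (eapply Rle_trans; [apply Rmin_l | apply Rmin_l]).
  assert (L2 : t <= t0 / 2) by (eapply Rle_trans; [apply Rmin_l | apply Rmin_r]).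
  assert (L3 : t * M < Rabs w1).
  { apply Rle_lt_trans with (Rabs w1 / (2 * M) * M).
    - apply Rmult_le_compat_r; [unfold M; lra | apply Rmin_r].
    - replace (Rabs w1 / (2 * M) * M) with (Rabs w1 / 2) by (field; unfold M; lra). lra. }
  assert (K : forall u, Rabs u = t -> u * w1 = - t * Rabs w1 -> False).
  { intros u Hu Hu1. specialize (H u ltac:(lra)).
    assert (B2 : Rabs (u ^ 2 * w2) <= t ^ 2 * Rabs w2) by (rewrite Rabs_mult, <- RPow_abs, Hu; lra).
    assert (B3 : Rabs (u ^ 3 * w3) <= t ^ 2 * Rabs w3).
    { rewrite Rabs_mult, <- RPow_abs, Hu. apply Rmult_le_compat_r; [lra |]. nra. }
    assert (B4 : Rabs (u ^ 4 * w4) <= t ^ 2 * Rabs w4).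
    { rewrite Rabs_mult, <- RPow_abs, Hu. apply Rmult_le_compat_r; [lra |].
      replace (t ^ 4) with (t ^ 2 * t ^ 2) by ring. assert (0 <= t ^ 2 <= 1) by nra. nra. }
    apply Rabs_le_between in B2, B3, B4.
    assert (t * (t * M) < t * Rabs w1) by (apply Rmult_lt_compat_l; lra).
    unfold M in *. nra. }
  destruct (Rcase_abs w1) as [Hn | Hn].
  - apply (K t); [apply Rabs_pos_eq; lra |]. rewrite (Rabs_left w1) by lra. ring.
  - apply (K (- t)); [rewrite Rabs_Ropp; apply Rabs_pos_eq; lra |].
    rewrite (Rabs_pos_eq w1) by lra. ring.
Qed.

Section FirstVariation.

Variables (a b beta Y nu : R) (B : R -> R) (g11 g12 g22 : R -> R -> R).
Let c := fun x => beta * B x.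
Let lam := lame_lambda Y nu.
Let mu := lame_mu Y nu.
Hypothesis Hab : a < b.
Hypothesis Hc : ct1 a b c.
Hypothesis Hcpos : forall s, a <= s <= b -> 0 < c s.
Variable U : R * R -> Prop.
Hypothesis HU : open U.
Hypothesis HDU : forall x y, InDbeta a b B beta x y -> U (x, y).
Hypothesis Hg : smooth2_open U g11.
Hypothesis Hdiag : forall x y, InDbeta a b B beta x y -> g12 x y = 0 /\ g22 x y = 1 /\ 0 < g11 x y.

Lemma ct2_hat f : smooth2_open U f -> ct2 a b (fun s r => f s (c s * r)).
Proof.
  intros Hf. apply (ct2_smooth a b c U); auto; [lra |].
  intros s r Hs Hr. apply HDU. now apply (strip_in a b beta B).
Qed.

Lemma ct2_bilin (p1 p2 p3 q1 q2 q3 : R -> R -> R) :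
  ct2 a b p1 -> ct2 a b p2 -> ct2 a b p3 -> ct2 a b q1 -> ct2 a b q2 -> ct2 a b q3 ->
  ct2 a b (fun s r => bilin lam mu (g11 s (c s * r)) (p1 s r) (p2 s r) (p3 s r)
    (q1 s r) (q2 s r) (q3 s r) * sqrt (g11 s (c s * r)) * c s).
Proof.
  intros. pose proof (ct2_hat g11 Hg) as HG.
  assert (Hi : ct2 a b (fun s r => / g11 s (c s * r))).
  { apply ct2_inv; [lra | exact HG |]. intros s r Hs Hr.
    destruct (Hdiag _ _ (strip_in a b beta B Hcpos s r Hs Hr)) as [_ [_ H']]. fold (c s) in H'. lra. }
  assert (Hc' : ct2 a b (fun s _ => c s)) by (now apply ct2_s).
  assert (Hi2 : ct2 a b (fun s r => / g11 s (c s * r) ^ 2)).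
  { apply (ct2_ext a b (fun s r => (/ g11 s (c s * r)) ^ 2)); [lra | | ct2_tac].
    intros. apply pow_inv. }
  unfold bilin, Rdiv. ct2_tac.
Qed.

Lemma strain_energy_dbl P1 P2 : smooth2_open U P1 -> smooth2_open U P2 ->
  strain_energy a b B beta Y nu g11 g12 g22 P1 P2 =
  dbl a b (fun s r => / 2 * (bilin lam mu (g11 s (c s * r))
    (e00 g11 P1 P2 s (c s * r)) (e01 P1 P2 s (c s * r)) (e11 P1 P2 s (c s * r))
    (e00 g11 P1 P2 s (c s * r)) (e01 P1 P2 s (c s * r)) (e11 P1 P2 s (c s * r))
     * sqrt (g11 s (c s * r)) * c s)).
Proof.
  intros H1 H2.
  pose proof (ct2_hat _ Hg).
  pose proof (ct2_hat _ (smooth2_open_pd2 U P1 0 H1)). pose proof (ct2_hat _ (smooth2_open_pd2 U P1 1 H1)).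
  pose proof (ct2_hat _ (smooth2_open_pd2 U P2 0 H2)). pose proof (ct2_hat _ (smooth2_open_pd2 U P2 1 H2)).
  unfold strain_energy.
  transitivity (RInt (fun x => RInt (fun y => / 2 * bilin lam mu (g11 x y)
    (e00 g11 P1 P2 x y) (e01 P1 P2 x y) (e11 P1 P2 x y)
    (e00 g11 P1 P2 x y) (e01 P1 P2 x y) (e11 P1 P2 x y) * sqrt (g11 x y)) (- c x) (c x)) a b).
  - apply RInt_ext_R; [lra |]. intros s Hs. fold (c s). pose proof (Hcpos s Hs).
    apply RInt_ext_R; [lra |]. intros y Hy.
    destruct (Hdiag s y) as [D1 [D2 D3]].
    { split; [exact Hs |]. fold (c s). now apply Rabs_le. }
    now apply energy_density_diag.
  - rewrite (RInt_strip a b c (fun x y => / 2 * bilin lam mu (g11 x y)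
    (e00 g11 P1 P2 x y) (e01 P1 P2 x y) (e11 P1 P2 x y)
    (e00 g11 P1 P2 x y) (e01 P1 P2 x y) (e11 P1 P2 x y) * sqrt (g11 x y))); auto; [| lra |].
    + apply dbl_ext; [lra |]. intros. ring.
    + apply (ct2_ext a b (fun s r => / c s * / 2 * (bilin lam mu (g11 s (c s * r))
    (e00 g11 P1 P2 s (c s * r)) (e01 P1 P2 s (c s * r)) (e11 P1 P2 s (c s * r))
    (e00 g11 P1 P2 s (c s * r)) (e01 P1 P2 s (c s * r)) (e11 P1 P2 s (c s * r))
     * sqrt (g11 s (c s * r)) * c s))); [lra | |].
      * intros s r Hs Hr. pose proof (Hcpos s Hs). field. lra.
      * apply ct2_mult; [apply ct2_mult; [| apply ct2_const] |].
        -- apply ct2_inv; [lra | now apply ct2_s |]. intros s r Hs Hr. pose proof (Hcpos s Hs). lra.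
        -- apply ct2_bilin; unfold e00, e01, e11; ct2_tac.
Qed.

Variables (Phi1 Phi2 V1 V2 : R -> R -> R).
Hypothesis HP1 : smooth2_open U Phi1.
Hypothesis HP2 : smooth2_open U Phi2.
Hypothesis HV1 : smooth2_open U V1.
Hypothesis HV2 : smooth2_open U V2.
Hypothesis Hemb : is_embedding a b B beta Phi1 Phi2.
Hypothesis Hmin : forall Psi1 Psi2, is_embedding a b B beta Psi1 Psi2 ->
  strain_energy a b B beta Y nu g11 g12 g22 Phi1 Phi2
  <= strain_energy a b B beta Y nu g11 g12 g22 Psi1 Psi2.

(** The strain of Phi + t V is E + t E' + t^2 E2, with E2 quadratic in V, so the linear coefficient
    of the energy is the stiffness pairing of E with E'. By symmetry of the stress this is the first
    Piola-Kirchhoff stress paired with dV. *)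
Lemma first_variation :
  dbl a b (fun s r => let y := c s * r in
    ((s00 lam mu g11 Phi1 Phi2 s y * pd2 0 Phi1 s y + s01 mu g11 Phi1 Phi2 s y * pd2 1 Phi1 s y)
       * pd2 0 V1 s y +
     (s00 lam mu g11 Phi1 Phi2 s y * pd2 0 Phi2 s y + s01 mu g11 Phi1 Phi2 s y * pd2 1 Phi2 s y)
       * pd2 0 V2 s y +
     (s01 mu g11 Phi1 Phi2 s y * pd2 0 Phi1 s y + s11 lam mu g11 Phi1 Phi2 s y * pd2 1 Phi1 s y)
       * pd2 1 V1 s y +
     (s01 mu g11 Phi1 Phi2 s y * pd2 0 Phi2 s y + s11 lam mu g11 Phi1 Phi2 s y * pd2 1 Phi2 s y)
       * pd2 1 V2 s y) * sqrt (g11 s y) * c s) = 0.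
Proof.
  destruct (embedding_open a b beta B Hc Hcpos U Phi1 Phi2 V1 V2 HU HDU HP1 HP2 HV1 HV2 Hemb)
    as [t0 [Ht0 Hopen]].
  pose proof (ct2_hat _ Hg).
  pose proof (ct2_hat _ (smooth2_open_pd2 U Phi1 0 HP1)).
  pose proof (ct2_hat _ (smooth2_open_pd2 U Phi1 1 HP1)).
  pose proof (ct2_hat _ (smooth2_open_pd2 U Phi2 0 HP2)).
  pose proof (ct2_hat _ (smooth2_open_pd2 U Phi2 1 HP2)).
  pose proof (ct2_hat _ (smooth2_open_pd2 U V1 0 HV1)).
  pose proof (ct2_hat _ (smooth2_open_pd2 U V1 1 HV1)).
  pose proof (ct2_hat _ (smooth2_open_pd2 U V2 0 HV2)).
  pose proof (ct2_hat _ (smooth2_open_pd2 U V2 1 HV2)).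
  set (A := fun s r => e00 g11 Phi1 Phi2 s (c s * r)).
  set (K := fun s r => e01 Phi1 Phi2 s (c s * r)).
  set (C := fun s r => e11 Phi1 Phi2 s (c s * r)).
  set (A' := fun s r => pd2 0 Phi1 s (c s * r) * pd2 0 V1 s (c s * r) +
                        pd2 0 Phi2 s (c s * r) * pd2 0 V2 s (c s * r)).
  set (K' := fun s r => / 2 * (pd2 0 Phi1 s (c s * r) * pd2 1 V1 s (c s * r) +
                        pd2 1 Phi1 s (c s * r) * pd2 0 V1 s (c s * r) +
                        pd2 0 Phi2 s (c s * r) * pd2 1 V2 s (c s * r) +
                        pd2 1 Phi2 s (c s * r) * pd2 0 V2 s (c s * r))).
  set (C' := fun s r => pd2 1 Phi1 s (c s * r) * pd2 1 V1 s (c s * r) +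
                        pd2 1 Phi2 s (c s * r) * pd2 1 V2 s (c s * r)).
  set (A2 := fun s r => / 2 * (pd2 0 V1 s (c s * r) ^ 2 + pd2 0 V2 s (c s * r) ^ 2)).
  set (K2 := fun s r => / 2 * (pd2 0 V1 s (c s * r) * pd2 1 V1 s (c s * r) +
                               pd2 0 V2 s (c s * r) * pd2 1 V2 s (c s * r))).
  set (C2 := fun s r => / 2 * (pd2 1 V1 s (c s * r) ^ 2 + pd2 1 V2 s (c s * r) ^ 2)).
  assert (cA : ct2 a b A) by (unfold A, e00; ct2_tac).
  assert (cK : ct2 a b K) by (unfold K, e01; ct2_tac).
  assert (cC : ct2 a b C) by (unfold C, e11; ct2_tac).
  assert (cA' : ct2 a b A') by (unfold A'; ct2_tac).
  assert (cK' : ct2 a b K') by (unfold K'; ct2_tac).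
  assert (cC' : ct2 a b C') by (unfold C'; ct2_tac).
  assert (cA2 : ct2 a b A2) by (unfold A2; ct2_tac).
  assert (cK2 : ct2 a b K2) by (unfold K2; ct2_tac).
  assert (cC2 : ct2 a b C2) by (unfold C2; ct2_tac).
  set (Q := fun (p1 p2 p3 q1 q2 q3 : R -> R -> R) s r => bilin lam mu (g11 s (c s * r))
    (p1 s r) (p2 s r) (p3 s r) (q1 s r) (q2 s r) (q3 s r) * sqrt (g11 s (c s * r)) * c s).
  assert (cQ : forall p1 p2 p3 q1 q2 q3, ct2 a b p1 -> ct2 a b p2 -> ct2 a b p3 ->
    ct2 a b q1 -> ct2 a b q2 -> ct2 a b q3 -> ct2 a b (Q p1 p2 p3 q1 q2 q3))
    by (intros; now apply ct2_bilin).
  assert (Q1 : dbl a b (Q A K C A' K' C') = 0).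
  { apply (quartic_min (/ 2 * dbl a b (Q A K C A K C)) _
      (/ 2 * dbl a b (Q A' K' C' A' K' C') + dbl a b (Q A K C A2 K2 C2))
      (dbl a b (Q A' K' C' A2 K2 C2)) (/ 2 * dbl a b (Q A2 K2 C2 A2 K2 C2)) t0 Ht0).
    intros t Ht. specialize (Hmin _ _ (Hopen t Ht)).
    assert (W0 : strain_energy a b B beta Y nu g11 g12 g22 Phi1 Phi2 =
      / 2 * dbl a b (Q A K C A K C)).
    { rewrite strain_energy_dbl by assumption.
      apply (dbl_scal a b (/ 2) (Q A K C A K C)); [lra | now apply cQ]. }
    rewrite W0, strain_energy_dbl in Hmin by (auto; apply smooth2_open_plus; auto;
      now apply smooth2_open_scal).
    eapply Rle_trans; [exact Hmin |]. right.
    rewrite (dbl_ext a b _ (fun s r => / 2 * Q A K C A K C s r + (t * Q A K C A' K' C' s r +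
      (t ^ 2 * (/ 2 * Q A' K' C' A' K' C' s r + Q A K C A2 K2 C2 s r) +
       (t ^ 3 * Q A' K' C' A2 K2 C2 s r + t ^ 4 * (/ 2 * Q A2 K2 C2 A2 K2 C2 s r)))))); [| lra |].
    - assert (cS : forall k p1 p2 p3 q1 q2 q3, ct2 a b p1 -> ct2 a b p2 -> ct2 a b p3 ->
        ct2 a b q1 -> ct2 a b q2 -> ct2 a b q3 -> ct2 a b (fun s r => k * Q p1 p2 p3 q1 q2 q3 s r))
        by (intros; apply ct2_mult; [apply ct2_const | now apply cQ]).
      assert (c2 : ct2 a b (fun s r => / 2 * Q A' K' C' A' K' C' s r + Q A K C A2 K2 C2 s r))
        by (apply ct2_plus; [now apply cS | now apply cQ]).
      assert (c4 : ct2 a b (fun s r => / 2 * Q A2 K2 C2 A2 K2 C2 s r)) by (now apply cS).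
      assert (c2' : ct2 a b (fun s r => t ^ 2 * (/ 2 * Q A' K' C' A' K' C' s r + Q A K C A2 K2 C2 s r)))
        by (apply ct2_mult; [apply ct2_const | exact c2]).
      assert (c4' : ct2 a b (fun s r => t ^ 4 * (/ 2 * Q A2 K2 C2 A2 K2 C2 s r)))
        by (apply ct2_mult; [apply ct2_const | exact c4]).
      assert (c34 : ct2 a b (fun s r => t ^ 3 * Q A' K' C' A2 K2 C2 s r +
        t ^ 4 * (/ 2 * Q A2 K2 C2 A2 K2 C2 s r))) by (apply ct2_plus; [now apply cS | exact c4']).
      assert (c234 : ct2 a b (fun s r =>
        t ^ 2 * (/ 2 * Q A' K' C' A' K' C' s r + Q A K C A2 K2 C2 s r) +
       (t ^ 3 * Q A' K' C' A2 K2 C2 s r + t ^ 4 * (/ 2 * Q A2 K2 C2 A2 K2 C2 s r))))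
        by (apply ct2_plus; assumption).
      rewrite (dbl_plus a b (fun s r => / 2 * Q A K C A K C s r));
        [| lra | now apply cS | apply ct2_plus; [now apply cS | exact c234]].
      rewrite (dbl_plus a b (fun s r => t * Q A K C A' K' C' s r));
        [| lra | now apply cS | exact c234].
      rewrite (dbl_plus a b (fun s r =>
        t ^ 2 * (/ 2 * Q A' K' C' A' K' C' s r + Q A K C A2 K2 C2 s r))); [| lra | assumption ..].
      rewrite (dbl_plus a b (fun s r => t ^ 3 * Q A' K' C' A2 K2 C2 s r));
        [| lra | now apply cS | assumption].
      rewrite (dbl_scal a b (t ^ 2)), (dbl_scal a b (t ^ 4)) by (auto; lra).
      rewrite (dbl_plus a b (fun s r => / 2 * Q A' K' C' A' K' C' s r));
        [| lra | now apply cS | now apply cQ].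
      rewrite !(fun k p1 p2 p3 q1 q2 q3 => dbl_scal a b k (Q p1 p2 p3 q1 q2 q3)) by (auto; lra).
      ring.
    - intros s r Hs Hr. pose proof (strip_in a b beta B Hcpos s r Hs Hr) as Hin.
      destruct (Hdiag _ _ Hin) as [_ [_ HG]].
      apply HDU in Hin. fold (c s) in HG, Hin.
      unfold Q, bilin, A, K, C, e00, e01, e11.
      rewrite !(pd2_pencil U) by assumption. unfold A', K', C', A2, K2, C2.
      field. lra. }
  rewrite <- Q1. apply dbl_ext; [lra |]. intros s r Hs Hr.
  destruct (Hdiag _ _ (strip_in a b beta B Hcpos s r Hs Hr)) as [_ [_ HG]]. fold (c s) in HG.
  cbv zeta. unfold Q, bilin, A', K', C', s00, s01, s11. fold (A s r) (K s r) (C s r).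
  field. lra.
Qed.

End FirstVariation.

(** * Force, lateral and moment balance *)

(* The two columns of the first Piola-Kirchhoff stress, paired with one component Q of the map and
   weighted by the area density. *)
Definition axial lam mu (g11 P1 P2 Q : R -> R -> R) x y :=
  (s00 lam mu g11 P1 P2 x y * pd2 0 Q x y + s01 mu g11 P1 P2 x y * pd2 1 Q x y) * sqrt (g11 x y).
Definition lateral lam mu (g11 P1 P2 Q : R -> R -> R) x y :=
  (s01 mu g11 P1 P2 x y * pd2 0 Q x y + s11 lam mu g11 P1 P2 x y * pd2 1 Q x y) * sqrt (g11 x y).

Lemma Derive_monomial n x : Derive (fun t => t ^ n) x = INR n * x ^ pred n.
Proof.
  rewrite (Derive_pow (fun t => t)) by apply ex_derive_id. rewrite Derive_id. ring.
Qed.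

Lemma pd2_monomial m n d x y : pd2 d (fun x y => x ^ m * y ^ n) x y =
  if Nat.eqb d 0 then INR m * x ^ pred m * y ^ n else x ^ m * (INR n * y ^ pred n).
Proof.
  unfold pd2. destruct (Nat.eqb d 0).
  - rewrite (Derive_ext _ (fun t => y ^ n * t ^ m)) by (intros; ring).
    rewrite Derive_scal, Derive_monomial. ring.
  - rewrite Derive_scal, Derive_monomial. ring.
Qed.

Lemma pd2_zero d x y : pd2 d (fun _ _ => 0) x y = 0.
Proof. unfold pd2. destruct (Nat.eqb d 0); apply Derive_const. Qed.

Section Balance.

Variables (a b beta Y nu : R) (B : R -> R) (g11 g12 g22 : R -> R -> R).
Let c := fun x => beta * B x.
Let lam := lame_lambda Y nu.
Let mu := lame_mu Y nu.
Hypothesis Hab : a < b.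
Hypothesis Hc : ct1 a b c.
Hypothesis Hcpos : forall s, a <= s <= b -> 0 < c s.
Variable U : R * R -> Prop.
Hypothesis HU : open U.
Hypothesis HDU : forall x y, InDbeta a b B beta x y -> U (x, y).
Hypothesis Hg : smooth2_open U g11.
Hypothesis Hdiag : forall x y, InDbeta a b B beta x y -> g12 x y = 0 /\ g22 x y = 1 /\ 0 < g11 x y.
Variables (Phi1 Phi2 : R -> R -> R).
Hypothesis HP1 : smooth2_open U Phi1.
Hypothesis HP2 : smooth2_open U Phi2.
Hypothesis Hemb : is_embedding a b B beta Phi1 Phi2.
Hypothesis Hmin : forall Psi1 Psi2, is_embedding a b B beta Psi1 Psi2 ->
  strain_energy a b B beta Y nu g11 g12 g22 Phi1 Phi2
  <= strain_energy a b B beta Y nu g11 g12 g22 Psi1 Psi2.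

Let N Q s r := axial lam mu g11 Phi1 Phi2 Q s (c s * r).
Let L Q s r := lateral lam mu g11 Phi1 Phi2 Q s (c s * r).

Lemma weak_balance V1 V2 : smooth2_open U V1 -> smooth2_open U V2 ->
  dbl a b (fun s r => (N Phi1 s r * pd2 0 V1 s (c s * r) + N Phi2 s r * pd2 0 V2 s (c s * r) +
    L Phi1 s r * pd2 1 V1 s (c s * r) + L Phi2 s r * pd2 1 V2 s (c s * r)) * c s) = 0.
Proof.
  intros HV1 HV2.
  rewrite <- (first_variation a b beta Y nu B g11 g12 g22 Hab Hc Hcpos U HU HDU Hg Hdiag
    Phi1 Phi2 V1 V2 HP1 HP2 HV1 HV2 Hemb Hmin).
  apply dbl_ext; [lra |]. intros s r Hs Hr. unfold N, L, axial, lateral. cbv zeta.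
  fold (c s). fold lam mu. ring.
Qed.

Lemma ct2_stress :
  ct2 a b (fun s r => s00 lam mu g11 Phi1 Phi2 s (c s * r)) /\
  ct2 a b (fun s r => s01 mu g11 Phi1 Phi2 s (c s * r)) /\
  ct2 a b (fun s r => s11 lam mu g11 Phi1 Phi2 s (c s * r)).
Proof.
  pose proof (ct2_hat a b beta B Hab Hc Hcpos U HDU) as Hat. fold c in Hat.
  pose proof (Hat _ Hg).
  pose proof (Hat _ (smooth2_open_pd2 U Phi1 0 HP1)).
  pose proof (Hat _ (smooth2_open_pd2 U Phi1 1 HP1)).
  pose proof (Hat _ (smooth2_open_pd2 U Phi2 0 HP2)).
  pose proof (Hat _ (smooth2_open_pd2 U Phi2 1 HP2)).
  assert (HG : forall s r, a <= s <= b -> -1 <= r <= 1 -> g11 s (c s * r) <> 0).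
  { intros s r Hs Hr.
    destruct (Hdiag _ _ (strip_in a b beta B Hcpos s r Hs Hr)) as [_ [_ H']].
    fold (c s) in H'. lra. }
  assert (Hi : ct2 a b (fun s r => / g11 s (c s * r))) by (apply ct2_inv; auto; lra).
  assert (Hi2 : ct2 a b (fun s r => / g11 s (c s * r) ^ 2)).
  { apply (ct2_ext a b (fun s r => (/ g11 s (c s * r)) ^ 2)); [lra | | ct2_tac].
    intros. apply pow_inv. }
  unfold s00, s01, s11, e00, e01, e11, Rdiv. repeat split; ct2_tac.
Qed.

Lemma ct2_N Q : smooth2_open U Q -> ct2 a b (N Q) /\ ct2 a b (L Q).
Proof.
  intros HQ. destruct ct2_stress as [S1 [S2 S3]].
  pose proof (ct2_hat a b beta B Hab Hc Hcpos U HDU) as Hat. fold c in Hat.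
  pose proof (Hat _ Hg).
  pose proof (Hat _ (smooth2_open_pd2 U Q 0 HQ)).
  pose proof (Hat _ (smooth2_open_pd2 U Q 1 HQ)).
  unfold N, L, axial, lateral. split; ct2_tac.
Qed.

(** The factor (m + 1) s^m is the derivative of the axial profile s^(m+1) of a test field. Every
    monomial arises in this way up to a constant and no end condition restricts the fields, so all
    moments of c(s) times the resultant vanish, and the resultant is zero instead of merely
    constant. *)
Lemma pointwise_balance n : ct2 a b n ->
  (forall m, dbl a b (fun s r => INR (S m) * s ^ m * n s r * c s) = 0) ->
  forall s, a <= s <= b -> RInt (n s) (-1) 1 = 0.
Proof.
  intros Hn H s Hs.
  assert (Hz : c s * RInt (n s) (-1) 1 = 0).
  { apply (moments_zero a b (fun s => c s * RInt (n s) (-1) 1)); auto.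
    - apply ct1_mult; [exact Hc |]. apply ct2_inner; [lra | exact Hn].
    - intros m. apply Rmult_eq_reg_l with (INR (S m)); [| apply not_0_INR; lia].
      rewrite Rmult_0_r, <- (H m). rewrite <- RInt_scal_R.
      + apply RInt_ext_R; [lra |]. intros x Hx.
        rewrite (RInt_ext_R (fun r => INR (S m) * x ^ m * n x r * c x)
          (fun r => INR (S m) * x ^ m * c x * n x r)); [| lra | intros; ring].
        rewrite RInt_scal_R by (now apply (ct2_ex_inner a b)). ring.
      + apply ct1_ex_RInt; [lra |]. apply ct1_mult; [| apply ct1_pow, ct1_id].
        apply ct1_mult; [exact Hc |]. apply ct2_inner; [lra | exact Hn]. }
  apply Rmult_integral in Hz. pose proof (Hcpos s Hs). destruct Hz; lra.
Qed.

Lemma smooth2_open_monomial m n : smooth2_open U (fun x y => x ^ m * y ^ n).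
Proof.
  apply smooth2_open_mult; auto; apply (smooth2_open_pow U); auto;
    apply smooth2_open_x || apply smooth2_open_y.
Qed.

Lemma smooth2_open_xpow m : smooth2_open U (fun x y => x ^ m).
Proof. apply (smooth2_open_pow U (fun x _ => x)); auto. apply smooth2_open_x. Qed.

(** The test fields are translations, in either Cartesian direction, with axial profile u1^(m+1). *)
Lemma force_balance s : a <= s <= b ->
  RInt (N Phi1 s) (-1) 1 = 0 /\ RInt (N Phi2 s) (-1) 1 = 0.
Proof.
  intros Hs.
  split; (apply pointwise_balance; [now apply ct2_N | intros m | exact Hs]).
  (* The factor y ^ 0 gives the field the shape expected by [pd2_monomial]. *)
  - rewrite <- (weak_balance (fun x y => x ^ S m * y ^ 0) (fun _ _ => 0));
      [| apply smooth2_open_monomial | apply smooth2_open_const].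
    apply dbl_ext; [lra |]. intros x r Hx Hr. rewrite !pd2_monomial, !pd2_zero.
    cbn [Nat.eqb pred pow INR]. simpl (INR 0). ring.
  - rewrite <- (weak_balance (fun _ _ => 0) (fun x y => x ^ S m * y ^ 0));
      [| apply smooth2_open_const | apply smooth2_open_monomial].
    apply dbl_ext; [lra |]. intros x r Hx Hr. rewrite !pd2_monomial, !pd2_zero.
    cbn [Nat.eqb pred pow INR]. simpl (INR 0). ring.
Qed.

(** With exponent n + 1 in u2 the lateral derivative runs through all the powers u2^n, while the
    axial term keeps one more power of the thickness. *)
Lemma lateral_balance m n :
  dbl a b (fun s r => (INR m * s ^ pred m * (c s * r) ^ S n * N Phi1 s r
    + s ^ m * (INR (S n) * (c s * r) ^ n) * L Phi1 s r) * c s) = 0 /\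
  dbl a b (fun s r => (INR m * s ^ pred m * (c s * r) ^ S n * N Phi2 s r
    + s ^ m * (INR (S n) * (c s * r) ^ n) * L Phi2 s r) * c s) = 0.
Proof.
  split.
  - rewrite <- (weak_balance (fun x y => x ^ m * y ^ S n) (fun _ _ => 0));
      [| apply smooth2_open_monomial | apply smooth2_open_const].
    apply dbl_ext; [lra |]. intros x r Hx Hr. rewrite !pd2_monomial, !pd2_zero.
    cbn [Nat.eqb pred]. ring.
  - rewrite <- (weak_balance (fun _ _ => 0) (fun x y => x ^ m * y ^ S n));
      [| apply smooth2_open_const | apply smooth2_open_monomial].
    apply dbl_ext; [lra |]. intros x r Hx Hr. rewrite !pd2_monomial, !pd2_zero.
    cbn [Nat.eqb pred]. ring.
Qed.

(* Test with an infinitesimal rotation cut off in u^1: the remaining terms cancel because the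
   second Piola-Kirchhoff stress is symmetric. *)
Lemma moment_balance s : a <= s <= b ->
  RInt (fun r => N Phi2 s r * Phi1 s (c s * r) - N Phi1 s r * Phi2 s (c s * r)) (-1) 1 = 0.
Proof.
  intros Hs.
  apply (pointwise_balance (fun s r => N Phi2 s r * Phi1 s (c s * r) - N Phi1 s r * Phi2 s (c s * r)));
    [| intros m | exact Hs].
  - destruct (ct2_N Phi1 HP1) as [N1 _]. destruct (ct2_N Phi2 HP2) as [N2 _].
    pose proof (ct2_hat a b beta B Hab Hc Hcpos U HDU) as Hat. fold c in Hat.
    pose proof (Hat _ HP1). pose proof (Hat _ HP2). ct2_tac.
  - rewrite <- (weak_balance (fun x y => (-1 * x ^ S m) * Phi2 x y) (fun x y => x ^ S m * Phi1 x y)).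
    2: { apply (smooth2_open_mult U (fun x y => -1 * x ^ S m)); auto.
         apply (smooth2_open_scal U (-1) (fun x y => x ^ S m)); auto. apply smooth2_open_xpow. }
    2: { apply (smooth2_open_mult U (fun x y => x ^ S m)); auto. apply smooth2_open_xpow. }
    apply dbl_ext; [lra |]. intros x r Hx Hr.
    pose proof (HDU _ _ (strip_in a b beta B Hcpos x r Hx Hr)) as HUp. fold (c x) in HUp.
    assert (X1 : smooth2_open U (fun x y => -1 * x ^ S m)).
    { apply (smooth2_open_scal U (-1) (fun x y => x ^ S m)); auto. apply smooth2_open_xpow. }
    pose proof (smooth2_open_xpow (S m)) as X2.
    assert (P : forall d, pd2 d (fun x y => -1 * x ^ S m * Phi2 x y) x (c x * r) =
      pd2 d (fun x y => -1 * x ^ S m) x (c x * r) * Phi2 x (c x * r) +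
      -1 * x ^ S m * pd2 d Phi2 x (c x * r)).
    { intros d. apply (pd2_mult (fun x y => -1 * x ^ S m) Phi2).
      - exact (smooth2_open_ex U _ _ _ X1 HUp).
      - exact (smooth2_open_ex U _ _ _ HP2 HUp). }
    assert (P' : forall d, pd2 d (fun x y => x ^ S m * Phi1 x y) x (c x * r) =
      pd2 d (fun x y => x ^ S m) x (c x * r) * Phi1 x (c x * r) +
      x ^ S m * pd2 d Phi1 x (c x * r)).
    { intros d. apply (pd2_mult (fun x y => x ^ S m) Phi1).
      - exact (smooth2_open_ex U _ _ _ X2 HUp).
      - exact (smooth2_open_ex U _ _ _ HP1 HUp). }
    assert (Q : forall d, pd2 d (fun x y : R => x ^ S m) x (c x * r) =
      if Nat.eqb d 0 then INR (S m) * x ^ m else 0).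
    { intros d. unfold pd2. destruct (Nat.eqb d 0); [apply (Derive_monomial (S m)) | apply Derive_const]. }
    assert (Q' : forall d, pd2 d (fun x y : R => -1 * x ^ S m) x (c x * r) =
      if Nat.eqb d 0 then -1 * (INR (S m) * x ^ m) else 0).
    { intros d. unfold pd2. destruct (Nat.eqb d 0); [| apply Derive_const].
      rewrite Derive_scal. f_equal. apply (Derive_monomial (S m)). }
    rewrite !P, !P', !Q, !Q'. cbn [Nat.eqb]. unfold N, L, axial, lateral. ring.
Qed.

End Balance.

(** * Uniform expansions in the thickness *)

Section UniformBigO.

Variables a b : R.
Hypothesis Hab : a < b.

(** Uniform in (s, r) and on all of (0, 1], in contrast to [bigO0], so that the estimates survive
    integration over the strip. *)
Definition UO (n : nat) (f : R -> R -> R -> R) : Prop :=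
  exists C, forall be s r, 0 < be <= 1 -> a <= s <= b -> -1 <= r <= 1 ->
    Rabs (f be s r) <= C * be ^ n.

Lemma UO_ext n f g :
  (forall be s r, 0 < be <= 1 -> a <= s <= b -> -1 <= r <= 1 -> f be s r = g be s r) ->
  UO n f -> UO n g.
Proof. intros E [C H]. exists C. intros. rewrite <- E by assumption. now apply H. Qed.

Lemma UO_plus n f g : UO n f -> UO n g -> UO n (fun be s r => f be s r + g be s r).
Proof.
  intros [C H] [D K]. exists (C + D). intros be s r Hb Hs Hr.
  eapply Rle_trans; [apply Rabs_triang |].
  specialize (H be s r Hb Hs Hr). specialize (K be s r Hb Hs Hr). lra.
Qed.

Lemma UO_mult n m f g : UO n f -> UO m g -> UO (n + m) (fun be s r => f be s r * g be s r).
Proof.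
  intros [C H] [D K]. exists (C * D). intros be s r Hb Hs Hr.
  specialize (H be s r Hb Hs Hr). specialize (K be s r Hb Hs Hr).
  rewrite Rabs_mult, pow_add. replace (C * D * (be ^ n * be ^ m))
    with ((C * be ^ n) * (D * be ^ m)) by ring.
  apply Rmult_le_compat; try apply Rabs_pos; assumption.
Qed.

Lemma UO_opp n f : UO n f -> UO n (fun be s r => - f be s r).
Proof. intros [C H]. exists C. intros. rewrite Rabs_Ropp. now apply H. Qed.

Lemma UO_minus n f g : UO n f -> UO n g -> UO n (fun be s r => f be s r - g be s r).
Proof. intros H K. exact (UO_plus n _ _ H (UO_opp n g K)). Qed.

Lemma UO_weaken n m f : (m <= n)%nat -> UO n f -> UO m f.
Proof.
  intros Hmn [C H]. exists (Rabs C). intros be s r Hb Hs Hr.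
  eapply Rle_trans; [now apply H |].
  apply Rle_trans with (Rabs C * be ^ n).
  - apply Rmult_le_compat_r; [apply pow_le; lra | apply Rle_abs].
  - apply Rmult_le_compat_l; [apply Rabs_pos |].
    replace n with (m + (n - m))%nat by lia. rewrite pow_add.
    rewrite <- (Rmult_1_r (be ^ m)) at 2. apply Rmult_le_compat_l; [apply pow_le; lra |].
    apply Rle_trans with (1 ^ (n - m)); [apply pow_incr; lra | rewrite pow1; lra].
Qed.

Lemma UO_ct2 f : ct2 a b f -> UO 0 (fun _ => f).
Proof.
  intros H. destruct (ct2_bounded a b f H) as [M [_ HM]]. exists M.
  intros be s r _ Hs Hr. rewrite Rmult_1_r. now apply HM.
Qed.

Lemma UO_pow n : UO n (fun be _ _ => be ^ n).
Proof.
  exists 1. intros be s r Hb _ _. rewrite Rabs_pos_eq by (apply pow_le; lra). lra.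
Qed.

Lemma UO_bpow n f : ct2 a b f -> UO n (fun be s r => be ^ n * f s r).
Proof.
  intros H. rewrite <- (Nat.add_0_r n) at 1. apply UO_mult; [apply UO_pow | now apply UO_ct2].
Qed.

Lemma small_zero x C : (forall be, 0 < be <= 1 -> Rabs x <= C * be) -> x = 0.
Proof.
  intros H. destruct (Req_dec x 0) as [E | E]; [exact E | exfalso].
  pose proof (Rabs_pos_lt x E) as Hx. pose proof (H 1 ltac:(lra)) as H1.
  assert (HC : 0 < C) by lra.
  specialize (H (Rmin 1 (Rabs x / (2 * C)))).
  assert (0 < Rabs x / (2 * C)) by (apply Rdiv_lt_0_compat; lra).
  assert (H2 : Rabs x <= C * Rmin 1 (Rabs x / (2 * C))).
  { apply H. split; [apply Rmin_glb_lt; lra | apply Rmin_l]. }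
  assert (H3 : C * Rmin 1 (Rabs x / (2 * C)) <= C * (Rabs x / (2 * C)))
    by (apply Rmult_le_compat_l; [lra | apply Rmin_r]).
  replace (C * (Rabs x / (2 * C))) with (Rabs x / 2) in H3 by (field; lra). lra.
Qed.

(** [h] is the coefficient of beta^p; it may vanish, in which case [f] is of higher order. The error
    is a full order smaller, as in a Taylor expansion. *)
Definition approx (p : nat) (f : R -> R -> R -> R) (h : R -> R -> R) : Prop :=
  ct2 a b h /\ UO (S p) (fun be s r => f be s r - be ^ p * h s r).

Lemma approx_UO p f h : approx p f h -> UO p f.
Proof.
  intros [Hh H].
  apply (UO_ext p (fun be s r => (f be s r - be ^ p * h s r) + be ^ p * h s r));
    [intros; ring |].
  apply UO_plus; [apply (UO_weaken (S p)); [lia | exact H] | now apply UO_bpow].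
Qed.

Lemma approx_plus p f g h k : approx p f h -> approx p g k ->
  approx p (fun be s r => f be s r + g be s r) (fun s r => h s r + k s r).
Proof.
  intros [H1 H2] [K1 K2]. split; [now apply ct2_plus |].
  refine (UO_ext _ _ _ _ (UO_plus _ _ _ H2 K2)). intros. cbv beta. ring.
Qed.

Lemma approx_minus p f g h k : approx p f h -> approx p g k ->
  approx p (fun be s r => f be s r - g be s r) (fun s r => h s r - k s r).
Proof.
  intros [H1 H2] [K1 K2]. split; [now apply ct2_minus |].
  refine (UO_ext _ _ _ _ (UO_minus _ _ _ H2 K2)). intros. cbv beta. ring.
Qed.

Lemma approx_mult p q f g h k : approx p f h -> approx q g k ->
  approx (p + q) (fun be s r => f be s r * g be s r) (fun s r => h s r * k s r).
Proof.
  intros Hf Hg. pose proof (approx_UO q g k Hg) as Ug.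
  destruct Hf as [H1 H2]. destruct Hg as [K1 K2]. split; [now apply ct2_mult |].
  apply (UO_ext _ (fun be s r => (f be s r - be ^ p * h s r) * g be s r +
    (be ^ p * h s r) * (g be s r - be ^ q * k s r))).
  - intros. rewrite pow_add. ring.
  - apply UO_plus.
    + exact (UO_mult (S p) q _ _ H2 Ug).
    + replace (S (p + q)) with (p + 0 + S q)%nat by lia. apply UO_mult; [| exact K2].
      apply UO_mult; [apply UO_pow | now apply UO_ct2].
Qed.

Lemma approx_ct2 h : ct2 a b h -> approx 0 (fun _ => h) h.
Proof.
  intros H. split; [exact H |]. exists 0. intros. rewrite pow_O, Rmult_1_l, Rminus_diag, Rabs_R0. lra.
Qed.

Lemma approx_pow p : approx p (fun be _ _ => be ^ p) (fun _ _ => 1).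
Proof.
  split; [apply ct2_const |]. exists 0. intros. rewrite Rmult_1_r, Rminus_diag, Rabs_R0. lra.
Qed.

Lemma approx_ext p f g h :
  (forall be s r, 0 < be <= 1 -> a <= s <= b -> -1 <= r <= 1 -> f be s r = g be s r) ->
  approx p f h -> approx p g h.
Proof.
  intros E [H1 H2]. split; [exact H1 |]. refine (UO_ext _ _ _ _ H2). intros. now rewrite E.
Qed.

(** Integrating the expansion bounds beta^p times the integral of [h] by a multiple of beta^(p+1);
    division by beta^p leaves a constant bounded by a multiple of [beta]. *)
Lemma dbl_limit p f h : approx p f h ->
  (forall be, 0 < be <= 1 -> ct2 a b (f be) /\ dbl a b (f be) = 0) -> dbl a b h = 0.
Proof.
  intros [H1 [C H2]] H0.
  apply (small_zero _ ((b - a) * (2 * C))). intros be Hb. destruct (H0 be Hb) as [Hc Hz].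
  assert (Hpos : 0 < be ^ p) by (apply pow_lt; lra).
  apply Rmult_le_reg_l with (be ^ p); [exact Hpos |].
  rewrite <- (Rabs_pos_eq (be ^ p)) at 1 by lra. rewrite <- Rabs_mult.
  replace (be ^ p * dbl a b h) with (dbl a b (fun s r => be ^ p * h s r + -1 * f be s r)).
  2: { rewrite (dbl_plus a b (fun s r => be ^ p * h s r)), !dbl_scal, Hz; auto; try lra;
       apply ct2_mult; auto; apply ct2_const. }
  assert (K : ct2 a b (fun s r => be ^ p * h s r + -1 * f be s r))
    by (apply ct2_plus; apply ct2_mult; auto; apply ct2_const).
  replace (be ^ p * ((b - a) * (2 * C) * be)) with (dbl a b (fun _ _ => C * be ^ S p)).
  2: { rewrite dbl_const. simpl. ring. }
  apply Rabs_le. split.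
  - apply Rle_trans with (-1 * dbl a b (fun _ _ => C * be ^ S p)); [lra |].
    rewrite <- dbl_scal by (try apply ct2_const; lra).
    apply dbl_le; auto; try lra; [apply ct2_const |]. intros s r Hs Hr.
    specialize (H2 be s r Hb Hs Hr). apply Rabs_le_between in H2. lra.
  - apply dbl_le; auto; try lra; [apply ct2_const |]. intros s r Hs Hr.
    specialize (H2 be s r Hb Hs Hr). apply Rabs_le_between in H2. lra.
Qed.

Lemma RInt_limit p f h s : a <= s <= b -> approx p f h ->
  (forall be, 0 < be <= 1 -> ct2 a b (f be) /\ RInt (f be s) (-1) 1 = 0) -> RInt (h s) (-1) 1 = 0.
Proof.
  intros Hs [H1 [C H2]] H0.
  apply (small_zero _ (2 * C)). intros be Hb. destruct (H0 be Hb) as [Hc Hz].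
  assert (Hpos : 0 < be ^ p) by (apply pow_lt; lra).
  apply Rmult_le_reg_l with (be ^ p); [exact Hpos |].
  rewrite <- (Rabs_pos_eq (be ^ p)) at 1 by lra. rewrite <- Rabs_mult.
  pose proof (ct2_fix_s a b _ s Hs Hc) as Kf. pose proof (ct2_fix_s a b _ s Hs H1) as Kh.
  replace (be ^ p * RInt (h s) (-1) 1) with (RInt (fun r => be ^ p * h s r + -1 * f be s r) (-1) 1).
  2: { assert (ex_RInt (f be s) (-1) 1) by (apply ct1_ex_RInt; [lra | exact Kf]).
       assert (ex_RInt (h s) (-1) 1) by (apply ct1_ex_RInt; [lra | exact Kh]).
       rewrite (RInt_plus_R (fun r => be ^ p * h s r)), !RInt_scal_R, Hz by
         (assumption || (apply ct1_ex_RInt; [lra | now apply ct1_scal])).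
       rewrite Rmult_0_r, Rplus_0_r. reflexivity. }
  replace (be ^ p * (2 * C * be)) with ((1 - -1) * (C * be ^ S p)) by (simpl; ring).
  apply abs_RInt_le_const; [lra | |].
  - apply ct1_ex_RInt; [lra |]. apply ct1_plus; now apply ct1_scal.
  - intros r Hr. specialize (H2 be s r Hb Hs Hr).
    replace (be ^ p * h s r + -1 * f be s r) with (- (f be s r - be ^ p * h s r)) by ring.
    now rewrite Rabs_Ropp.
Qed.

(** By h^2 <= 2 f^2 + 2 (f - h)^2 the integral of h^2 is O(beta), hence zero, and h is continuous.
    This is how the energy bound becomes a pointwise statement. *)
Lemma square_limit f h C : approx 0 f h ->
  (forall be, 0 < be <= 1 -> ct2 a b (f be) /\ dbl a b (fun s r => f be s r ^ 2) <= C * be) ->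
  forall s r, a <= s <= b -> -1 <= r <= 1 -> h s r = 0.
Proof.
  intros [H1 [D H2]] H0 s r Hs Hr.
  assert (Hc2 : ct2 a b (fun s r => h s r ^ 2)) by (now apply ct2_pow).
  assert (Hpos : forall s r, a <= s <= b -> -1 <= r <= 1 -> 0 <= h s r ^ 2)
    by (intros; apply pow2_ge_0).
  enough (E : h s r ^ 2 = 0).
  { apply Rsqr_0_uniq. unfold Rsqr. rewrite <- E. ring. }
  apply (dbl_eq0 a b (fun s r => h s r ^ 2)); auto.
  apply Req_le, (small_zero _ (2 * C + (b - a) * (2 * (2 * D ^ 2)))). intros be Hb.
  rewrite Rabs_pos_eq.
  2: { replace 0 with (dbl a b (fun _ _ => 0)) by (rewrite dbl_const; ring).
       apply dbl_le; auto; try lra. apply ct2_const. }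
  destruct (H0 be Hb) as [Hc Hle].
  assert (Hf2 : ct2 a b (fun s r => 2 * f be s r ^ 2))
    by (apply ct2_mult; [apply ct2_const | now apply ct2_pow]).
  apply Rle_trans with (dbl a b (fun s r => 2 * f be s r ^ 2 + 2 * D ^ 2 * be)).
  - apply dbl_le; auto; try lra; [apply ct2_plus; [exact Hf2 | apply ct2_const] |].
    intros u v Hu Hv. specialize (H2 be u v Hb Hu Hv). rewrite pow_O, Rmult_1_l, pow_1 in H2.
    assert (H3 : (f be u v - h u v) ^ 2 <= (D * be) ^ 2).
    { rewrite <- pow2_abs. apply pow_incr. split; [apply Rabs_pos | exact H2]. }
    assert (H4 : (D * be) ^ 2 <= D ^ 2 * be).
    { replace ((D * be) ^ 2) with (D ^ 2 * (be * be)) by ring.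
      apply Rmult_le_compat_l; [apply pow2_ge_0 |]. nra. }
    assert (H5 : h u v ^ 2 <= 2 * f be u v ^ 2 + 2 * (f be u v - h u v) ^ 2).
    { pose proof (pow2_ge_0 (2 * f be u v - h u v)). nra. }
    lra.
  - rewrite (dbl_plus a b (fun s r => 2 * f be s r ^ 2) (fun _ _ => 2 * D ^ 2 * be));
      [| lra | exact Hf2 | apply ct2_const].
    rewrite dbl_scal; [| lra | now apply ct2_pow]. rewrite dbl_const. lra.
Qed.

(** * Second-order expansions in the thickness *)

Definition ex3 (f : R -> R -> R -> R) (f0 f1 f2 : R -> R -> R) : Prop :=
  ct2 a b f0 /\ ct2 a b f1 /\ ct2 a b f2 /\
  UO 3 (fun be s r => f be s r - (f0 s r + be * f1 s r + be ^ 2 * f2 s r)).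

Lemma ex3_plus f g f0 f1 f2 g0 g1 g2 : ex3 f f0 f1 f2 -> ex3 g g0 g1 g2 ->
  ex3 (fun be s r => f be s r + g be s r) (fun s r => f0 s r + g0 s r)
    (fun s r => f1 s r + g1 s r) (fun s r => f2 s r + g2 s r).
Proof.
  intros [F0 [F1 [F2 F3]]] [G0 [G1 [G2 G3]]].
  repeat (split; [now apply ct2_plus |]).
  refine (UO_ext _ _ _ _ (UO_plus _ _ _ F3 G3)). intros. cbv beta. ring.
Qed.

Lemma ex3_minus f g f0 f1 f2 g0 g1 g2 : ex3 f f0 f1 f2 -> ex3 g g0 g1 g2 ->
  ex3 (fun be s r => f be s r - g be s r) (fun s r => f0 s r - g0 s r)
    (fun s r => f1 s r - g1 s r) (fun s r => f2 s r - g2 s r).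
Proof.
  intros [F0 [F1 [F2 F3]]] [G0 [G1 [G2 G3]]].
  repeat (split; [now apply ct2_minus |]).
  refine (UO_ext _ _ _ _ (UO_minus _ _ _ F3 G3)). intros. cbv beta. ring.
Qed.

Lemma ex3_UO f f0 f1 f2 : ex3 f f0 f1 f2 -> UO 0 f.
Proof.
  intros [F0 [F1 [F2 F3]]].
  apply (UO_ext 0 (fun be s r => (f be s r - (f0 s r + be * f1 s r + be ^ 2 * f2 s r)) +
    ((be ^ 0 * f0 s r + be ^ 1 * f1 s r) + be ^ 2 * f2 s r))); [intros; simpl; ring |].
  apply UO_plus; [apply (UO_weaken 3); [lia | exact F3] |].
  apply UO_plus; [apply UO_plus |].
  - now apply UO_bpow.
  - apply (UO_weaken 1); [lia |]. now apply UO_bpow.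
  - apply (UO_weaken 2); [lia |]. now apply UO_bpow.
Qed.

Lemma ex3_poly f0 f1 f2 : ct2 a b f0 -> ct2 a b f1 -> ct2 a b f2 ->
  ex3 (fun be s r => f0 s r + be * f1 s r + be ^ 2 * f2 s r) f0 f1 f2.
Proof.
  intros. repeat (split; [assumption |]). exists 0. intros. rewrite Rminus_diag, Rabs_R0. lra.
Qed.

Lemma ex3_mult f g f0 f1 f2 g0 g1 g2 : ex3 f f0 f1 f2 -> ex3 g g0 g1 g2 ->
  ex3 (fun be s r => f be s r * g be s r) (fun s r => f0 s r * g0 s r)
    (fun s r => f0 s r * g1 s r + f1 s r * g0 s r)
    (fun s r => f0 s r * g2 s r + f1 s r * g1 s r + f2 s r * g0 s r).
Proof.
  intros Hf Hg. pose proof (ex3_UO _ _ _ _ Hg) as Ug.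
  destruct Hf as [F0 [F1 [F2 F3]]]. destruct Hg as [G0 [G1 [G2 G3]]].
  pose proof (ex3_UO _ _ _ _ (ex3_poly f0 f1 f2 F0 F1 F2)) as Uf.
  split; [now apply ct2_mult |]. split; [apply ct2_plus; now apply ct2_mult |].
  split; [apply ct2_plus; [apply ct2_plus |]; now apply ct2_mult |].
  apply (UO_ext 3 (fun be s r =>
    ((f be s r - (f0 s r + be * f1 s r + be ^ 2 * f2 s r)) * g be s r +
     (f0 s r + be * f1 s r + be ^ 2 * f2 s r) *
       (g be s r - (g0 s r + be * g1 s r + be ^ 2 * g2 s r))) +
    (be ^ 3 * (f1 s r * g2 s r + f2 s r * g1 s r) + be ^ 4 * (f2 s r * g2 s r)))).
  - intros. ring.
  - apply UO_plus; apply UO_plus.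
    + exact (UO_mult 3 0 _ _ F3 Ug).
    + exact (UO_mult 0 3 _ _ Uf G3).
    + apply UO_bpow. apply ct2_plus; now apply ct2_mult.
    + apply (UO_weaken 4); [lia |]. apply UO_bpow. now apply ct2_mult.
Qed.

Lemma ex3_ct2 f : ct2 a b f -> ex3 (fun _ => f) f (fun _ _ => 0) (fun _ _ => 0).
Proof.
  intros H. split; [exact H |]. split; [apply ct2_const |]. split; [apply ct2_const |].
  exists 0. intros. replace (f s r - (f s r + be * 0 + be ^ 2 * 0)) with 0 by ring.
  rewrite Rabs_R0. lra.
Qed.

Lemma ex3_ext f g f0 f1 f2 :
  (forall be s r, 0 < be <= 1 -> a <= s <= b -> -1 <= r <= 1 -> f be s r = g be s r) ->
  ex3 f f0 f1 f2 -> ex3 g f0 f1 f2.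
Proof.
  intros E [F0 [F1 [F2 F3]]]. repeat (split; [assumption |]).
  refine (UO_ext _ _ _ _ F3). intros. now rewrite E.
Qed.

Lemma ex3_approx0 f f0 f1 f2 : ex3 f f0 f1 f2 -> approx 0 f f0.
Proof.
  intros [F0 [F1 [F2 F3]]]. split; [exact F0 |].
  apply (UO_ext 1 (fun be s r => (f be s r - (f0 s r + be * f1 s r + be ^ 2 * f2 s r)) +
    (be ^ 1 * f1 s r + be ^ 2 * f2 s r))); [intros; ring |].
  apply UO_plus; [apply (UO_weaken 3); [lia | exact F3] |].
  apply UO_plus; [now apply UO_bpow |]. apply (UO_weaken 2); [lia |]. now apply UO_bpow.
Qed.

Lemma ex3_approx1 f f0 f1 f2 : ex3 f f0 f1 f2 ->
  (forall s r, a <= s <= b -> -1 <= r <= 1 -> f0 s r = 0) -> approx 1 f f1.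
Proof.
  intros [F0 [F1 [F2 F3]]] Z0. split; [exact F1 |].
  apply (UO_ext 2 (fun be s r => (f be s r - (f0 s r + be * f1 s r + be ^ 2 * f2 s r)) +
    be ^ 2 * f2 s r)); [intros; rewrite Z0 by assumption; ring |].
  apply UO_plus; [apply (UO_weaken 3); [lia | exact F3] |]. now apply UO_bpow.
Qed.

Lemma ex3_approx2 f f0 f1 f2 : ex3 f f0 f1 f2 ->
  (forall s r, a <= s <= b -> -1 <= r <= 1 -> f0 s r = 0) ->
  (forall s r, a <= s <= b -> -1 <= r <= 1 -> f1 s r = 0) -> approx 2 f f2.
Proof.
  intros [F0 [F1 [F2 F3]]] Z0 Z1. split; [exact F2 |].
  refine (UO_ext _ _ _ _ F3). intros. rewrite Z0, Z1 by assumption. ring.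
Qed.

Lemma approx_inv g m : 0 < m ->
  (forall be s r, 0 < be <= 1 -> a <= s <= b -> -1 <= r <= 1 -> m <= g be s r) ->
  approx 0 g (fun _ _ => 1) -> approx 0 (fun be s r => / g be s r) (fun _ _ => 1).
Proof.
  intros Hm Hg [_ [C H]]. split; [apply ct2_const |]. exists (C / m). intros be s r Hb Hs Hr.
  specialize (H be s r Hb Hs Hr). specialize (Hg be s r Hb Hs Hr).
  rewrite pow_O, Rmult_1_l in *.
  replace (/ g be s r - 1) with (- (g be s r - 1) * / g be s r) by (field; lra).
  rewrite Rabs_mult, Rabs_Ropp, (Rabs_pos_eq (/ g be s r)) by (apply Rlt_le, Rinv_0_lt_compat; lra).
  replace (C / m * be ^ 1) with ((C * be ^ 1) * / m) by (field; lra).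
  apply Rmult_le_compat; [apply Rabs_pos | apply Rlt_le, Rinv_0_lt_compat; lra | exact H |].
  apply Rinv_le_contravar; lra.
Qed.

Lemma approx_sqrt g :
  (forall be s r, 0 < be <= 1 -> a <= s <= b -> -1 <= r <= 1 -> 0 < g be s r) ->
  approx 0 g (fun _ _ => 1) -> approx 0 (fun be s r => sqrt (g be s r)) (fun _ _ => 1).
Proof.
  intros Hg [_ [C H]]. split; [apply ct2_const |]. exists C. intros be s r Hb Hs Hr.
  specialize (H be s r Hb Hs Hr). specialize (Hg be s r Hb Hs Hr).
  rewrite pow_O, Rmult_1_l in *. eapply Rle_trans; [| exact H].
  pose proof (sqrt_lt_R0 _ Hg) as Hq. pose proof (sqrt_sqrt (g be s r) ltac:(lra)) as E.
  rewrite <- E at 2. replace (sqrt (g be s r) * sqrt (g be s r) - 1)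
    with ((sqrt (g be s r) - 1) * (sqrt (g be s r) + 1)) by ring.
  rewrite Rabs_mult, (Rabs_pos_eq (sqrt (g be s r) + 1)) by lra.
  rewrite <- (Rmult_1_r (Rabs (sqrt (g be s r) - 1))) at 1.
  apply Rmult_le_compat_l; [apply Rabs_pos | lra].
Qed.

End UniformBigO.

(** * Balance laws at leading order *)

Lemma ct2_fix_r a b f r : a <= b -> -1 <= r <= 1 -> ct2 a b f -> ct1 a b (fun s => f s r).
Proof.
  intros Hab Hr H s. apply continuous_R_eps. intros eps He.
  destruct (ct2_eps a b f (clamp a b s) r (clamp_in a b s Hab) Hr H eps He) as [d [Hd H']].
  exists d. split; [exact Hd |]. intros y Hy. apply H'; auto.
  - now apply clamp_in.
  - pose proof (clamp_lip a b s y). lra.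
  - rewrite Rminus_diag, Rabs_R0. exact Hd.
Qed.

Section LeadingOrder.

Variables (a b lam mu nu : R) (B : R -> R).
Hypothesis Hab : a < b.
Hypothesis HB : ct1 a b B.
Hypothesis HBpos : forall s, a <= s <= b -> 0 < B s.
Hypothesis Hmu : mu <> 0.
Hypothesis Hlam : lam = nu * (lam + 2 * mu).
Hypothesis Hlm : 0 < lam + 2 * mu.
Hypothesis Hnu : -1 < nu < 1.

(** In normalized coordinates, (F1, F2) stands for Phi, (X1, X2) for d_1 Phi, (Z1, Z2) for d_2 Phi,
    and A, K, C for E_11, E_12, E_22. Only limits and balance laws are assumed, so that the same
    argument runs at every order [k] of the strain. *)
Variables (G X1 X2 Z1 Z2 F1 F2 A K C : R -> R -> R -> R).
Variables (x1 x2 z1 z2 : R -> R -> R).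
Let S00 be s r := (lam + 2 * mu) * A be s r / G be s r ^ 2 + lam * C be s r / G be s r.
Let S01 be s r := 2 * mu * K be s r / G be s r.
Let S11 be s r := (lam + 2 * mu) * C be s r + lam * A be s r / G be s r.
Let N (X Z : R -> R -> R -> R) be s r :=
  (S00 be s r * X be s r + S01 be s r * Z be s r) * sqrt (G be s r).
Let L (X Z : R -> R -> R -> R) be s r :=
  (S01 be s r * X be s r + S11 be s r * Z be s r) * sqrt (G be s r).

Variable m0 : R.
Hypothesis Hm0 : 0 < m0.
Hypothesis HGpos : forall be s r, 0 < be <= 1 -> a <= s <= b -> -1 <= r <= 1 -> m0 <= G be s r.
Hypothesis HG : approx a b 0 G (fun _ _ => 1).
Hypothesis HX1 : approx a b 0 X1 x1.
Hypothesis HX2 : approx a b 0 X2 x2.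
Hypothesis HZ1 : approx a b 0 Z1 z1.
Hypothesis HZ2 : approx a b 0 Z2 z2.
Hypothesis Hx : forall s r, a <= s <= b -> -1 <= r <= 1 -> x1 s r * x1 s r + x2 s r * x2 s r = 1.
Hypothesis Hz : forall s r, a <= s <= b -> -1 <= r <= 1 -> z1 s r * z1 s r + z2 s r * z2 s r = 1.
Hypothesis Hxz : forall s r, a <= s <= b -> -1 <= r <= 1 -> x1 s r * z1 s r + x2 s r * z2 s r = 0.
Hypothesis Hxr : forall s r, a <= s <= b -> -1 <= r <= 1 -> x1 s r = x1 s 0 /\ x2 s r = x2 s 0.
Hypothesis Hzr : forall s r, a <= s <= b -> -1 <= r <= 1 -> z1 s r = z1 s 0 /\ z2 s r = z2 s 0.
Hypothesis HD1 : approx a b 1 (fun be s r => F1 be s r - F1 be s 0) (fun s r => B s * r * z1 s r).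
Hypothesis HD2 : approx a b 1 (fun be s r => F2 be s r - F2 be s 0) (fun s r => B s * r * z2 s r).
Hypothesis HcF : forall be, 0 < be <= 1 -> ct2 a b (F1 be) /\ ct2 a b (F2 be).
Hypothesis HcN : forall be, 0 < be <= 1 -> ct2 a b (N X1 Z1 be) /\ ct2 a b (N X2 Z2 be) /\
  ct2 a b (L X1 Z1 be) /\ ct2 a b (L X2 Z2 be).
Hypothesis Hforce : forall be s, 0 < be <= 1 -> a <= s <= b ->
  RInt (N X1 Z1 be s) (-1) 1 = 0 /\ RInt (N X2 Z2 be s) (-1) 1 = 0.
Hypothesis Hmoment : forall be s, 0 < be <= 1 -> a <= s <= b ->
  RInt (fun r => N X2 Z2 be s r * F1 be s r - N X1 Z1 be s r * F2 be s r) (-1) 1 = 0.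
Hypothesis Hlateral : forall be m n, 0 < be <= 1 ->
  dbl a b (fun s r => (INR m * s ^ pred m * (be * B s * r) ^ S n * N X1 Z1 be s r
    + s ^ m * (INR (S n) * (be * B s * r) ^ n) * L X1 Z1 be s r) * (be * B s)) = 0 /\
  dbl a b (fun s r => (INR m * s ^ pred m * (be * B s * r) ^ S n * N X2 Z2 be s r
    + s ^ m * (INR (S n) * (be * B s * r) ^ n) * L X2 Z2 be s r) * (be * B s)) = 0.

Variables (k : nat) (ea ek ec : R -> R -> R).
Hypothesis HA : approx a b k A ea.
Hypothesis HK : approx a b k K ek.
Hypothesis HC : approx a b k C ec.

Let t00 s r := (lam + 2 * mu) * ea s r + lam * ec s r.
Let t01 s r := 2 * mu * ek s r.
Let t11 s r := (lam + 2 * mu) * ec s r + lam * ea s r.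

Lemma approx_scal p c f h : approx a b p f h ->
  approx a b p (fun be s r => c * f be s r) (fun s r => c * h s r).
Proof.
  intros H. apply (approx_mult a b 0 p (fun _ _ _ => c) f (fun _ _ => c) h); auto.
  apply (approx_ct2 a b (fun _ _ => c)), ct2_const.
Qed.

Lemma approx_limit_ext p f h h' : (forall s r, h s r = h' s r) -> approx a b p f h ->
  approx a b p f h'.
Proof.
  intros E H. replace h' with h; [exact H |].
  apply functional_extensionality; intros s. apply functional_extensionality; intros r. apply E.
Qed.

(** G = 1 + O(beta), so the metric factors leave the leading coefficients unchanged. *)
Lemma stress_leading : approx a b k S00 t00 /\ approx a b k S01 t01 /\ approx a b k S11 t11.
Proof.
  pose proof (approx_inv a b G m0 Hm0 HGpos HG) as Hi.
  assert (HiM : forall f h, approx a b k f h -> approx a b k (fun be s r => f be s r / G be s r) h).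
  { intros f h H. pose proof (approx_mult a b k 0 _ _ _ _ H Hi) as M.
    rewrite Nat.add_0_r in M. refine (approx_limit_ext _ _ _ _ _ M). intros. ring. }
  assert (HiM2 : forall f h, approx a b k f h ->
    approx a b k (fun be s r => f be s r / G be s r ^ 2) h).
  { intros f h H. refine (approx_ext a b k _ _ _ _ (HiM _ _ (HiM _ _ H))).
    intros be s r Hb Hs Hr. pose proof (HGpos be s r Hb Hs Hr). field. lra. }
  split; [| split].
  - exact (approx_plus a b k _ _ _ _ (HiM2 _ _ (approx_scal _ _ _ _ HA))
      (HiM _ _ (approx_scal _ _ _ _ HC))).
  - exact (HiM _ _ (approx_scal _ _ _ _ HK)).
  - exact (approx_plus a b k _ _ _ _ (approx_scal _ _ _ _ HC) (HiM _ _ (approx_scal _ _ _ _ HA))).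
Qed.

Lemma traction_leading X Z x z : approx a b 0 X x -> approx a b 0 Z z ->
  approx a b k (N X Z) (fun s r => t00 s r * x s r + t01 s r * z s r) /\
  approx a b k (L X Z) (fun s r => t01 s r * x s r + t11 s r * z s r).
Proof.
  intros HX HZ. destruct stress_leading as [H0 [H1 H2]].
  assert (Hq : approx a b 0 (fun be s r => sqrt (G be s r)) (fun _ _ => 1)).
  { apply approx_sqrt; auto. intros be s r Hb Hs Hr. pose proof (HGpos be s r Hb Hs Hr). lra. }
  assert (HM : forall f g h h', approx a b k f h -> approx a b 0 g h' ->
    approx a b k (fun be s r => f be s r * g be s r) (fun s r => h s r * h' s r)).
  { intros f g h h' Hf Hg. pose proof (approx_mult a b k 0 _ _ _ _ Hf Hg) as M.
    now rewrite Nat.add_0_r in M. }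
  split.
  - refine (approx_limit_ext _ _ _ _ _ (HM _ _ _ _ (approx_plus a b k _ _ _ _ (HM _ _ _ _ H0 HX)
      (HM _ _ _ _ H1 HZ)) Hq)). intros. cbv beta. ring.
  - refine (approx_limit_ext _ _ _ _ _ (HM _ _ _ _ (approx_plus a b k _ _ _ _ (HM _ _ _ _ H1 HX)
      (HM _ _ _ _ H2 HZ)) Hq)). intros. cbv beta. ring.
Qed.

Lemma ct2_B : ct2 a b (fun s _ => B s).
Proof. now apply ct2_s. Qed.

Lemma ct2_spow m : ct2 a b (fun s _ => s ^ m).
Proof. apply (ct2_s a b (fun s => s ^ m)), ct1_pow, ct1_id. Qed.

(** The axial term carries (be B r)^(n+1) and the lateral one (be B r)^n, so after division by the
    common power only the lateral column survives in the limit. It is then tested against s^m r^n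
    for all m and n, weighted by powers of B. *)
Lemma lateral_leading_zero X Z x z : approx a b 0 X x -> approx a b 0 Z z ->
  (forall be, 0 < be <= 1 -> ct2 a b (N X Z be) /\ ct2 a b (L X Z be)) ->
  (forall be m n, 0 < be <= 1 ->
    dbl a b (fun s r => (INR m * s ^ pred m * (be * B s * r) ^ S n * N X Z be s r
    + s ^ m * (INR (S n) * (be * B s * r) ^ n) * L X Z be s r) * (be * B s)) = 0) ->
  forall s r, a <= s <= b -> -1 <= r <= 1 -> t01 s r * x s r + t11 s r * z s r = 0.
Proof.
  intros HX HZ Hct Hbal.
  destruct (traction_leading X Z x z HX HZ) as [HN HL].
  set (l := fun s r => t01 s r * x s r + t11 s r * z s r) in *.
  pose proof ct2_B as cB.
  assert (cl : ct2 a b l) by apply HL.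
  assert (Hl : forall m n,
    dbl a b (fun s r => (INR (S n) * s ^ m * (B s * r) ^ n * B s) * l s r) = 0).
  { intros m n. pose proof (ct2_spow m) as cm. pose proof (ct2_spow (pred m)) as cm'.
    assert (c1 : ct2 a b (fun s r => INR (S n) * s ^ m * (B s * r) ^ n * B s)) by ct2_tac.
    assert (c2 : ct2 a b (fun s r => INR m * s ^ pred m * (B s * r) ^ S n * B s)) by ct2_tac.
    assert (T2 : approx a b (S n + k) (fun be s r =>
      (be ^ S n * (INR (S n) * s ^ m * (B s * r) ^ n * B s)) * L X Z be s r)
      (fun s r => (INR (S n) * s ^ m * (B s * r) ^ n * B s) * l s r)).
    { pose proof (approx_mult a b (S n) 0 _ _ _ _ (approx_pow a b (S n)) (approx_ct2 a b _ c1)) as M.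
      rewrite Nat.add_0_r in M.
      refine (approx_limit_ext _ _ _ _ _ (approx_mult a b _ _ _ _ _ _ M HL)).
      intros. cbv beta. ring. }
    assert (T1 : UO a b (S (S n + k)) (fun be s r =>
      (be ^ S (S n) * (INR m * s ^ pred m * (B s * r) ^ S n * B s)) * N X Z be s r)).
    { replace (S (S n + k)) with (S (S n) + k)%nat by lia.
      apply UO_mult; [now apply UO_bpow |]. now apply (approx_UO a b k _ _ HN). }
    (* The exponent n + 1 + k collects beta^n from u2^n, one factor from the area weight and beta^k
       from the strain. *)
    apply (dbl_limit a b Hab (S n + k) (fun be s r =>
      (INR m * s ^ pred m * (be * B s * r) ^ S n * N X Z be s r
      + s ^ m * (INR (S n) * (be * B s * r) ^ n) * L X Z be s r) * (be * B s))).
    - destruct T2 as [T2a T2b]. split; [exact T2a |].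
      refine (UO_ext a b _ _ _ _ (UO_plus a b _ _ _ T1 T2b)).
      intros. cbv beta.
      replace (be * B s * r) with (be * (B s * r)) by ring.
      rewrite (Rpow_mult_distr be (B s * r) (S n)), (Rpow_mult_distr be (B s * r) n).
      simpl. ring.
    - intros be Hb. split; [| now apply Hbal]. destruct (Hct be Hb) as [cN cL].
      ct2_tac. }
  intros s r Hs Hr.
  (* Moments in s at fixed n, where the positive weight B^(n+1) can be divided out; moments in r
     afterwards. *)
  assert (Hmom : forall n, forall s, a <= s <= b -> RInt (fun r => l s r * r ^ n) (-1) 1 = 0).
  { intros n. 
    assert (cln : ct2 a b (fun s r => l s r * r ^ n)) by ct2_tac.
    assert (E : forall s, a <= s <= b -> B s ^ S n * RInt (fun r => l s r * r ^ n) (-1) 1 = 0).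
    { apply (moments_zero a b (fun s => B s ^ S n * RInt (fun r => l s r * r ^ n) (-1) 1)); auto.
      - apply ct1_mult; [now apply ct1_pow |]. apply (ct2_inner a b (fun s r => l s r * r ^ n)); auto; lra.
      - intros m. apply Rmult_eq_reg_l with (INR (S n)); [| apply not_0_INR; lia].
        rewrite Rmult_0_r, <- (Hl m n), <- RInt_scal_R.
        + apply RInt_ext_R; [lra |]. intros u Hu.
          rewrite (RInt_ext_R (fun r => INR (S n) * u ^ m * (B u * r) ^ n * B u * l u r)
            (fun r => (INR (S n) * u ^ m * B u ^ S n) * (l u r * r ^ n))); [| lra |].
          * rewrite RInt_scal_R by (now apply (ct2_ex_inner a b (fun s r => l s r * r ^ n))). ring.
          * intros q _. rewrite Rpow_mult_distr. simpl. ring.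
        + apply ct1_ex_RInt; [lra |]. apply ct1_mult; [| apply ct1_pow, ct1_id].
          apply ct1_mult; [now apply ct1_pow |].
          apply (ct2_inner a b (fun s r => l s r * r ^ n)); auto; lra. }
    intros u Hu. specialize (E u Hu). apply Rmult_integral in E.
    destruct E as [E | E]; [| exact E]. pose proof (pow_lt (B u) (S n) (HBpos u Hu)). lra. }
  apply (moments_zero (-1) 1 (l s)); auto; [lra | now apply (ct2_fix_s a b)].
Qed.

(** Lateral balance in both Cartesian directions, projected on the orthonormal limit frame (x, z),
    gives S^12 = S^22 = 0 at order [k]. By [Hlam] the second equation reads E_22 = - nu E_11, and
    S^11 becomes a constant multiple of E_11. Since the frame does not depend on r, force and moment
    balance pass to E_11. *)
Lemma leading_order : forall s r, a <= s <= b -> -1 <= r <= 1 ->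
  ek s r = 0 /\ ec s r = - nu * ea s r /\
  RInt (ea s) (-1) 1 = 0 /\ RInt (fun r => ea s r * r) (-1) 1 = 0.
Proof.
  assert (Z0 : forall s r, a <= s <= b -> -1 <= r <= 1 -> t01 s r = 0 /\ t11 s r = 0).
  { intros s r Hs Hr.
    assert (E1 := lateral_leading_zero X1 Z1 x1 z1 HX1 HZ1
      (fun be Hb => conj (proj1 (HcN be Hb)) (proj1 (proj2 (proj2 (HcN be Hb)))))
      (fun be m n Hb => proj1 (Hlateral be m n Hb)) s r Hs Hr).
    assert (E2 := lateral_leading_zero X2 Z2 x2 z2 HX2 HZ2
      (fun be Hb => conj (proj1 (proj2 (HcN be Hb))) (proj2 (proj2 (proj2 (HcN be Hb)))))
      (fun be m n Hb => proj2 (Hlateral be m n Hb)) s r Hs Hr).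
    pose proof (Hx s r Hs Hr) as Ex. pose proof (Hz s r Hs Hr) as Ez.
    pose proof (Hxz s r Hs Hr) as Exz. split.
    - transitivity (t01 s r * (x1 s r * x1 s r + x2 s r * x2 s r)
        + t11 s r * (x1 s r * z1 s r + x2 s r * z2 s r)); [rewrite Ex, Exz; ring |].
      transitivity (x1 s r * (t01 s r * x1 s r + t11 s r * z1 s r)
        + x2 s r * (t01 s r * x2 s r + t11 s r * z2 s r)); [ring | rewrite E1, E2; ring].
    - transitivity (t11 s r * (z1 s r * z1 s r + z2 s r * z2 s r)
        + t01 s r * (x1 s r * z1 s r + x2 s r * z2 s r)); [rewrite Ez, Exz; ring |].
      transitivity (z1 s r * (t01 s r * x1 s r + t11 s r * z1 s r)
        + z2 s r * (t01 s r * x2 s r + t11 s r * z2 s r)); [ring | rewrite E1, E2; ring]. }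
  assert (Hc : forall s r, a <= s <= b -> -1 <= r <= 1 -> ec s r = - nu * ea s r).
  { intros s r Hs Hr. destruct (Z0 s r Hs Hr) as [_ E]. unfold t11 in E.
    apply Rmult_eq_reg_l with (lam + 2 * mu); [| lra].
    transitivity (- (nu * (lam + 2 * mu)) * ea s r); [rewrite <- Hlam; lra | ring]. }
  (* For the Lamé parameters of the theorem this constant is Young's modulus. *)
  assert (H00 : forall s r, a <= s <= b -> -1 <= r <= 1 ->
    t00 s r = ((lam + 2 * mu) * (1 - nu ^ 2)) * ea s r).
  { intros s r Hs Hr. unfold t00. rewrite (Hc s r Hs Hr).
    transitivity ((lam + 2 * mu) * ea s r - nu * (nu * (lam + 2 * mu)) * ea s r);
      [rewrite <- Hlam; ring | ring]. }
  assert (cea : ct2 a b ea) by apply HA.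
  destruct (traction_leading X1 Z1 x1 z1 HX1 HZ1) as [HN1 _].
  destruct (traction_leading X2 Z2 x2 z2 HX2 HZ2) as [HN2 _].
  assert (Hq : 0 < (lam + 2 * mu) * (1 - nu ^ 2)) by (apply Rmult_lt_0_compat; nra).
  intros s r Hs Hr. split; [| split; [now apply Hc | split]].
  - destruct (Z0 s r Hs Hr) as [E _]. unfold t01 in E.
    apply Rmult_integral in E. destruct E; [lra | assumption].
  - pose proof (RInt_limit a b k _ _ s Hs HN1 (fun be Hb =>
      conj (proj1 (HcN be Hb)) (proj1 (Hforce be s Hb Hs)))) as I1.
    pose proof (RInt_limit a b k _ _ s Hs HN2 (fun be Hb =>
      conj (proj1 (proj2 (HcN be Hb))) (proj2 (Hforce be s Hb Hs)))) as I2.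
    assert (P : forall x z i, (forall r, -1 <= r <= 1 -> x s r = i) ->
      RInt (fun r => t00 s r * x s r + t01 s r * z s r) (-1) 1 = 0 ->
      i * RInt (ea s) (-1) 1 = 0).
    { intros x z i Hi I. apply Rmult_eq_reg_l with ((lam + 2 * mu) * (1 - nu ^ 2)); [| lra].
      rewrite Rmult_0_r, <- I, <- Rmult_assoc, <- RInt_scal_R by (now apply (ct2_ex_inner a b)).
      apply RInt_ext_R; [lra |]. intros q Hq'. rewrite (H00 s q Hs Hq'), (Hi q Hq').
      destruct (Z0 s q Hs Hq') as [-> _]. ring. }
    apply (P x1 z1 (x1 s 0)) in I1; [| intros q Hq'; now apply Hxr].
    apply (P x2 z2 (x2 s 0)) in I2; [| intros q Hq'; now apply Hxr].
    pose proof (Hx s 0 Hs ltac:(lra)) as Ex.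
    (* The two components of the unit vector x cannot both vanish. *)
    apply Rmult_integral in I1, I2. destruct I1 as [I1 | I1]; [| exact I1].
    destruct I2 as [I2 | I2]; [| exact I2]. rewrite I1, I2 in Ex. lra.
  (* Subtracting the force balance times Phi(s, 0) moves the base point of the moment to the center
     curve; the lever arm is then O(beta), whence the order k + 1. *)
  - assert (HM : approx a b (k + 1) (fun be s r =>
      N X2 Z2 be s r * (F1 be s r - F1 be s 0) - N X1 Z1 be s r * (F2 be s r - F2 be s 0))
      (fun s r => (t00 s r * x2 s r + t01 s r * z2 s r) * (B s * r * z1 s r) -
                  (t00 s r * x1 s r + t01 s r * z1 s r) * (B s * r * z2 s r))).
    { exact (approx_minus a b (k + 1) _ _ _ _ (approx_mult a b k 1 _ _ _ _ HN2 HD1)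
        (approx_mult a b k 1 _ _ _ _ HN1 HD2)). }
    pose proof (RInt_limit a b (k + 1) _ _ s Hs HM) as I.
    assert (I' : RInt (fun r => (t00 s r * x2 s r + t01 s r * z2 s r) * (B s * r * z1 s r) -
                  (t00 s r * x1 s r + t01 s r * z1 s r) * (B s * r * z2 s r)) (-1) 1 = 0).
    { apply I. intros be Hb. destruct (HcN be Hb) as [c1 [c2 _]]. destruct (HcF be Hb) as [f1 f2].
      assert (f1' : ct2 a b (fun s _ => F1 be s 0))
        by (apply (ct2_s a b (fun s => F1 be s 0)), ct2_fix_r; auto; lra).
      assert (f2' : ct2 a b (fun s _ => F2 be s 0))
        by (apply (ct2_s a b (fun s => F2 be s 0)), ct2_fix_r; auto; lra).
      split; [ct2_tac |].
      destruct (Hforce be s Hb Hs) as [h1 h2]. pose proof (Hmoment be s Hb Hs) as h3.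
      rewrite (RInt_ext_R _ (fun r => (N X2 Z2 be s r * F1 be s r - N X1 Z1 be s r * F2 be s r) +
        ((- F1 be s 0) * N X2 Z2 be s r + F2 be s 0 * N X1 Z1 be s r))); [| lra | intros; ring].
      assert (x1' : ex_RInt (N X1 Z1 be s) (-1) 1) by (now apply (ct2_ex_inner a b)).
      assert (x2' : ex_RInt (N X2 Z2 be s) (-1) 1) by (now apply (ct2_ex_inner a b)).
      rewrite (RInt_plus_R (fun r => N X2 Z2 be s r * F1 be s r - N X1 Z1 be s r * F2 be s r)
        (fun r => (- F1 be s 0) * N X2 Z2 be s r + F2 be s 0 * N X1 Z1 be s r)).
      - rewrite (RInt_plus_R (fun r => (- F1 be s 0) * N X2 Z2 be s r)
          (fun r => F2 be s 0 * N X1 Z1 be s r)).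
        + rewrite !RInt_scal_R by assumption. rewrite h1, h2, h3, !Rmult_0_r, !Rplus_0_r.
          reflexivity.
        + apply (ex_RInt_scal (V := R_NormedModule)). exact x2'.
        + apply (ex_RInt_scal (V := R_NormedModule)). exact x1'.
      - apply (ct2_ex_inner a b (fun s r => N X2 Z2 be s r * F1 be s r - N X1 Z1 be s r * F2 be s r));
          [exact Hs |]. ct2_tac.
      - apply (ct2_ex_inner a b (fun s r => - F1 be s 0 * N X2 Z2 be s r + F2 be s 0 * N X1 Z1 be s r));
          [exact Hs |]. ct2_tac. }
    (* Up to sign, [w] is [B] times the determinant of the limit frame, nonzero by Lagrange's
       identity. *)
    set (w := B s * (x2 s 0 * z1 s 0 - x1 s 0 * z2 s 0)).
    assert (Hw : w <> 0).
    { unfold w. pose proof (HBpos s Hs).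
      pose proof (Hx s 0 Hs ltac:(lra)) as Ex. pose proof (Hz s 0 Hs ltac:(lra)) as Ez.
      pose proof (Hxz s 0 Hs ltac:(lra)) as Exz.
      intros E. apply Rmult_integral in E. destruct E as [E | E]; [lra |].
      assert (E2 : (x2 s 0 * z1 s 0 - x1 s 0 * z2 s 0) ^ 2 =
        (x1 s 0 * x1 s 0 + x2 s 0 * x2 s 0) * (z1 s 0 * z1 s 0 + z2 s 0 * z2 s 0)
        - (x1 s 0 * z1 s 0 + x2 s 0 * z2 s 0) ^ 2) by ring.
      rewrite E, Ex, Ez, Exz in E2. lra. }
    apply Rmult_eq_reg_l with ((lam + 2 * mu) * (1 - nu ^ 2) * w);
      [| apply Rmult_integral_contrapositive; split; [lra | exact Hw]].
    rewrite Rmult_0_r, <- I', <- RInt_scal_R.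
    + apply RInt_ext_R; [lra |]. intros q Hq'.
      rewrite (H00 s q Hs Hq'). destruct (Z0 s q Hs Hq') as [-> _].
      destruct (Hxr s q Hs Hq') as [-> ->]. destruct (Hzr s q Hs Hq') as [-> ->].
      unfold w. ring.
    + apply (ct2_ex_inner a b (fun s r => ea s r * r)); [exact Hs |]. ct2_tac.
Qed.

End LeadingOrder.

(** * The metric in the chart *)

(** Integration from 0 raises the power by one. The Taylor bounds iterate this with the constant
    kept coarse, since only orders matter. *)
Lemma integrate_bound (f df : R -> R) M n : 0 <= M ->
  (forall t, 0 <= t <= 1 -> is_derive f t (df t)) -> f 0 = 0 ->
  (forall t, 0 <= t <= 1 -> Rabs (df t) <= M * t ^ n) ->
  forall t, 0 <= t <= 1 -> Rabs (f t) <= M * t ^ S n.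
Proof.
  intros HM Hd H0 Hb t Ht.
  destruct (MVT_gen f 0 t df) as [x [Hx E]]; rewrite ?Rmin_left, ?Rmax_right in * by lra.
  - intros x Hx. apply Hd. lra.
  - intros x Hx. apply ex_derive_continuity_pt. exists (df x). apply Hd. lra.
  - rewrite H0, Rminus_0_r, Rminus_0_r in E. rewrite E, Rabs_mult, (Rabs_pos_eq t) by lra.
    replace (M * t ^ S n) with (M * t ^ n * t) by (simpl; ring).
    apply Rmult_le_compat_r; [lra |].
    apply Rle_trans with (1 := Hb x ltac:(lra)).
    apply Rmult_le_compat_l; [exact HM |]. apply pow_incr. lra.
Qed.

Lemma taylor3_bound (f0 f1 f2 f3 : R -> R) M : 0 <= M ->
  (forall t, 0 <= t <= 1 -> is_derive f0 t (f1 t) /\ is_derive f1 t (f2 t) /\ is_derive f2 t (f3 t)) ->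
  (forall t, 0 <= t <= 1 -> Rabs (f3 t) <= M) ->
  forall t, 0 <= t <= 1 -> Rabs (f0 t - (f0 0 + t * f1 0 + t ^ 2 * (f2 0 / 2))) <= M * t ^ 3.
Proof.
  intros HM Hd Hb.
  assert (B2 : forall t, 0 <= t <= 1 -> Rabs (f2 t - f2 0) <= M * t ^ 1).
  { apply (integrate_bound (fun t => f2 t - f2 0) f3 M 0); auto; [| ring |].
    - intros t Ht. destruct (Hd t Ht) as [_ [_ D]].
      rewrite <- (Rminus_0_r (f3 t)). apply (is_derive_minus (V := R_NormedModule)); [exact D |].
      apply (is_derive_const (V := R_NormedModule)).
    - intros t Ht. rewrite pow_O, Rmult_1_r. now apply Hb. }
  assert (B1 : forall t, 0 <= t <= 1 -> Rabs (f1 t - (f1 0 + t * f2 0)) <= M * t ^ 2).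
  { apply (integrate_bound _ (fun t => f2 t - f2 0) M 1); auto; [| ring].
    intros t Ht. destruct (Hd t Ht) as [_ [D _]].
    apply (is_derive_minus (V := R_NormedModule)); [exact D |].
    auto_derive; [trivial | ring]. }
  apply (integrate_bound (fun t => f0 t - (f0 0 + t * f1 0 + t ^ 2 * (f2 0 / 2)))
    (fun t => f1 t - (f1 0 + t * f2 0)) M 2); auto; [| field].
  intros t Ht. destruct (Hd t Ht) as [D _].
  apply (is_derive_minus (V := R_NormedModule)); [exact D |].
  auto_derive; [trivial | field].
Qed.

Lemma taylor4_bound (f0 f1 f2 f3 f4 : R -> R) M : 0 <= M ->
  (forall t, 0 <= t <= 1 -> is_derive f0 t (f1 t) /\ is_derive f1 t (f2 t) /\
     is_derive f2 t (f3 t) /\ is_derive f3 t (f4 t)) ->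
  (forall t, 0 <= t <= 1 -> Rabs (f4 t) <= M) ->
  forall t, 0 <= t <= 1 ->
    Rabs (f0 t - (f0 0 + t * f1 0 + t ^ 2 * (f2 0 / 2) + t ^ 3 * (f3 0 / 6))) <= M * t ^ 4.
Proof.
  intros HM Hd Hb.
  assert (B1 : forall t, 0 <= t <= 1 ->
    Rabs (f1 t - f3 0 / 2 * t ^ 2 - (f1 0 + t * f2 0)) <= M * t ^ 3).
  { intros t Ht.
    assert (B := taylor3_bound f1 f2 f3 f4 M HM
      (fun t Ht => proj2 (Hd t Ht)) Hb t Ht).
    replace (f1 t - f3 0 / 2 * t ^ 2 - (f1 0 + t * f2 0))
      with (f1 t - (f1 0 + t * f2 0 + t ^ 2 * (f3 0 / 2))) by field. exact B. }
  apply (integrate_bound (fun t => f0 t - (f0 0 + t * f1 0 + t ^ 2 * (f2 0 / 2) + t ^ 3 * (f3 0 / 6)))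
    (fun t => f1 t - f3 0 / 2 * t ^ 2 - (f1 0 + t * f2 0)) M 3); auto; [| field].
  intros t Ht. destruct (Hd t Ht) as [D _].
  replace (f1 t - f3 0 / 2 * t ^ 2 - (f1 0 + t * f2 0))
    with (f1 t - (f1 0 + t * f2 0 + f3 0 / 2 * t ^ 2)) by ring.
  apply (is_derive_minus (V := R_NormedModule)); [exact D |].
  auto_derive; [trivial | field].
Qed.

Lemma ex_derive_mult_R (f g : R -> R) x : ex_derive f x -> ex_derive g x ->
  ex_derive (fun t => f t * g t) x.
Proof. apply ex_derive_mult. Qed.
Lemma ex_derive_plus_R (f g : R -> R) x : ex_derive f x -> ex_derive g x ->
  ex_derive (fun t => f t + g t) x.
Proof. exact (ex_derive_plus (V := R_NormedModule) f g x). Qed.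
Lemma ex_derive_minus_R (f g : R -> R) x : ex_derive f x -> ex_derive g x ->
  ex_derive (fun t => f t - g t) x.
Proof. exact (ex_derive_minus (V := R_NormedModule) f g x). Qed.
Lemma ex_derive_opp_R (f : R -> R) x : ex_derive f x -> ex_derive (fun t => - f t) x.
Proof. exact (ex_derive_opp (V := R_NormedModule) f x). Qed.
Lemma ex_derive_pow_R (f : R -> R) n x : ex_derive f x -> ex_derive (fun t => f t ^ n) x.
Proof. exact (ex_derive_pow f n x). Qed.
Lemma ex_derive_div_R (f g : R -> R) x : ex_derive f x -> ex_derive g x -> g x <> 0 ->
  ex_derive (fun t => f t / g t) x.
Proof. exact (ex_derive_div f g x). Qed.

Ltac exd_tac := lazymatch goal with
  | H : ex_derive ?f ?x |- ex_derive ?f ?x => exact H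
  | |- ex_derive (fun _ => ?k) ?x => exact (ex_derive_const (V := R_NormedModule) k x)
  | |- ex_derive (fun t => @?f t + @?g t) ?x => refine (ex_derive_plus_R f g x _ _); exd_tac
  | |- ex_derive (fun t => @?f t - @?g t) ?x => refine (ex_derive_minus_R f g x _ _); exd_tac
  | |- ex_derive (fun t => - @?f t) ?x => refine (ex_derive_opp_R f x _); exd_tac
  | |- ex_derive (fun t => @?f t * @?g t) ?x => refine (ex_derive_mult_R f g x _ _); exd_tac
  | |- ex_derive (fun t => @?f t / @?g t) ?x => refine (ex_derive_div_R f g x _ _ _); [exd_tac | exd_tac |]
  | |- ex_derive (fun t => @?f t ^ ?n) ?x => refine (ex_derive_pow_R f n x _); exd_tac
  | |- _ => idtac
  end.

Section Metric.

Variables (a b : R) (B : R -> R) (g11 g12 g22 : R -> R -> R).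
Hypothesis Hchart : chart_hyp a b B g11 g12 g22.

Lemma chart_ab : a < b.
Proof. apply Hchart. Qed.

Lemma chart_B_pos x : a <= x <= b -> 0 < B x.
Proof. apply Hchart. Qed.

Lemma chart_B_ex_derive x : a <= x <= b -> ex_derive B x.
Proof.
  intros Hx. destruct Hchart as [_ [[U [_ [HU H]]] _]]. exact (H 0%nat x (HU x Hx)).
Qed.

Lemma chart_B_ct1 : ct1 a b B.
Proof.
  pose proof chart_ab. apply ct1_of_continuous; [lra |]. intros x Hx.
  exact (ex_derive_continuous (V := R_NormedModule) B x (chart_B_ex_derive x Hx)).
Qed.

Lemma chart_dB_ct1 : ct1 a b (Derive B).
Proof.
  pose proof chart_ab. apply ct1_of_continuous; [lra |]. intros x Hx.
  apply (ex_derive_continuous (V := R_NormedModule) (Derive B) x).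
  destruct Hchart as [_ [[U [_ [HU H']]] _]]. exact (H' 1%nat x (HU x Hx)).
Qed.

(** By continuity of [B], a short horizontal segment at an interior height stays in the domain; over
    an endpoint of I it is one-sided. The inequality is strict because at the upper and lower edges
    such a segment may leave the domain. *)
Lemma chart_line x y : a <= x <= b -> Rabs y < B x -> exists c d, c < d /\ c <= x <= d /\
  forall t, c <= t <= d -> a <= t <= b /\ - B t <= y <= B t.
Proof.
  intros Hx Hy. pose proof chart_ab as Hab.
  destruct (ct1_eps a b B x Hx chart_B_ct1 (B x - Rabs y)) as [del [Hd H]]; [lra |].
  exists (Rmax a (x - del / 2)), (Rmin b (x + del / 2)).
  assert (HH : a <= Rmax a (x - del / 2) /\ x - del / 2 <= Rmax a (x - del / 2) /\
    Rmax a (x - del / 2) <= x <= Rmin b (x + del / 2) /\ Rmin b (x + del / 2) <= b /\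
    Rmin b (x + del / 2) <= x + del / 2 /\ Rmax a (x - del / 2) < Rmin b (x + del / 2)).
  { unfold Rmax, Rmin. repeat destruct Rle_dec; lra. }
  split; [tauto |]. split; [tauto |]. intros t Ht.
  assert (Ht' : a <= t <= b) by lra. split; [exact Ht' |].
  assert (HB : Rabs (B t - B x) < B x - Rabs y) by (apply H; [exact Ht' | apply Rabs_def1; lra]).
  apply Rabs_def2 in HB. apply Rabs_le_between. lra.
Qed.

Lemma chart_open : exists U, open U /\ (forall x y, InD a b B x y -> U (x, y)) /\
  smooth2_open U g11 /\ smooth2_open U g12 /\ smooth2_open U g22.
Proof.
  destruct Hchart as [_ [_ [_ [H1 [H2 [H3 _]]]]]].
  apply smooth2_on_open in H1, H2, H3.
  destruct H1 as [U1 [O1 [S1 F1]]]. destruct H2 as [U2 [O2 [S2 F2]]].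
  destruct H3 as [U3 [O3 [S3 F3]]].
  exists (fun p => U1 p /\ (U2 p /\ U3 p)).
  split; [apply open_and; [exact O1 | now apply open_and] |].
  split; [intros; auto |].
  split; [| split]; (eapply smooth2_open_sub; [| eassumption]; simpl; tauto).
Qed.

(** The line t -> (x, t) has velocity d/du2, so its squared speed is g22. *)
Lemma metric_g22 x y : InD a b B x y -> g22 x y = 1.
Proof.
  intros [Hx Hy]. destruct Hchart as [_ [_ [_ [_ [_ [_ [_ [_ H]]]]]]]].
  destruct (H x Hx) as [_ Hu]. specialize (Hu y Hy). unfold sum2 in Hu. simpl in Hu.
  rewrite Derive_const, Derive_id in Hu. lra.
Qed.

Lemma metric_dx_zero f k x y : a <= x <= b -> Rabs y < B x ->
  (forall x y, InD a b B x y -> f x y = k) ->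
  (forall x y, InD a b B x y -> ex_derive (fun t => f t y) x) -> pd2 0 f x y = 0.
Proof.
  intros Hx Hy Hf He. destruct (chart_line x y Hx Hy) as [c [d [Hcd [Hin H]]]].
  change (Derive (fun t => f t y) x = 0). transitivity (Derive (fun _ => k) x); [| apply Derive_const].
  apply (Derive_eq_on_interval c d); auto.
  - apply He. now apply H.
  - apply ex_derive_const.
  - intros t Ht. apply Hf. now apply H.
Qed.

Lemma metric_dy_zero f k x y : a <= x <= b -> Rabs y < B x ->
  (forall x y, InD a b B x y -> f x y = k) -> pd2 1 f x y = 0.
Proof.
  intros Hx Hy Hf. change (Derive (fun t => f x t) y = 0). transitivity (Derive (fun _ => k) y); [| apply Derive_const].
  apply Derive_ext_loc. assert (Hp : 0 < B x - Rabs y) by lra.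
  exists (mkposreal _ Hp). intros t Ht. apply Hf. split; [exact Hx |].
  change (Rabs (t - y) < B x - Rabs y) in Ht. apply Rabs_le_between.
  replace t with ((t - y) + y) by ring. eapply Rle_trans; [apply Rabs_triang | lra].
Qed.

(** The Gauss lemma. The geodesic equation of the coordinate lines says Gamma^k_22 = 0 for both k.
    Since d_1 g22 = 0, the inverse metric annihilates the covector (d_2 g12, d_2 g22 / 2), so d_2
    g12 = 0; and g12 vanishes on the center curve. *)
Lemma metric_g12 x y : InD a b B x y -> g12 x y = 0.
Proof.
  intros [Hx Hy]. pose proof (chart_B_pos x Hx) as HBx.
  destruct chart_open as [U [_ [HU [S1 [S2 S3]]]]].
  (* Only interior heights: d_1 g22 = 0 is available there, and the mean value theorem asks for the
     derivative on an open interval. *)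
  assert (D0 : forall t, Rabs t < B x -> pd2 1 g12 x t = 0).
  { intros t Ht.
    assert (Ht' : - B x <= t <= B x) by (apply Rabs_le_between; lra).
    assert (E22 : pd2 0 g22 x t = 0).
    { apply (metric_dx_zero g22 1); auto; [apply metric_g22 |].
      intros u v Huv. apply (smooth2_open_ex U g22 u v S3 (HU u v Huv)). }
    destruct Hchart as [_ [_ [_ [_ [_ [_ [Hdet [_ H]]]]]]]].
    destruct (Hdet x t (conj Hx Ht')) as [Hg Hd].
    destruct (H x Hx) as [Hgeo _]. specialize (Hgeo t Ht').
    pose proof (Hgeo 0%nat ltac:(lia)) as K0. pose proof (Hgeo 1%nat ltac:(lia)) as K1.
    clear Hgeo. unfold sum2 in K0, K1. cbn [Nat.eqb] in K0, K1.
    rewrite (Derive_n_const 1) in K0.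
    assert (E1 : Derive_n (fun t => t) 2 t = 0).
    { simpl. rewrite (Derive_ext _ (fun _ => 1)); [apply Derive_const | intros; apply Derive_id]. }
    rewrite E1 in K1. rewrite !Derive_const, !Derive_id in K0, K1.
    assert (G0 : Gam g11 g12 g22 0 1 1 x t = 0) by lra.
    assert (G1 : Gam g11 g12 g22 1 1 1 x t = 0) by lra.
    clear K0 K1. unfold Gam, sum2, gm, ginv in G0, G1. rewrite E22 in G0, G1.
    set (d := detg g11 g12 g22 x t) in *. set (p := pd2 1 g12 x t) in *.
    set (w := pd2 1 g22 x t) in *.
    assert (E : d * p = 0).
    { assert (F0 : g22 x t * (p + p) + - g12 x t * w = 0).
      { transitivity (2 * d * (/ 2 * (g22 x t / d * (p + p - 0) + - g12 x t / d * (w + w - w))));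
          [field; lra | rewrite G0; ring]. }
      assert (F1 : - g12 x t * (p + p) + g11 x t * w = 0).
      { transitivity (2 * d * (/ 2 * (- g12 x t / d * (p + p - 0) + g11 x t / d * (w + w - w))));
          [field; lra | rewrite G1; ring]. }
      (* Cramer's rule for the two linear equations in d_2 g12 and d_2 g22. *)
      assert (F2 : 2 * (d * p) = g11 x t * (g22 x t * (p + p) + - g12 x t * w)
        + g12 x t * (- g12 x t * (p + p) + g11 x t * w)) by (unfold d, detg; ring).
      rewrite F0, F1 in F2. lra. }
    apply Rmult_integral in E. destruct E; [lra | assumption]. }
  assert (H0 : g12 x 0 = 0).
  { destruct Hchart as [_ [_ [_ [_ [_ [_ [_ [H _]]]]]]]]. now apply (H x Hx). }
  destruct (MVT_gen (fun t => g12 x t) 0 y (fun t => 0)) as [z [_ E]].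
  - intros t Ht. rewrite <- (D0 t).
    + apply Derive_correct. apply (smooth2_open_ex U g12 x t S2), HU. split; [exact Hx |].
      unfold Rmin, Rmax in Ht. destruct Rle_dec; lra.
    + apply Rabs_def1; unfold Rmin, Rmax in Ht; destruct Rle_dec; lra.
  - intros t Ht. apply (ex_derive_continuity_pt (fun t => g12 x t)).
    apply (smooth2_open_ex U g12 x t S2), HU. split; [exact Hx |].
    unfold Rmin, Rmax in Ht. destruct Rle_dec; lra.
  - cbv beta in E. lra.
Qed.

Lemma metric_diag x y : InD a b B x y -> g12 x y = 0 /\ g22 x y = 1 /\ 0 < g11 x y.
Proof.
  intros H. split; [now apply metric_g12 |]. split; [now apply metric_g22 |].
  destruct Hchart as [_ [_ [_ [_ [_ [_ [Hdet _]]]]]]]. now apply Hdet.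
Qed.

Lemma metric_center s : a <= s <= b -> g11 s 0 = 1.
Proof. destruct Hchart as [_ [_ [_ [_ [_ [_ [_ [H _]]]]]]]]. intros Hs. now apply (H s Hs). Qed.

Lemma in_strip s y : a <= s <= b -> Rabs y < B s -> InD a b B s y.
Proof. intros Hs Hy. split; [exact Hs |]. apply Rabs_le_between. lra. Qed.

(** For the metric G du1^2 + du2^2 one has Gamma^1_12 = G_2 / (2 G) and Gamma^k_22 = 0 for k = 1, 2,
    so K = - d_2 Gamma^1_12 - (Gamma^1_12)^2. This is the classical - (sqrt G)_22 / sqrt G,
    evaluated where G = 1. *)
Lemma gaussK_center s : a <= s <= b ->
  gaussK g11 g12 g22 s 0 = - / 2 * pd2 1 (pd2 1 g11) s 0 + / 4 * pd2 1 g11 s 0 ^ 2.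
Proof.
  intros Hs. pose proof (chart_B_pos s Hs) as HBs. pose proof chart_ab as Hab.
  destruct chart_open as [U [HUo [HU [S1 [S2 S3]]]]].
  assert (Hin : forall x, a <= x <= b -> InD a b B x 0).
  { intros x Hx. apply in_strip; auto. rewrite Rabs_R0. now apply chart_B_pos. }
  pose proof (HU _ _ (Hin s Hs)) as HUs.
  assert (Hy0 : forall x, a <= x <= b -> Rabs 0 < B x)
    by (intros; rewrite Rabs_R0; now apply chart_B_pos).
  assert (P12x : forall x y, a <= x <= b -> Rabs y < B x -> pd2 0 g12 x y = 0).
  { intros x y Hx Hy. apply (metric_dx_zero g12 0); auto; [apply metric_g12 |].
    intros u v Huv. apply (smooth2_open_ex U g12 u v S2 (HU u v Huv)). }
  assert (P22x : forall x y, a <= x <= b -> Rabs y < B x -> pd2 0 g22 x y = 0).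
  { intros x y Hx Hy. apply (metric_dx_zero g22 1); auto; [apply metric_g22 |].
    intros u v Huv. apply (smooth2_open_ex U g22 u v S3 (HU u v Huv)). }
  assert (P12y : forall x y, a <= x <= b -> Rabs y < B x -> pd2 1 g12 x y = 0).
  { intros x y Hx Hy. apply (metric_dy_zero g12 0); auto. apply metric_g12. }
  assert (P22y : forall x y, a <= x <= b -> Rabs y < B x -> pd2 1 g22 x y = 0).
  { intros x y Hx Hy. apply (metric_dy_zero g22 1); auto. apply metric_g22. }
  assert (P11x : pd2 0 g11 s 0 = 0).
  { change (Derive (fun t => g11 t 0) s = 0). transitivity (Derive (fun _ => 1) s); [| apply Derive_const].
    apply (Derive_eq_on_interval a b); auto.
    - apply (smooth2_open_ex U g11 s 0 S1 HUs).
    - apply ex_derive_const.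
    - intros. now apply metric_center. }
  assert (Gm : forall x y, a <= x <= b -> Rabs y < B x ->
    Gam g11 g12 g22 0 0 1 x y = / 2 * (pd2 1 g11 x y / g11 x y) /\
    Gam g11 g12 g22 0 1 0 x y = / 2 * (pd2 1 g11 x y / g11 x y) /\
    Gam g11 g12 g22 0 1 1 x y = 0 /\ Gam g11 g12 g22 1 1 1 x y = 0).
  { intros x y Hx Hy. destruct (metric_diag x y (in_strip x y Hx Hy)) as [D1 [D2 D3]].
    destruct (ginv_diag g11 g12 g22 x y D1 D2 D3) as [I1 [I2 [I3 I4]]].
    unfold Gam, sum2, gm. rewrite I1, I2, I3, I4.
    rewrite (P12x x y), (P12y x y), (P22x x y), (P22y x y) by assumption.
    repeat split; field; lra. }
  destruct (metric_diag s 0 (Hin s Hs)) as [D1 [D2 D3]].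
  destruct (Gm s 0 Hs (Hy0 s Hs)) as [G1 [G2 [G3 G4]]].
  unfold gaussK, Riem. unfold sum2 at 1. cbn [gm].
  rewrite D1. unfold detg. rewrite D1, D2, (metric_center s Hs).
  (* Gamma^1_22 is known to vanish for u1 in [a, b] only; at the ends its derivative is controlled
     through differentiability of the extended metric. *)
  assert (T1 : pd2 0 (Gam g11 g12 g22 0 1 1) s 0 = 0).
  { change (Derive (fun t => Gam g11 g12 g22 0 1 1 t 0) s = 0). transitivity (Derive (fun _ => 0) s); [| apply Derive_const].
    apply (Derive_eq_on_interval a b); auto; [| apply ex_derive_const |].
    - unfold Gam, sum2, gm, ginv, detg.
      pose proof (proj1 (smooth2_open_ex U _ s 0 S1 HUs)).
      pose proof (proj1 (smooth2_open_ex U _ s 0 S2 HUs)).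
      pose proof (proj1 (smooth2_open_ex U _ s 0 S3 HUs)).
      pose proof (proj1 (smooth2_open_ex U _ s 0 (smooth2_open_pd2 U _ 1 S2) HUs)).
      pose proof (proj1 (smooth2_open_ex U _ s 0 (smooth2_open_pd2 U _ 0 S3) HUs)).
      pose proof (proj1 (smooth2_open_ex U _ s 0 (smooth2_open_pd2 U _ 1 S3) HUs)).
      exd_tac; rewrite D1, D2; lra.
    - intros t Ht. now apply (Gm t 0 Ht (Hy0 t Ht)). }
  assert (T2 : pd2 1 (Gam g11 g12 g22 0 0 1) s 0 =
    / 2 * (pd2 1 (pd2 1 g11) s 0 - pd2 1 g11 s 0 ^ 2)).
  { change (Derive (fun t => Gam g11 g12 g22 0 0 1 s t) 0 =
      / 2 * (pd2 1 (pd2 1 g11) s 0 - pd2 1 g11 s 0 ^ 2)).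
    rewrite (Derive_ext_loc _ (fun t => / 2 * (pd2 1 g11 s t / g11 s t))).
    - rewrite Derive_scal, Derive_div.
      + cbv beta. rewrite (metric_center s Hs).
        change (Derive (pd2 1 g11 s) 0) with (pd2 1 (pd2 1 g11) s 0).
        change (Derive (g11 s) 0) with (pd2 1 g11 s 0). field.
      + apply (smooth2_open_ex U _ s 0 (smooth2_open_pd2 U _ 1 S1) HUs).
      + apply (smooth2_open_ex U _ s 0 S1 HUs).
      + lra.
    - exists (mkposreal _ HBs). intros t Ht. apply Gm; [exact Hs |].
      change (Rabs (t - 0) < B s) in Ht. now rewrite Rminus_0_r in Ht. }
  rewrite T1, T2. unfold sum2. rewrite G1, G2, G3, G4, (metric_center s Hs). field.
Qed.

(** At fixed (s, r) this is Taylor's formula along the segment t -> (s, t k) with k = B(s) r; each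
    derivative brings a factor k. *)
Lemma metric_expansion : ex3 a b (fun be s r => g11 s (be * B s * r)) (fun _ _ => 1)
  (fun s r => B s * r * pd2 1 g11 s 0) (fun s r => (B s * r) ^ 2 * pd2 1 (pd2 1 g11) s 0 / 2).
Proof.
  pose proof chart_ab as Hab.
  destruct chart_open as [U [HUo [HU [S1 [S2 S3]]]]].
  assert (Hin : forall s r, a <= s <= b -> -1 <= r <= 1 -> InD a b B s (B s * r)).
  { intros s r Hs Hr. split; [exact Hs |]. pose proof (chart_B_pos s Hs). split; nra. }
  assert (cB : ct2 a b (fun s _ => B s)) by (apply ct2_s, chart_B_ct1).
  assert (c0 : ct1 a b (fun _ => 0)) by (apply ct1_const).
  assert (Hz : forall f, smooth2_open U f -> ct2 a b (fun s _ => f s 0)).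
  { intros f Hf. apply (ct2_ext a b (fun s r => f s (0 * r))); [lra | intros; now rewrite Rmult_0_l |].
    apply (ct2_smooth a b (fun _ => 0) U); auto; [lra |]. intros s r Hs Hr. apply HU.
    replace (0 * r) with (B s * 0) by ring. apply Hin; lra. }
  pose proof (Hz _ (smooth2_open_pd2 U _ 1 S1)) as c1.
  pose proof (Hz _ (smooth2_open_pd2 U _ 1 (smooth2_open_pd2 U _ 1 S1))) as c2.
  split; [apply ct2_const |]. split; [ct2_tac |]. split; [unfold Rdiv; ct2_tac |].
  pose proof (smooth2_open_pd2 U _ 1 S1) as S1'.
  pose proof (smooth2_open_pd2 U _ 1 S1') as S1''.
  pose proof (smooth2_open_pd2 U _ 1 S1'') as S1'''.
  destruct (ct2_bounded a b _ cB) as [MB [HMB HB]].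
  destruct (ct2_bounded a b (fun s r => pd2 1 (pd2 1 (pd2 1 g11)) s (B s * r))) as [M [HM Hbd]].
  { apply (ct2_smooth a b B U); auto; [lra | apply chart_B_ct1]. }
  exists (MB ^ 3 * M). intros be s r Hb Hs Hr.
  set (k := B s * r).
  assert (Hk : Rabs k <= MB).
  { unfold k. rewrite Rabs_mult. rewrite <- (Rmult_1_r MB).
    apply Rmult_le_compat; try apply Rabs_pos; [now apply (HB s r) | now apply Rabs_le]. }
  assert (HinU : forall t, 0 <= t <= 1 -> U (s, t * k)).
  { intros t Ht. apply HU. unfold k. replace (t * (B s * r)) with (B s * (t * r)) by ring.
    apply Hin; auto. nra. }
  assert (Hder : forall f, smooth2_open U f -> forall n t, 0 <= t <= 1 ->
    is_derive (fun t => k ^ n * f s (t * k)) t (k ^ S n * pd2 1 f s (t * k))).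
  { intros f Hf n t Ht.
    replace (k ^ S n * pd2 1 f s (t * k)) with (k ^ n * (k * pd2 1 f s (t * k))) by (simpl; ring).
    apply (is_derive_scal (fun t => f s (t * k))).
    apply (is_derive_comp (fun y => f s y) (fun t => t * k)).
    - apply Derive_correct. apply (smooth2_open_ex U f s (t * k) Hf (HinU t Ht)).
    - auto_derive; [trivial | ring]. }
  pose proof (taylor3_bound (fun t => k ^ 0 * g11 s (t * k)) (fun t => k ^ 1 * pd2 1 g11 s (t * k))
    (fun t => k ^ 2 * pd2 1 (pd2 1 g11) s (t * k))
    (fun t => k ^ 3 * pd2 1 (pd2 1 (pd2 1 g11)) s (t * k)) (MB ^ 3 * M)) as T.
  specialize (T ltac:(apply Rmult_le_pos; [apply pow_le |]; lra)).
  specialize (T (fun t Ht => conj (Hder _ S1 0%nat t Ht)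
    (conj (Hder _ S1' 1%nat t Ht) (Hder _ S1'' 2%nat t Ht)))).
  cbv beta in T.
  replace (g11 s (be * B s * r) - (1 + be * (k * pd2 1 g11 s 0) +
     be ^ 2 * (k ^ 2 * pd2 1 (pd2 1 g11) s 0 / 2)))
    with (k ^ 0 * g11 s (be * k) - (k ^ 0 * g11 s (0 * k) + be * (k ^ 1 * pd2 1 g11 s (0 * k)) +
      be ^ 2 * (k ^ 2 * pd2 1 (pd2 1 g11) s (0 * k) / 2))).
  - apply T; [| lra]. intros t Ht. rewrite Rabs_mult, <- RPow_abs.
    apply Rmult_le_compat; [apply pow_le, Rabs_pos | apply Rabs_pos | |].
    + apply pow_incr. split; [apply Rabs_pos | exact Hk].
    + unfold k. replace (t * (B s * r)) with (B s * (t * r)) by ring. apply Hbd; auto. nra.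
  - rewrite Rmult_0_l, (metric_center s Hs). unfold k.
    replace (be * B s * r) with (be * (B s * r)) by ring. field.
Qed.

(** Since be B r = B (be r), thin strips lie in the full compact domain, on which g11 is continuous
    and positive. *)
Lemma metric_lower : exists m, 0 < m /\ forall be s r, 0 < be <= 1 -> a <= s <= b -> -1 <= r <= 1 ->
  m <= g11 s (be * B s * r) <= / m.
Proof.
  pose proof chart_ab as Hab.
  destruct chart_open as [U [HUo [HU [S1 [S2 S3]]]]].
  assert (Hin : forall s r, a <= s <= b -> -1 <= r <= 1 -> InD a b B s (B s * r)).
  { intros s r Hs Hr. split; [exact Hs |]. pose proof (chart_B_pos s Hs). split; nra. }
  assert (c1 : ct2 a b (fun s r => g11 s (B s * r))).
  { apply (ct2_smooth a b B U); auto; [lra | apply chart_B_ct1]. }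
  assert (c2 : ct2 a b (fun s r => / g11 s (B s * r))).
  { apply ct2_inv; auto; [lra |]. intros s r Hs Hr.
    destruct (metric_diag _ _ (Hin s r Hs Hr)) as [_ [_ H]]. lra. }
  destruct (ct2_bounded a b _ c1) as [M1 [HM1 H1]].
  destruct (ct2_bounded a b _ c2) as [M2 [HM2 H2]].
  assert (HM : 0 < Rmax M1 M2) by (eapply Rlt_le_trans; [exact HM1 | apply Rmax_l]).
  exists (/ Rmax M1 M2). split; [now apply Rinv_0_lt_compat |].
  intros be s r Hb Hs Hr. rewrite Rinv_inv.
  replace (be * B s * r) with (B s * (be * r)) by ring.
  assert (Hr' : -1 <= be * r <= 1) by nra.
  destruct (metric_diag _ _ (Hin s _ Hs Hr')) as [_ [_ H]].
  specialize (H1 s _ Hs Hr'). specialize (H2 s _ Hs Hr').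
  rewrite Rabs_pos_eq in H1 by lra. rewrite Rabs_pos_eq in H2 by (apply Rlt_le, Rinv_0_lt_compat, H).
  pose proof (Rmax_l M1 M2). pose proof (Rmax_r M1 M2). split; [| lra].
  rewrite <- (Rinv_inv (g11 s (B s * (be * r)))).
  apply Rinv_le_contravar; [now apply Rinv_0_lt_compat | lra].
Qed.

End Metric.

(** * Expansion of the minimizers *)

Lemma dpart3_swap_0_1 U f l x y z : open U -> smooth3_open U f -> U (x, (y, z)) ->
  dpart3 (0 :: 1 :: l)%nat f x y z = dpart3 (1 :: 0 :: l)%nat f x y z.
Proof.
  intros HU Hf H. destruct (open_box3 U x y z HU H) as [e [Hpos Hb]].
  simpl. unfold pd3; simpl.
  assert (C : forall l', continuity_2d_pt (fun u v => dpart3 l' f u v z) x y).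
  { intros l'. intros eps. destruct (Hf l' x y z H) as [Hc _].
    destruct (proj1 (continuous_R3_eps _ _ _ _) Hc eps (cond_pos eps)) as [d [Hd Hd']].
    exists (mkposreal d Hd). intros u v Hu Hv. apply (Hd' u v z); auto.
    rewrite Rminus_diag, Rabs_R0. exact Hd. }
  apply (Schwarz (fun u v => dpart3 l f u v z) x y).
  - exists (mkposreal e Hpos). intros u v Hu Hv. simpl in Hu, Hv.
    assert (Hp : U (u, (v, z))) by (apply Hb; auto; rewrite Rminus_diag, Rabs_R0; exact Hpos).
    split; [| split; [| split]].
    + exact (proj1 (proj2 (Hf l u v z Hp))).
    + exact (proj1 (proj2 (proj2 (Hf l u v z Hp)))).
    + exact (proj1 (proj2 (Hf (1%nat :: l) u v z Hp))).
    + exact (proj1 (proj2 (proj2 (Hf (0%nat :: l) u v z Hp)))).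
  - apply (C (0 :: 1 :: l)%nat).
  - apply (C (1 :: 0 :: l)%nat).
Qed.

(** Taylor's formula for F_s and F_r puts the beta-derivatives outermost. Moved innermost, they
    exhibit the coefficients as s- and r-derivatives of the coefficients of F. *)
Lemma dpart3_commute U f d j x y z : open U -> smooth3_open U f -> d = 1%nat \/ d = 2%nat ->
  U (x, (y, z)) ->
  dpart3 (repeat 0%nat j ++ [d]) f x y z = dpart3 (d :: repeat 0%nat j) f x y z.
Proof.
  intros HU Hf Hd. revert x y z. induction j as [| j IH]; intros x y z H; [reflexivity |].
  transitivity (dpart3 (0 :: d :: repeat 0 j)%nat f x y z).
  - exact (dpart3_ext_open U _ _ HU IH [0%nat] x y z H).
  - destruct Hd as [-> | ->].
    + now apply (dpart3_swap_0_1 U).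
    + now apply (dpart3_swap_0_2 U).
Qed.

Section Family.

Variables (a b : R) (B : R -> R).
Hypothesis Hab : a < b.
Hypothesis HB : ct1 a b B.
Hypothesis HdB : ct1 a b (Derive B).
Hypothesis HBd : forall s, a <= s <= b -> ex_derive B s.
Hypothesis HBpos : forall s, a <= s <= b -> 0 < B s.
Variables (Phi F : R -> R -> R -> R) (U : R * (R * R) -> Prop).
Hypothesis HU : open U.
Hypothesis HSU : forall be s r, 0 <= be <= 1 -> a <= s <= b -> -1 <= r <= 1 -> U (be, (s, r)).
Hypothesis HF : smooth3_open U F.
Hypothesis HPhi : forall be, 0 < be <= 1 -> smooth2_on (InDbeta a b B be) (Phi be).
Hypothesis HFP : forall be s r, 0 < be <= 1 -> a <= s <= b -> -1 <= r <= 1 ->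
  F be s r = Phi be s (be * B s * r).

Let co l s r := dpart3 l F 0 s r.

Lemma dpart3_bounded l : exists M, 0 < M /\
  forall be s r, 0 <= be <= 1 -> a <= s <= b -> -1 <= r <= 1 -> Rabs (dpart3 l F be s r) <= M.
Proof.
  destruct (compact_box3 0 1 a b (-1) 1 (fun d be s r => Rabs (dpart3 l F be s r) <= / d))
    as [d [Hd H]].
  - intros d d' be s r [H1 H2] H3. apply Rle_trans with (/ d); [exact H3 |].
    apply Rinv_le_contravar; assumption.
  - intros be s r Hb Hs Hr. destruct (HF l be s r (HSU be s r Hb Hs Hr)) as [Hc _].
    destruct (proj1 (continuous_R3_eps _ _ _ _) Hc 1 Rlt_0_1) as [d [Hd H]]. simpl in H.
    assert (H0 : 0 < Rabs (dpart3 l F be s r) + 1) by (pose proof (Rabs_pos (dpart3 l F be s r)); lra).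
    exists (Rmin d (/ (Rabs (dpart3 l F be s r) + 1))). split.
    { apply Rmin_glb_lt; [exact Hd | now apply Rinv_0_lt_compat]. }
    intros be' s' r' _ _ _ H1 H2 H3.
    pose proof (Rmin_l d (/ (Rabs (dpart3 l F be s r) + 1))).
    assert (K : Rabs (dpart3 l F be' s' r') <= Rabs (dpart3 l F be s r) + 1).
    { specialize (H be' s' r' ltac:(lra) ltac:(lra) ltac:(lra)).
      pose proof (Rabs_triang_inv (dpart3 l F be' s' r') (dpart3 l F be s r)). lra. }
    apply Rle_trans with (1 := K).
    rewrite <- (Rinv_inv (Rabs (dpart3 l F be s r) + 1)) at 1.
    apply Rinv_le_contravar; [| apply Rmin_r].
    apply Rmin_glb_lt; [exact Hd | now apply Rinv_0_lt_compat].
  - exists (/ d). split; [now apply Rinv_0_lt_compat | exact H].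
Qed.

Lemma dpart3_ct2 l be : 0 <= be <= 1 -> ct2 a b (dpart3 l F be).
Proof.
  intros Hb. apply ct2_of_continuous; [lra |]. intros s r Hs Hr.
  destruct (HF l be s r (HSU be s r Hb Hs Hr)) as [Hc _].
  apply continuous_R2_eps. intros eps He.
  destruct (proj1 (continuous_R3_eps _ _ _ _) Hc eps He) as [d [Hd H]].
  exists d. split; [exact Hd |]. intros s' r' H1 H2. apply (H be s' r'); auto.
  rewrite Rminus_diag, Rabs_R0. exact Hd.
Qed.

Lemma co_ct2 l : ct2 a b (co l).
Proof. apply dpart3_ct2. lra. Qed.

Lemma dpart3_is_derive l be s r : 0 <= be <= 1 -> a <= s <= b -> -1 <= r <= 1 ->
  is_derive (fun t => dpart3 l F t s r) be (dpart3 (0%nat :: l) F be s r) /\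
  is_derive (fun t => dpart3 l F be t r) s (dpart3 (1%nat :: l) F be s r) /\
  is_derive (fun t => dpart3 l F be s t) r (dpart3 (2%nat :: l) F be s r).
Proof.
  intros Hb Hs Hr. destruct (HF l be s r (HSU be s r Hb Hs Hr)) as [_ [D0 [D1 D2]]].
  repeat split; now apply Derive_correct.
Qed.

Lemma family_taylor3 l : ex3 a b (dpart3 l F) (co l) (co (0%nat :: l))
  (fun s r => co (0 :: 0 :: l)%nat s r / 2).
Proof.
  split; [apply co_ct2 |]. split; [apply co_ct2 |].
  split; [apply ct2_mult; [apply co_ct2 | apply ct2_const] |].
  destruct (dpart3_bounded (0 :: 0 :: 0 :: l)%nat) as [M [HM H]]. exists M.
  intros be s r Hb Hs Hr.
  apply (taylor3_bound (fun t => dpart3 l F t s r) (fun t => dpart3 (0 :: l)%nat F t s r)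
    (fun t => dpart3 (0 :: 0 :: l)%nat F t s r) (fun t => dpart3 (0 :: 0 :: 0 :: l)%nat F t s r) M);
    [lra | | | lra].
  - intros t Ht.
    exact (conj (proj1 (dpart3_is_derive l t s r Ht Hs Hr))
      (conj (proj1 (dpart3_is_derive (0%nat :: l) t s r Ht Hs Hr))
        (proj1 (dpart3_is_derive (0 :: 0 :: l)%nat t s r Ht Hs Hr)))).
  - intros t Ht. now apply H.
Qed.

Lemma co_commute d j s r : d = 1%nat \/ d = 2%nat -> a <= s <= b -> -1 <= r <= 1 ->
  co (repeat 0%nat j ++ [d]) s r = co (d :: repeat 0%nat j) s r.
Proof. intros Hd Hs Hr. apply (dpart3_commute U); auto. apply HSU; auto; lra. Qed.

Lemma ex3_limit_ext f f0 f1 f2 f0' f1' f2' : ex3 a b f f0 f1 f2 ->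
  (forall s r, a <= s <= b -> -1 <= r <= 1 -> f0 s r = f0' s r) ->
  (forall s r, a <= s <= b -> -1 <= r <= 1 -> f1 s r = f1' s r) ->
  (forall s r, a <= s <= b -> -1 <= r <= 1 -> f2 s r = f2' s r) -> ex3 a b f f0' f1' f2'.
Proof.
  intros [F0 [F1 [F2 F3]]] E0 E1 E2.
  split; [refine (ct2_ext a b _ _ _ E0 F0); lra |].
  split; [refine (ct2_ext a b _ _ _ E1 F1); lra |].
  split; [refine (ct2_ext a b _ _ _ E2 F2); lra |].
  refine (UO_ext a b _ _ _ _ F3). intros be s r _ Hs Hr. now rewrite E0, E1, E2.
Qed.

Lemma family_taylor_d d : d = 1%nat \/ d = 2%nat ->
  ex3 a b (dpart3 [d] F) (co [d]) (co [d; 0%nat]) (fun s r => co [d; 0%nat; 0%nat] s r / 2).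
Proof.
  intros Hd. refine (ex3_limit_ext _ _ _ _ _ _ _ (family_taylor3 [d]) _ _ _).
  - reflexivity.
  - intros s r Hs Hr. exact (co_commute d 1 s r Hd Hs Hr).
  - intros s r Hs Hr. f_equal. exact (co_commute d 2 s r Hd Hs Hr).
Qed.

(** One order beyond the other expansions: d_2 Phi is F_r / (be B), and the division costs a power
    of [be]. *)
Lemma family_taylor4_r : UO a b 4 (fun be s r => dpart3 [2%nat] F be s r -
  (co [2%nat] s r + be * co [2; 0]%nat s r + be ^ 2 * (co [2; 0; 0]%nat s r / 2)
   + be ^ 3 * (co [2; 0; 0; 0]%nat s r / 6))).
Proof.
  destruct (dpart3_bounded [0; 0; 0; 0; 2]%nat) as [M [HM H]]. exists M.
  intros be s r Hb Hs Hr.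
  pose proof (co_commute 2 1 s r (or_intror eq_refl) Hs Hr) as E1.
  pose proof (co_commute 2 2 s r (or_intror eq_refl) Hs Hr) as E2.
  pose proof (co_commute 2 3 s r (or_intror eq_refl) Hs Hr) as E3.
  cbn [repeat app] in E1, E2, E3. rewrite <- E1, <- E2, <- E3. unfold co.
  apply (taylor4_bound (fun t => dpart3 [2]%nat F t s r) (fun t => dpart3 [0; 2]%nat F t s r)
    (fun t => dpart3 [0; 0; 2]%nat F t s r) (fun t => dpart3 [0; 0; 0; 2]%nat F t s r)
    (fun t => dpart3 [0; 0; 0; 0; 2]%nat F t s r) M); [lra | | | lra].
  - intros t Ht.
    exact (conj (proj1 (dpart3_is_derive [2]%nat t s r Ht Hs Hr))
      (conj (proj1 (dpart3_is_derive [0; 2]%nat t s r Ht Hs Hr))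
      (conj (proj1 (dpart3_is_derive [0; 0; 2]%nat t s r Ht Hs Hr))
        (proj1 (dpart3_is_derive [0; 0; 0; 2]%nat t s r Ht Hs Hr))))).
  - intros t Ht. now apply H.
Qed.

Let X be s r := pd2 0 (Phi be) s (be * B s * r).
Let Z be s r := pd2 1 (Phi be) s (be * B s * r).

Lemma strip_mem be s r : 0 < be <= 1 -> a <= s <= b -> -1 <= r <= 1 ->
  InDbeta a b B be s (be * B s * r).
Proof.
  intros Hb Hs Hr. apply (strip_in a b be B); auto.
  intros t Ht. apply Rmult_lt_0_compat; [lra | now apply HBpos].
Qed.

Lemma family_dr be s r : 0 < be <= 1 -> a <= s <= b -> -1 <= r <= 1 ->
  dpart3 [2%nat] F be s r = be * B s * Z be s r.
Proof.
  intros Hb Hs Hr.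
  destruct (proj1 (smooth2_on_open _ _) (HPhi be Hb)) as [V [HV [HDV Hsm]]].
  assert (D : is_derive (fun t => Phi be s (be * B s * t)) r (be * B s * Z be s r)).
  { apply (is_derive_comp (fun y => Phi be s y) (fun t => be * B s * t)).
    - apply Derive_correct.
      exact (proj2 (smooth2_open_ex V (Phi be) _ _ Hsm (HDV _ _ (strip_mem be s r Hb Hs Hr)))).
    - auto_derive; [trivial | ring]. }
  rewrite <- (is_derive_unique _ _ _ D).
  apply (Derive_eq_on_interval (-1) 1 (fun t => F be s t)); auto; [lra | | now exists (be * B s * Z be s r)].
  exists (dpart3 [2%nat] F be s r). exact (proj2 (proj2 (dpart3_is_derive [] be s r ltac:(lra) Hs Hr))).
Qed.

Lemma family_ds be s r : 0 < be <= 1 -> a <= s <= b -> -1 <= r <= 1 ->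
  dpart3 [1%nat] F be s r = X be s r + Z be s r * (be * Derive B s * r).
Proof.
  intros Hb Hs Hr.
  destruct (proj1 (smooth2_on_open _ _) (HPhi be Hb)) as [V [HV [HDV Hsm]]].
  assert (D : is_derive (fun t => Phi be t (be * B t * r)) s
    (X be s r + Z be s r * (be * Derive B s * r))).
  { apply (smooth2_open_chain V (Phi be) (fun t => be * B t * r)); auto.
    - apply HDV. now apply strip_mem.
    - apply (is_derive_ext (fun t => (be * r) * B t)); [intros; simpl; ring |].
      replace (be * Derive B s * r) with (be * r * Derive B s) by ring.
      apply (is_derive_scal B). now apply Derive_correct, HBd. }
  rewrite <- (is_derive_unique _ _ _ D).
  apply (Derive_eq_on_interval a b (fun t => F be t r)); auto.
  - exists (dpart3 [1%nat] F be s r). exact (proj1 (proj2 (dpart3_is_derive [] be s r ltac:(lra) Hs Hr))).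
  - now exists (X be s r + Z be s r * (be * Derive B s * r)).
Qed.

Lemma ct2_invB : ct2 a b (fun s _ => / B s).
Proof.
  apply (ct2_inv a b (fun s _ => B s)); [lra | now apply ct2_s |].
  intros s r Hs Hr. pose proof (HBpos s Hs). lra.
Qed.

Let bb s := Derive B s / B s.

(** Solving the chain rule for d_1 Phi and replacing be B d_2 Phi by F_r gives d_1 Phi = F_s - r (B'
    / B) F_r, in which nothing is divided by [be]. *)
Lemma X_expansion : ex3 a b X (fun s r => co [1%nat] s r - r * bb s * co [2%nat] s r)
  (fun s r => co [1; 0]%nat s r - r * bb s * co [2; 0]%nat s r)
  (fun s r => (co [1; 0; 0]%nat s r - r * bb s * co [2; 0; 0]%nat s r) / 2).
Proof.
  pose proof ct2_invB as cI. assert (cD : ct2 a b (fun s _ => Derive B s)) by (now apply ct2_s).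
  assert (cb : ct2 a b (fun s r => r * (Derive B s * / B s))) by ct2_tac.
  pose proof (ex3_minus a b _ _ _ _ _ _ _ _ (family_taylor_d 1 (or_introl eq_refl))
    (ex3_mult a b _ _ _ _ _ _ _ _ (ex3_ct2 a b _ cb) (family_taylor_d 2 (or_intror eq_refl)))) as E.
  cbv beta in E.
  refine (ex3_limit_ext _ _ _ _ _ _ _ (ex3_ext a b _ _ _ _ _ _ E) _ _ _).
  - intros be s r Hb Hs Hr. cbv beta. rewrite (family_ds be s r Hb Hs Hr), (family_dr be s r Hb Hs Hr).
    pose proof (HBpos s Hs). field. lra.
  - intros s r Hs Hr. cbv beta. unfold bb. field. pose proof (HBpos s Hs). lra.
  - intros s r Hs Hr. cbv beta. unfold bb. field. pose proof (HBpos s Hs). lra.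
  - intros s r Hs Hr. cbv beta. unfold bb. field. pose proof (HBpos s Hs). lra.
Qed.

(** The hypothesis removes the constant term of F_r, so that division by be B shifts its expansion
    by one order; 1, 2 and 6 are the factorials in the Taylor formula of F_r. *)
Lemma Z_expansion : (forall s r, a <= s <= b -> -1 <= r <= 1 -> co [2%nat] s r = 0) ->
  ex3 a b Z (fun s r => co [2; 0]%nat s r / B s)
    (fun s r => co [2; 0; 0]%nat s r / (2 * B s)) (fun s r => co [2; 0; 0; 0]%nat s r / (6 * B s)).
Proof.
  intros H0. pose proof ct2_invB as cI.
  assert (ci : forall k l, ct2 a b (fun s r => co l s r * (k * / B s))).
  { intros k l. pose proof (co_ct2 l). ct2_tac. }
  split; [refine (ct2_ext a b _ _ _ _ (ci 1 [2; 0]%nat)); [lra |]; intros s r Hs Hr;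
    cbv beta; pose proof (HBpos s Hs); field; lra |].
  split; [refine (ct2_ext a b _ _ _ _ (ci (/ 2) [2; 0; 0]%nat)); [lra |]; intros s r Hs Hr;
    cbv beta; pose proof (HBpos s Hs); field; lra |].
  split; [refine (ct2_ext a b _ _ _ _ (ci (/ 6) [2; 0; 0; 0]%nat)); [lra |]; intros s r Hs Hr;
    cbv beta; pose proof (HBpos s Hs); field; lra |].
  destruct family_taylor4_r as [C HC]. destruct (ct2_bounded a b _ cI) as [M [HM HMb]].
  exists (Rabs C * M). intros be s r Hb Hs Hr. specialize (HC be s r Hb Hs Hr).
  rewrite (family_dr be s r Hb Hs Hr), (H0 s r Hs Hr) in HC.
  pose proof (HBpos s Hs) as HBs. specialize (HMb s r Hs Hr).
  match goal with |- Rabs ?e <= _ => replace e with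
    ((be * B s * Z be s r - (0 + be * co [2; 0]%nat s r + be ^ 2 * (co [2; 0; 0]%nat s r / 2)
      + be ^ 3 * (co [2; 0; 0; 0]%nat s r / 6))) * (/ be * / B s)) by (field; lra) end.
  rewrite Rabs_mult, Rabs_mult, (Rabs_pos_eq (/ be)) by (apply Rlt_le, Rinv_0_lt_compat; lra).
  replace (Rabs C * M * be ^ 3) with ((Rabs C * be ^ 4) * (/ be * M)) by (field; lra).
  assert (0 < / be) by (apply Rinv_0_lt_compat; lra).
  apply Rmult_le_compat; [apply Rabs_pos | apply Rmult_le_pos; [lra | apply Rabs_pos] | |].
  - apply Rle_trans with (1 := HC). apply Rmult_le_compat_r; [apply pow_le; lra | apply Rle_abs].
  - apply Rmult_le_compat_l; lra.
Qed.

(** An r-derivative independent of r makes the coefficient affine in r. Differentiating the affine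
    formula in s passes this on to the s-derivative, which is what enters E_11. *)
Lemma coefficient_affine j :
  (forall s r, a <= s <= b -> -1 <= r <= 1 ->
     co (2%nat :: repeat 0%nat j) s r = co (2%nat :: repeat 0%nat j) s 0) ->
  forall s r, a <= s <= b -> -1 <= r <= 1 ->
    co (repeat 0%nat j) s r = co (repeat 0%nat j) s 0 + r * co (2%nat :: repeat 0%nat j) s 0 /\
    co (1%nat :: repeat 0%nat j) s r = co (1%nat :: repeat 0%nat j) s 0
      + r * co (1%nat :: 2%nat :: repeat 0%nat j) s 0.
Proof.
  intros H. set (l := repeat 0%nat j) in *.
  assert (A : forall s r, a <= s <= b -> -1 <= r <= 1 ->
    co l s r = co l s 0 + r * co (2%nat :: l) s 0).
  { intros s r Hs Hr.
    destruct (MVT_gen (fun t => co l s t) 0 r (fun t => co (2%nat :: l) s t)) as [t [Ht E]].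
    - intros t Ht. refine (proj2 (proj2 (dpart3_is_derive l 0 s t _ Hs _))); [lra |].
      unfold Rmin, Rmax in Ht. destruct Rle_dec; lra.
    - intros t Ht. apply ex_derive_continuity_pt. exists (co (2%nat :: l) s t).
      refine (proj2 (proj2 (dpart3_is_derive l 0 s t _ Hs _))); [lra |].
      unfold Rmin, Rmax in Ht. destruct Rle_dec; lra.
    - rewrite (H s t Hs) in E.
      + lra.
      + unfold Rmin, Rmax in Ht. destruct Rle_dec; lra. }
  intros s r Hs Hr. split; [now apply A |].
  assert (D1 : is_derive (fun t => co l t r) s (co (1%nat :: l) s r))
    by (exact (proj1 (proj2 (dpart3_is_derive l 0 s r ltac:(lra) Hs Hr)))).
  assert (D2 : is_derive (fun t => co l t 0 + r * co (2%nat :: l) t 0) s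
    (co (1%nat :: l) s 0 + r * co (1%nat :: 2%nat :: l) s 0)).
  { apply (is_derive_plus (V := R_NormedModule)).
    - exact (proj1 (proj2 (dpart3_is_derive l 0 s 0 ltac:(lra) Hs ltac:(lra)))).
    - apply (is_derive_scal (fun t => co (2%nat :: l) t 0)).
      exact (proj1 (proj2 (dpart3_is_derive (2%nat :: l) 0 s 0 ltac:(lra) Hs ltac:(lra)))). }
  rewrite <- (is_derive_unique _ _ _ D1), <- (is_derive_unique _ _ _ D2).
  apply (Derive_eq_on_interval a b _ _ s Hab Hs (ex_intro _ _ D1) (ex_intro _ _ D2)).
  intros t Ht. now apply A.
Qed.

(** At beta = 0 the strip has collapsed onto a curve, so the tangent of the limit is constant across
    the width as well. *)
Lemma coefficient_const : (forall s r, a <= s <= b -> -1 <= r <= 1 -> co [2%nat] s r = 0) ->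
  forall s r, a <= s <= b -> -1 <= r <= 1 ->
    co [] s r = co [] s 0 /\ co [1%nat] s r = co [1%nat] s 0.
Proof.
  intros H0 s r Hs Hr.
  destruct (coefficient_affine 0) with (s := s) (r := r) as [E1 E2]; auto.
  - intros t q Ht Hq. cbn [repeat]. rewrite !H0; auto; lra.
  - cbn [repeat] in E1, E2.
    assert (E3 : co [1; 2]%nat s 0 = 0).
    { transitivity (Derive (fun t => co [2%nat] t 0) s).
      { symmetry. apply is_derive_unique.
        exact (proj1 (proj2 (dpart3_is_derive [2%nat] 0 s 0 ltac:(lra) Hs ltac:(lra)))). }
      transitivity (Derive (fun _ => 0) s); [| apply Derive_const].
      apply (Derive_eq_on_interval a b); auto.
      - exists (dpart3 [1; 2]%nat F 0 s 0).
        exact (proj1 (proj2 (dpart3_is_derive [2%nat] 0 s 0 ltac:(lra) Hs ltac:(lra)))).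
      - apply ex_derive_const.
      - intros t Ht. apply H0; auto; lra. }
    rewrite (H0 s 0 Hs ltac:(lra)) in E1. rewrite E3 in E2. lra.
Qed.

(** The lever arm of the moment balance, measured from the center curve. *)
Lemma displacement_expansion :
  (forall s r, a <= s <= b -> -1 <= r <= 1 -> co [2%nat] s r = 0) ->
  (forall s r, a <= s <= b -> -1 <= r <= 1 -> co [2; 0]%nat s r = co [2; 0]%nat s 0) ->
  approx a b 1 (fun be s r => Phi be s (be * B s * r) - Phi be s (be * B s * 0))
    (fun s r => B s * r * (co [2; 0]%nat s r / B s)).
Proof.
  intros H0 H1. pose proof ct2_invB as cI. pose proof (co_ct2 [2; 0]%nat).
  assert (cB : ct2 a b (fun s _ => B s)) by (now apply ct2_s).
  split; [unfold Rdiv; ct2_tac |].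
  destruct (family_taylor3 []) as [_ [_ [c2 [C HC]]]].
  destruct (ct2_bounded a b _ c2) as [M [HM HMb]].
  exists (2 * (Rabs C + M)). intros be s r Hb Hs Hr.
  assert (K : forall r, -1 <= r <= 1 ->
    Rabs (F be s r - (co [] s r + be * co [0%nat] s r)) <= (Rabs C + M) * be ^ 2).
  { intros t Ht. specialize (HC be s t Hb Hs Ht). specialize (HMb s t Hs Ht). cbn [dpart3] in HC.
    replace (F be s t - (co [] s t + be * co [0%nat] s t)) with
      ((F be s t - (co [] s t + be * co [0%nat] s t + be ^ 2 * (co [0; 0]%nat s t / 2)))
       + be ^ 2 * (co [0; 0]%nat s t / 2)) by ring.
    eapply Rle_trans; [apply Rabs_triang |].
    rewrite Rmult_plus_distr_r. apply Rplus_le_compat.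
    - eapply Rle_trans; [exact HC |].
      assert (be ^ 3 <= be ^ 2) by (simpl; nra). assert (0 <= be ^ 3) by (apply pow_le; lra).
      pose proof (Rle_abs C). pose proof (Rabs_pos C). nra.
    - rewrite Rabs_mult, (Rabs_pos_eq (be ^ 2)) by (apply pow_le; lra).
      rewrite Rmult_comm. apply Rmult_le_compat_r; [apply pow_le; lra | exact HMb]. }
  rewrite <- !HFP by (auto; lra).
  pose proof (K r Hr) as K1. pose proof (K 0 ltac:(lra)) as K0.
  destruct (coefficient_const H0 s r Hs Hr) as [E0 _].
  destruct (coefficient_affine 1 H1 s r Hs Hr) as [E1 _]. cbn [repeat] in E1.
  rewrite <- (H1 s r Hs Hr) in E1. rewrite E0, E1 in K1.
  pose proof (HBpos s Hs) as HBs. rewrite pow_1.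
  match goal with |- Rabs ?e <= _ => replace e with
    ((F be s r - (co [] s 0 + be * (co [0%nat] s 0 + r * co [2; 0]%nat s r)))
     - (F be s 0 - (co [] s 0 + be * co [0%nat] s 0))) by (field; lra) end.
  apply Rabs_le_between in K1, K0. apply Rabs_le. lra.
Qed.

End Family.

(** * Energy bound *)

(** In dimension 2, lambda + 2 mu = Y / (1 - nu^2), and hence nu = lambda / (lambda + 2 mu). *)
Lemma lame_facts Y nu : 0 < Y -> -1 < nu < 1 ->
  lame_lambda Y nu = nu * (lame_lambda Y nu + 2 * lame_mu Y nu) /\
  0 < lame_lambda Y nu + 2 * lame_mu Y nu /\ 0 < lame_mu Y nu.
Proof.
  intros HY Hnu. unfold lame_lambda, lame_mu.
  assert (E : nu * Y / ((1 + nu) * (1 - nu)) + 2 * (Y / (2 * (1 + nu))) = Y / ((1 + nu) * (1 - nu)))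
    by (field; lra).
  rewrite E. split; [field; lra |]. split; apply Rdiv_lt_0_compat; nra.
Qed.

(** With u = A / G the form is (lam + 2 mu)(u^2 + 2 nu u C + C^2) + 4 mu K^2 / G, and the quadratic
    form in (u, C) has eigenvalues 1 + nu and 1 - nu, both at least 1 - |nu|. *)
Lemma bilin_coercive lam mu nu m G A K C : lam = nu * (lam + 2 * mu) -> 0 < lam + 2 * mu ->
  0 < mu -> -1 < nu < 1 -> 0 < m -> m <= G <= / m ->
  Rmin ((lam + 2 * mu) * (1 - Rabs nu) * Rmin (m ^ 2) 1) (4 * mu * m) * (A ^ 2 + K ^ 2 + C ^ 2)
  <= bilin lam mu G A K C A K C.
Proof.
  intros Hl HL Hmu Hnu Hm HG.
  assert (HGi : m <= / G).
  { rewrite <- (Rinv_inv m). apply Rinv_le_contravar; lra. }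
  set (L := lam + 2 * mu) in *. set (u := A / G).
  assert (E : bilin lam mu G A K C A K C = L * (u ^ 2 + C ^ 2 + 2 * nu * u * C) + 4 * mu * K ^ 2 * / G).
  { unfold bilin. fold L. rewrite Hl at 1. unfold u. field. lra. }
  rewrite E. clear E.
  assert (Hn : 0 < 1 - Rabs nu) by (assert (Rabs nu < 1) by (apply Rabs_def1; lra); lra).
  assert (Q1 : (1 - Rabs nu) * (u ^ 2 + C ^ 2) <= u ^ 2 + C ^ 2 + 2 * nu * u * C).
  { unfold Rabs. destruct Rcase_abs; pose proof (pow2_ge_0 (u - C)); pose proof (pow2_ge_0 (u + C)); nra. }
  assert (Q2 : m ^ 2 * A ^ 2 <= u ^ 2).
  { unfold u, Rdiv. replace ((A * / G) ^ 2) with (A ^ 2 * (/ G) ^ 2) by ring.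
    rewrite Rmult_comm. apply Rmult_le_compat_l; [apply pow2_ge_0 | apply pow_incr; lra]. }
  set (k := Rmin (m ^ 2) 1).
  assert (Hk1 : k <= m ^ 2) by apply Rmin_l. assert (Hk2 : k <= 1) by apply Rmin_r.
  pose proof (pow2_ge_0 A). pose proof (pow2_ge_0 C). pose proof (pow2_ge_0 K).
  assert (Q3 : k * (A ^ 2 + C ^ 2) <= u ^ 2 + C ^ 2) by nra.
  set (w := Rmin (L * (1 - Rabs nu) * k) (4 * mu * m)).
  assert (Hw1 : w <= L * (1 - Rabs nu) * k) by apply Rmin_l.
  assert (Hw2 : w <= 4 * mu * m) by apply Rmin_r.
  assert (Q4 : w * (A ^ 2 + C ^ 2) <= L * (u ^ 2 + C ^ 2 + 2 * nu * u * C)).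
  { apply Rle_trans with (L * (1 - Rabs nu) * k * (A ^ 2 + C ^ 2)).
    - apply Rmult_le_compat_r; lra.
    - apply Rle_trans with (L * ((1 - Rabs nu) * (u ^ 2 + C ^ 2))).
      + replace (L * (1 - Rabs nu) * k * (A ^ 2 + C ^ 2))
          with (L * ((1 - Rabs nu) * (k * (A ^ 2 + C ^ 2)))) by ring.
        apply Rmult_le_compat_l; [lra |]. apply Rmult_le_compat_l; lra.
      + apply Rmult_le_compat_l; lra. }
  assert (Q5 : w * K ^ 2 <= 4 * mu * K ^ 2 * / G).
  { apply Rle_trans with (4 * mu * m * K ^ 2); [apply Rmult_le_compat_r; lra |].
    replace (4 * mu * m * K ^ 2) with (4 * mu * K ^ 2 * m) by ring.
    apply Rmult_le_compat_l; [| lra]. apply Rmult_le_pos; lra. }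
  lra.
Qed.

Section Minimizers.

Variables (a b Y nu : R) (B : R -> R) (g11 g12 g22 : R -> R -> R) (Phi1 Phi2 : R -> R -> R -> R).
Hypothesis Hchart : chart_hyp a b B g11 g12 g22.
Hypothesis HY : 0 < Y.
Hypothesis Hnu : -1 < nu < 1.
Hypothesis Hfam : forall beta, 0 < beta <= 1 ->
     is_embedding a b B beta (Phi1 beta) (Phi2 beta) /\
     forall Psi1 Psi2 : R -> R -> R, is_embedding a b B beta Psi1 Psi2 ->
       strain_energy a b B beta Y nu g11 g12 g22 (Phi1 beta) (Phi2 beta)
       <= strain_energy a b B beta Y nu g11 g12 g22 Psi1 Psi2.

Let lam := lame_lambda Y nu.
Let mu := lame_mu Y nu.
Let Hab : a < b := chart_ab a b B g11 g12 g22 Hchart.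

Lemma thin_ct1 be : ct1 a b (fun x => be * B x).
Proof. apply ct1_scal. exact (chart_B_ct1 a b B g11 g12 g22 Hchart). Qed.

Lemma thin_pos be : 0 < be <= 1 -> forall s, a <= s <= b -> 0 < be * B s.
Proof.
  intros Hb s Hs. pose proof (chart_B_pos a b B g11 g12 g22 Hchart s Hs).
  apply Rmult_lt_0_compat; lra.
Qed.

Lemma thin_in be x y : 0 < be <= 1 -> InDbeta a b B be x y -> InD a b B x y.
Proof.
  intros Hb [Hx Hy]. pose proof (chart_B_pos a b B g11 g12 g22 Hchart x Hx).
  split; [exact Hx |]. apply Rabs_le_between. nra.
Qed.

Lemma thin_diag be : 0 < be <= 1 -> forall x y, InDbeta a b B be x y ->
  g12 x y = 0 /\ g22 x y = 1 /\ 0 < g11 x y.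
Proof.
  intros Hb x y H. apply (metric_diag a b B g11 g12 g22 Hchart). now apply (thin_in be).
Qed.

Lemma thin_open be P1 P2 : 0 < be <= 1 -> is_embedding a b B be P1 P2 ->
  exists U, open U /\ (forall x y, InDbeta a b B be x y -> U (x, y)) /\
    smooth2_open U g11 /\ smooth2_open U P1 /\ smooth2_open U P2.
Proof.
  intros Hb [H1 [H2 _]]. apply smooth2_on_open in H1, H2.
  destruct H1 as [U1 [O1 [S1 F1]]]. destruct H2 as [U2 [O2 [S2 F2]]].
  destruct (chart_open a b B g11 g12 g22 Hchart) as [U3 [O3 [S3 [F3 _]]]].
  exists (fun p => U1 p /\ (U2 p /\ U3 p)).
  split; [apply open_and; [exact O1 | now apply open_and] |].
  split; [intros x y H; repeat split; auto; apply S3; now apply (thin_in be) |].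
  split; [| split]; (eapply smooth2_open_sub; [| eassumption]; simpl; tauto).
Qed.

Lemma thin_ct2 be : 0 < be <= 1 ->
  ct2 a b (fun s r => g11 s (be * B s * r)) /\
  ct2 a b (fun s r => Phi1 be s (be * B s * r)) /\ ct2 a b (fun s r => Phi2 be s (be * B s * r)) /\
  ct2 a b (fun s r => e00 g11 (Phi1 be) (Phi2 be) s (be * B s * r)) /\
  ct2 a b (fun s r => e01 (Phi1 be) (Phi2 be) s (be * B s * r)) /\
  ct2 a b (fun s r => e11 (Phi1 be) (Phi2 be) s (be * B s * r)).
Proof.
  intros Hb. destruct (Hfam be Hb) as [Hemb _].
  destruct (thin_open be _ _ Hb Hemb) as [U [HU [HD [Sg [S1 S2]]]]].
  pose proof (ct2_hat a b be B Hab (thin_ct1 be) (thin_pos be Hb) U HD) as Hat. cbv beta in Hat.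
  pose proof (Hat _ Sg).
  pose proof (Hat _ S1). pose proof (Hat _ S2).
  pose proof (Hat _ (smooth2_open_pd2 U _ 0 S1)). pose proof (Hat _ (smooth2_open_pd2 U _ 1 S1)).
  pose proof (Hat _ (smooth2_open_pd2 U _ 0 S2)). pose proof (Hat _ (smooth2_open_pd2 U _ 1 S2)).
  unfold e00, e01, e11. repeat split; ct2_tac.
Qed.

Lemma identity_embedding be : is_embedding a b B be (fun x _ => x) (fun _ y => y).
Proof.
  split; [| split; [| split]].
  - apply smooth2_on_open. exists (fun _ => True).
    split; [apply open_true |]. split; [trivial |]. apply smooth2_open_x.
  - apply smooth2_on_open. exists (fun _ => True).
    split; [apply open_true |]. split; [trivial |]. apply smooth2_open_y.
  - intros x y x' y' _ _ E1 E2. now split.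
  - intros x y _. unfold pd2. simpl. rewrite !Derive_id, !Derive_const. lra.
Qed.

Lemma balance be : 0 < be <= 1 ->
  let N Q s r := axial lam mu g11 (Phi1 be) (Phi2 be) Q s (be * B s * r) in
  let L Q s r := lateral lam mu g11 (Phi1 be) (Phi2 be) Q s (be * B s * r) in
  (ct2 a b (N (Phi1 be)) /\ ct2 a b (N (Phi2 be)) /\
   ct2 a b (L (Phi1 be)) /\ ct2 a b (L (Phi2 be))) /\
  (forall s, a <= s <= b -> RInt (N (Phi1 be) s) (-1) 1 = 0 /\ RInt (N (Phi2 be) s) (-1) 1 = 0) /\
  (forall s, a <= s <= b -> RInt (fun r => N (Phi2 be) s r * Phi1 be s (be * B s * r)
     - N (Phi1 be) s r * Phi2 be s (be * B s * r)) (-1) 1 = 0) /\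
  (forall m n,
    dbl a b (fun s r => (INR m * s ^ pred m * (be * B s * r) ^ S n * N (Phi1 be) s r
    + s ^ m * (INR (S n) * (be * B s * r) ^ n) * L (Phi1 be) s r) * (be * B s)) = 0 /\
    dbl a b (fun s r => (INR m * s ^ pred m * (be * B s * r) ^ S n * N (Phi2 be) s r
    + s ^ m * (INR (S n) * (be * B s * r) ^ n) * L (Phi2 be) s r) * (be * B s)) = 0).
Proof.
  intros Hb N L. destruct (Hfam be Hb) as [Hemb Hmin].
  destruct (thin_open be _ _ Hb Hemb) as [U [HU [HD [Sg [S1 S2]]]]].
  pose proof (ct2_N a b be Y nu B g11 g12 g22 Hab (thin_ct1 be) (thin_pos be Hb) U HD Sg
    (thin_diag be Hb) _ _ S1 S2) as CN.
  split; [| split; [| split]].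
  - destruct (CN _ S1), (CN _ S2). repeat split; assumption.
  - intros s Hs. exact (force_balance a b be Y nu B g11 g12 g22 Hab (thin_ct1 be) (thin_pos be Hb)
      U HU HD Sg (thin_diag be Hb) _ _ S1 S2 Hemb Hmin s Hs).
  - intros s Hs. exact (moment_balance a b be Y nu B g11 g12 g22 Hab (thin_ct1 be) (thin_pos be Hb)
      U HU HD Sg (thin_diag be Hb) _ _ S1 S2 Hemb Hmin s Hs).
  - intros m n. exact (lateral_balance a b be Y nu B g11 g12 g22 Hab (thin_ct1 be) (thin_pos be Hb)
      U HU HD Sg (thin_diag be Hb) _ _ S1 S2 Hemb Hmin m n).
Qed.

(* The identity of the chart is a competitor of energy O(beta^3). *)
Lemma energy_bound : exists M, forall be, 0 < be <= 1 ->
  dbl a b (fun s r => e00 g11 (Phi1 be) (Phi2 be) s (be * B s * r) ^ 2) <= M * be /\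
  dbl a b (fun s r => e01 (Phi1 be) (Phi2 be) s (be * B s * r) ^ 2) <= M * be /\
  dbl a b (fun s r => e11 (Phi1 be) (Phi2 be) s (be * B s * r) ^ 2) <= M * be.
Proof.
  destruct (lame_facts Y nu HY Hnu) as [Hl [HL Hmu]]. fold lam mu in Hl, HL, Hmu.
  destruct (metric_lower a b B g11 g12 g22 Hchart) as [m [Hm HGm]].
  pose proof (metric_expansion a b B g11 g12 g22 Hchart) as HGx.
  apply ex3_approx0 in HGx. destruct HGx as [_ [Cg HCg]].
  assert (cB : ct2 a b (fun s _ => B s))
    by (apply ct2_s; exact (chart_B_ct1 a b B g11 g12 g22 Hchart)).
  destruct (ct2_bounded a b _ cB) as [MB [HMB HB]].
  assert (ciB : ct2 a b (fun s _ => / B s)).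
  { apply ct2_inv; auto; [lra |]. intros s r Hs Hr.
    pose proof (chart_B_pos a b B g11 g12 g22 Hchart s Hs). lra. }
  destruct (ct2_bounded a b _ ciB) as [MI [HMI HBi]].
  set (w := Rmin ((lam + 2 * mu) * (1 - Rabs nu) * Rmin (m ^ 2) 1) (4 * mu * m)).
  assert (Hw : 0 < w).
  { assert (Rabs nu < 1) by (apply Rabs_def1; lra).
    apply Rmin_glb_lt; [apply Rmult_lt_0_compat; [apply Rmult_lt_0_compat; lra |] |].
    - apply Rmin_glb_lt; [apply pow_lt; lra | lra].
    - apply Rmult_lt_0_compat; lra. }
  assert (Hsm : 0 < sqrt m) by (now apply sqrt_lt_R0).
  (* Lower bound for the energy integrand per unit of [be] and of squared strain: [w] from
     coercivity, sqrt m from the area density, 1 / [MI] from B. *)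
  set (m1 := / 2 * (w * sqrt m * / MI)).
  assert (HMI' : 0 < / MI) by (now apply Rinv_0_lt_compat).
  assert (Hm1 : 0 < m1).
  { unfold m1. assert (0 < w * sqrt m * / MI) by (repeat apply Rmult_lt_0_compat; assumption). lra. }
  (* Constant for the identity map, whose only strain is E_11 = (1 - g11) / 2, bounded by [Cg] be /
     2. *)
  set (M2 := / 2 * ((lam + 2 * mu) * (/ 2 * Cg) ^ 2 * (/ m) ^ 2 * sqrt (/ m) * MB)).
  exists ((b - a) * (2 * M2) / m1). intros be Hb.
  destruct (Hfam be Hb) as [Hemb Hmin]. specialize (Hmin _ _ (identity_embedding be)).
  destruct (thin_open be _ _ Hb Hemb) as [U [HU [HD [Sg [S1 S2]]]]].
  rewrite (strain_energy_dbl a b be Y nu B g11 g12 g22 Hab (thin_ct1 be) (thin_pos be Hb) U HD Sg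
    (thin_diag be Hb) _ _ S1 S2) in Hmin.
  rewrite (strain_energy_dbl a b be Y nu B g11 g12 g22 Hab (thin_ct1 be) (thin_pos be Hb) U HD Sg
    (thin_diag be Hb) _ _ (smooth2_open_x U) (smooth2_open_y U)) in Hmin.
  fold lam mu in Hmin.
  destruct (thin_ct2 be Hb) as [cG [_ [_ [cA [cK cC]]]]].
  pose proof (ct2_bilin a b be Y nu B g11 g12 g22 Hab (thin_ct1 be) (thin_pos be Hb) U HD Sg
    (thin_diag be Hb)) as cbil. cbv beta in cbil. fold lam mu in cbil.
  pose proof (cbil _ _ _ _ _ _ cA cK cC cA cK cC) as cW.
  assert (cI : ct2 a b (fun s r => e00 g11 (fun x _ => x) (fun _ y => y) s (be * B s * r))).
  { apply (ct2_ext a b (fun s r => / 2 * (1 ^ 2 + 0 ^ 2 - g11 s (be * B s * r)))); [lra | | ct2_tac].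
    intros. unfold e00, pd2. simpl. rewrite Derive_id, Derive_const. ring. }
  assert (cI1 : ct2 a b (fun s r => e01 (fun x _ => x) (fun _ y => y) s (be * B s * r))).
  { apply (ct2_ext a b (fun _ _ => 0)); [lra | | ct2_tac].
    intros. unfold e01, pd2. simpl. rewrite !Derive_id, !Derive_const. ring. }
  assert (cI2 : ct2 a b (fun s r => e11 (fun x _ => x) (fun _ y => y) s (be * B s * r))).
  { apply (ct2_ext a b (fun _ _ => 0)); [lra | | ct2_tac].
    intros. unfold e11, pd2. simpl. rewrite !Derive_id, !Derive_const. ring. }
  pose proof (cbil _ _ _ _ _ _ cI cI1 cI2 cI cI1 cI2) as cWI.
  set (A := fun s r => e00 g11 (Phi1 be) (Phi2 be) s (be * B s * r)) in *.
  set (K := fun s r => e01 (Phi1 be) (Phi2 be) s (be * B s * r)) in *.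
  set (C := fun s r => e11 (Phi1 be) (Phi2 be) s (be * B s * r)) in *.
  assert (cS : ct2 a b (fun s r => A s r ^ 2 + K s r ^ 2 + C s r ^ 2)) by ct2_tac.
  assert (Low : be * m1 * dbl a b (fun s r => A s r ^ 2 + K s r ^ 2 + C s r ^ 2) <=
    be * be * ((b - a) * (2 * M2))).
  { rewrite <- dbl_scal by (auto; lra).
    eapply Rle_trans; [| eapply Rle_trans; [exact Hmin |]].
    - apply dbl_le; [lra | apply ct2_mult; [apply ct2_const | exact cS]
        | apply ct2_mult; [apply ct2_const | exact cW] |].
      intros s r Hs Hr. specialize (HGm be s r Hb Hs Hr). cbv beta.
      pose proof (bilin_coercive lam mu nu m (g11 s (be * B s * r)) (A s r) (K s r) (C s r)
        Hl HL Hmu Hnu Hm HGm) as Hco. fold w in Hco. fold (A s r) (K s r) (C s r).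
      set (q := A s r ^ 2 + K s r ^ 2 + C s r ^ 2) in *.
      assert (Hq : 0 <= q) by (unfold q; pose proof (pow2_ge_0 (A s r));
        pose proof (pow2_ge_0 (K s r)); pose proof (pow2_ge_0 (C s r)); lra).
      assert (Hsg : sqrt m <= sqrt (g11 s (be * B s * r))) by (apply sqrt_le_1_alt; lra).
      pose proof (chart_B_pos a b B g11 g12 g22 Hchart s Hs) as HBs.
      assert (HBl : / MI <= B s).
      { specialize (HBi s r Hs Hr). rewrite Rabs_pos_eq in HBi by (apply Rlt_le, Rinv_0_lt_compat, HBs).
        rewrite <- (Rinv_inv (B s)). apply Rinv_le_contravar; [now apply Rinv_0_lt_compat | exact HBi]. }
      replace (be * m1 * q) with (/ 2 * (w * q * sqrt m * (be * / MI))) by (unfold m1; ring).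
      apply Rmult_le_compat_l; [lra |].
      apply Rmult_le_compat; [| apply Rmult_le_pos; lra | | apply Rmult_le_compat_l; lra].
      + repeat apply Rmult_le_pos; lra.
      + apply Rmult_le_compat; [apply Rmult_le_pos; lra | lra | exact Hco | exact Hsg].
    - replace (be * be * ((b - a) * (2 * M2))) with (dbl a b (fun _ _ => be * be * M2))
        by (rewrite dbl_const; ring).
      apply dbl_le; [lra | apply ct2_mult; [apply ct2_const | exact cWI] | apply ct2_const |].
      intros s r Hs Hr. specialize (HGm be s r Hb Hs Hr). specialize (HCg be s r Hb Hs Hr).
      cbv beta. rewrite pow_O, Rmult_1_l, pow_1 in HCg.
      set (G := g11 s (be * B s * r)) in *.
      replace (e00 g11 (fun x _ => x) (fun _ y => y) s (be * B s * r)) with (/ 2 * (1 - G))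
        by (unfold e00, pd2; simpl; rewrite Derive_id, Derive_const; fold G; ring).
      replace (e01 (fun x _ => x) (fun _ y => y) s (be * B s * r)) with 0
        by (unfold e01, pd2; simpl; rewrite !Derive_id, !Derive_const; ring).
      replace (e11 (fun x _ => x) (fun _ y => y) s (be * B s * r)) with 0
        by (unfold e11, pd2; simpl; rewrite !Derive_id, !Derive_const; ring).
      pose proof (chart_B_pos a b B g11 g12 g22 Hchart s Hs) as HBs.
      assert (HBu : B s <= MB) by (specialize (HB s r Hs Hr); rewrite Rabs_pos_eq in HB; lra).
      assert (Hsg : sqrt G <= sqrt (/ m)) by (apply sqrt_le_1_alt; lra).
      assert (HGi : / G <= / m) by (apply Rinv_le_contravar; lra).
      assert (HGi0 : 0 < / G) by (apply Rinv_0_lt_compat; lra).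
      (* The squared strain of the identity is O(be^2). One power is given up: any positive power
         makes the limit strain vanish. *)
      assert (Hbe2 : be ^ 2 <= be) by nra.
      pose proof (sqrt_pos G). 
      replace (bilin lam mu G (/ 2 * (1 - G)) 0 0 (/ 2 * (1 - G)) 0 0)
        with ((lam + 2 * mu) * (/ 2 * (1 - G)) ^ 2 * (/ G) ^ 2) by (unfold bilin; field; lra).
      assert (Hsq : (/ 2 * (1 - G)) ^ 2 <= (/ 2 * Cg) ^ 2 * be ^ 2).
      { replace ((/ 2 * Cg) ^ 2 * be ^ 2) with ((/ 2 * (Cg * be)) ^ 2) by ring.
        rewrite <- (pow2_abs (/ 2 * (1 - G))). apply pow_incr. split; [apply Rabs_pos |].
        rewrite Rabs_mult, (Rabs_pos_eq (/ 2)) by lra. rewrite Rabs_minus_sym. lra. }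
      replace (be * be * M2) with (/ 2 * ((lam + 2 * mu) * ((/ 2 * Cg) ^ 2 * be) * (/ m) ^ 2
        * sqrt (/ m) * (be * MB))) by (unfold M2; ring).
      apply Rmult_le_compat_l; [lra |].
      apply Rmult_le_compat; [| apply Rmult_le_pos; lra | | apply Rmult_le_compat_l; lra].
      + apply Rmult_le_pos; [| lra]. apply Rmult_le_pos; [| apply pow2_ge_0].
        apply Rmult_le_pos; [lra | apply pow2_ge_0].
      + apply Rmult_le_compat; [| lra | | exact Hsg].
        * apply Rmult_le_pos; [| apply pow2_ge_0]. apply Rmult_le_pos; [lra | apply pow2_ge_0].
        * apply Rmult_le_compat; [| apply pow2_ge_0 | | apply pow_incr; lra].
          -- apply Rmult_le_pos; [lra | apply pow2_ge_0].
          -- apply Rmult_le_compat_l; [lra |]. apply Rle_trans with (1 := Hsq).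
             apply Rmult_le_compat_l; [apply pow2_ge_0 | exact Hbe2]. }
  assert (Tot : dbl a b (fun s r => A s r ^ 2 + K s r ^ 2 + C s r ^ 2) <=
    (b - a) * (2 * M2) / m1 * be).
  { apply Rmult_le_reg_l with (be * m1); [apply Rmult_lt_0_compat; lra |].
    apply Rle_trans with (1 := Low). right. field. lra. }
  assert (Part : forall f, ct2 a b f ->
    (forall s r, f s r ^ 2 <= A s r ^ 2 + K s r ^ 2 + C s r ^ 2) ->
    dbl a b (fun s r => f s r ^ 2) <= (b - a) * (2 * M2) / m1 * be).
  { intros f Hf Hle. eapply Rle_trans; [| exact Tot].
    apply dbl_le; [lra | now apply ct2_pow | exact cS |]. intros. apply Hle. }
  split; [| split].
  - apply (Part A cA). intros s r. pose proof (pow2_ge_0 (K s r)). pose proof (pow2_ge_0 (C s r)). lra.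
  - apply (Part K cK). intros s r. pose proof (pow2_ge_0 (A s r)). pose proof (pow2_ge_0 (C s r)). lra.
  - apply (Part C cC). intros s r. pose proof (pow2_ge_0 (K s r)). pose proof (pow2_ge_0 (A s r)). lra.
Qed.

End Minimizers.

(** * Strain at second order *)

Lemma RInt_quadratic f al ga de :
  (forall r, -1 <= r <= 1 -> f r = al + ga * r + de * r ^ 2) ->
  RInt f (-1) 1 = 2 * al + 2 * de / 3 /\ RInt (fun r => f r * r) (-1) 1 = 2 * ga / 3.
Proof.
  intros H. split.
  - rewrite (RInt_ext_R f (fun r => al + ga * r + de * r ^ 2)); [| lra | exact H].
    rewrite (is_RInt_unique _ (-1) 1 (minus (al * 1 + ga * 1 ^ 2 / 2 + de * 1 ^ 3 / 3)
      (al * -1 + ga * (-1) ^ 2 / 2 + de * (-1) ^ 3 / 3))).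
    + unfold minus, plus, opp; simpl. field.
    + apply (is_RInt_derive (fun r => al * r + ga * r ^ 2 / 2 + de * r ^ 3 / 3)).
      * intros x _. auto_derive; [trivial | field].
      * intros x _. apply (ex_derive_continuous (V := R_NormedModule)). auto_derive. trivial.
  - rewrite (RInt_ext_R _ (fun r => (al + ga * r + de * r ^ 2) * r));
      [| lra | intros r Hr; now rewrite H].
    rewrite (is_RInt_unique _ (-1) 1 (minus (al * 1 ^ 2 / 2 + ga * 1 ^ 3 / 3 + de * 1 ^ 4 / 4)
      (al * (-1) ^ 2 / 2 + ga * (-1) ^ 3 / 3 + de * (-1) ^ 4 / 4))).
    + unfold minus, plus, opp; simpl. field.
    + apply (is_RInt_derive (fun r => al * r ^ 2 / 2 + ga * r ^ 3 / 3 + de * r ^ 4 / 4)).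
      * intros x _. auto_derive; [trivial | field].
      * intros x _. apply (ex_derive_continuous (V := R_NormedModule)). auto_derive. trivial.
Qed.

(** By Lagrange's identity the determinant of the pair squares to 1, so w is determined by its two
    scalar products. *)
Lemma orthonormal_zero x1 x2 z1 z2 w1 w2 :
  x1 * x1 + x2 * x2 = 1 -> z1 * z1 + z2 * z2 = 1 -> x1 * z1 + x2 * z2 = 0 ->
  x1 * w1 + x2 * w2 = 0 -> z1 * w1 + z2 * w2 = 0 -> w1 = 0 /\ w2 = 0.
Proof.
  intros Hx Hz Hxz H1 H2.
  assert (D : (x1 * z2 - x2 * z1) * (x1 * z2 - x2 * z1) = 1).
  { transitivity ((x1 * x1 + x2 * x2) * (z1 * z1 + z2 * z2)
      - (x1 * z1 + x2 * z2) * (x1 * z1 + x2 * z2)); [ring | rewrite Hx, Hz, Hxz; ring]. }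
  set (d := x1 * z2 - x2 * z1) in *.
  assert (E1 : d * w1 = 0).
  { transitivity (z2 * (x1 * w1 + x2 * w2) - x2 * (z1 * w1 + z2 * w2));
      [unfold d; ring | rewrite H1, H2; ring]. }
  assert (E2 : d * w2 = 0).
  { transitivity (x1 * (z1 * w1 + z2 * w2) - z1 * (x1 * w1 + x2 * w2));
      [unfold d; ring | rewrite H1, H2; ring]. }
  apply Rmult_integral in E1, E2.
  assert (d <> 0) by (intros E; rewrite E in D; lra).
  split; [destruct E1 | destruct E2]; tauto.
Qed.

(** A vector orthogonal to z is a multiple of x. *)
Lemma orthonormal_norm x1 x2 z1 z2 w1 w2 :
  x1 * x1 + x2 * x2 = 1 -> z1 * z1 + z2 * z2 = 1 -> x1 * z1 + x2 * z2 = 0 ->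
  z1 * w1 + z2 * w2 = 0 -> w1 * w1 + w2 * w2 = (x1 * w1 + x2 * w2) ^ 2.
Proof.
  intros Hx Hz Hxz H.
  destruct (orthonormal_zero x1 x2 z1 z2 (w1 - (x1 * w1 + x2 * w2) * x1)
    (w2 - (x1 * w1 + x2 * w2) * x2) Hx Hz Hxz) as [E1 E2].
  - transitivity ((x1 * w1 + x2 * w2) * (1 - (x1 * x1 + x2 * x2))); [ring | rewrite Hx; ring].
  - transitivity ((z1 * w1 + z2 * w2) - (x1 * w1 + x2 * w2) * (x1 * z1 + x2 * z2));
      [ring | rewrite H, Hxz; ring].
  - set (t := x1 * w1 + x2 * w2) in *.
    assert (W1 : w1 = t * x1) by lra. assert (W2 : w2 = t * x2) by lra.
    rewrite W1, W2. transitivity (t ^ 2 * (x1 * x1 + x2 * x2)); [ring | rewrite Hx; ring].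
Qed.

Lemma strain_expansions a b X1 X2 Z1 Z2 G p0 p1 p2 q0 q1 q2 u0 u1 u2 v0 v1 v2 h1 h2 : a < b ->
  ex3 a b X1 p0 p1 p2 -> ex3 a b X2 q0 q1 q2 -> ex3 a b Z1 u0 u1 u2 -> ex3 a b Z2 v0 v1 v2 ->
  ex3 a b G (fun _ _ => 1) h1 h2 ->
  ex3 a b (fun be s r => / 2 * (X1 be s r ^ 2 + X2 be s r ^ 2 - G be s r))
    (fun s r => / 2 * (p0 s r * p0 s r + q0 s r * q0 s r - 1))
    (fun s r => p0 s r * p1 s r + q0 s r * q1 s r - h1 s r / 2)
    (fun s r => p0 s r * p2 s r + q0 s r * q2 s r + / 2 * (p1 s r * p1 s r + q1 s r * q1 s r)
       - h2 s r / 2) /\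
  ex3 a b (fun be s r => / 2 * (X1 be s r * Z1 be s r + X2 be s r * Z2 be s r))
    (fun s r => / 2 * (p0 s r * u0 s r + q0 s r * v0 s r))
    (fun s r => / 2 * (p0 s r * u1 s r + p1 s r * u0 s r + q0 s r * v1 s r + q1 s r * v0 s r))
    (fun s r => / 2 * (p0 s r * u2 s r + p1 s r * u1 s r + p2 s r * u0 s r
       + (q0 s r * v2 s r + q1 s r * v1 s r + q2 s r * v0 s r))) /\
  ex3 a b (fun be s r => / 2 * (Z1 be s r ^ 2 + Z2 be s r ^ 2 - 1))
    (fun s r => / 2 * (u0 s r * u0 s r + v0 s r * v0 s r - 1))
    (fun s r => u0 s r * u1 s r + v0 s r * v1 s r)
    (fun s r => u0 s r * u2 s r + v0 s r * v2 s r + / 2 * (u1 s r * u1 s r + v1 s r * v1 s r)).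
Proof.
  intros Hab HX1 HX2 HZ1 HZ2 HG.
  pose proof (ex3_ct2 a b _ (ct2_const a b (/ 2))) as Hh.
  pose proof (ex3_ct2 a b _ (ct2_const a b 1)) as H1.
  pose proof (ex3_mult a b _ _ _ _ _ _ _ _ HX1 HX1) as X11.
  pose proof (ex3_mult a b _ _ _ _ _ _ _ _ HX2 HX2) as X22.
  pose proof (ex3_mult a b _ _ _ _ _ _ _ _ HZ1 HZ1) as Z11.
  pose proof (ex3_mult a b _ _ _ _ _ _ _ _ HZ2 HZ2) as Z22.
  pose proof (ex3_mult a b _ _ _ _ _ _ _ _ HX1 HZ1) as XZ1.
  pose proof (ex3_mult a b _ _ _ _ _ _ _ _ HX2 HZ2) as XZ2.
  pose proof (ex3_mult a b _ _ _ _ _ _ _ _ Hh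
    (ex3_minus a b _ _ _ _ _ _ _ _ (ex3_plus a b _ _ _ _ _ _ _ _ X11 X22) HG)) as EA.
  pose proof (ex3_mult a b _ _ _ _ _ _ _ _ Hh (ex3_plus a b _ _ _ _ _ _ _ _ XZ1 XZ2)) as EK.
  pose proof (ex3_mult a b _ _ _ _ _ _ _ _ Hh
    (ex3_minus a b _ _ _ _ _ _ _ _ (ex3_plus a b _ _ _ _ _ _ _ _ Z11 Z22) H1)) as EC.
  split; [| split].
  - refine (ex3_limit_ext a b Hab _ _ _ _ _ _ _ (ex3_ext a b _ _ _ _ _ _ EA) _ _ _);
      intros; cbv beta; field.
  - refine (ex3_limit_ext a b Hab _ _ _ _ _ _ _ (ex3_ext a b _ _ _ _ _ _ EK) _ _ _);
      intros; cbv beta; field.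
  - refine (ex3_limit_ext a b Hab _ _ _ _ _ _ _ (ex3_ext a b _ _ _ _ _ _ EC) _ _ _);
      intros; cbv beta; field.
Qed.

Section Asymptotics.

Variables (a b Y nu : R) (B : R -> R) (g11 g12 g22 : R -> R -> R) (Phi1 Phi2 : R -> R -> R -> R).
Hypothesis Hchart : chart_hyp a b B g11 g12 g22.
Hypothesis HY : 0 < Y.
Hypothesis Hnu : -1 < nu < 1.
Hypothesis Hfam : forall beta, 0 < beta <= 1 ->
     is_embedding a b B beta (Phi1 beta) (Phi2 beta) /\
     forall Psi1 Psi2 : R -> R -> R, is_embedding a b B beta Psi1 Psi2 ->
       strain_energy a b B beta Y nu g11 g12 g22 (Phi1 beta) (Phi2 beta)
       <= strain_energy a b B beta Y nu g11 g12 g22 Psi1 Psi2.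
Variables (F1 F2 : R -> R -> R -> R) (U1 U2 : R * (R * R) -> Prop).
Hypothesis HU1 : open U1.
Hypothesis HU2 : open U2.
Hypothesis HSU1 : forall be s r, 0 <= be <= 1 -> a <= s <= b -> -1 <= r <= 1 -> U1 (be, (s, r)).
Hypothesis HSU2 : forall be s r, 0 <= be <= 1 -> a <= s <= b -> -1 <= r <= 1 -> U2 (be, (s, r)).
Hypothesis HF1 : smooth3_open U1 F1.
Hypothesis HF2 : smooth3_open U2 F2.
Hypothesis HFP1 : forall be s r, 0 < be <= 1 -> a <= s <= b -> -1 <= r <= 1 ->
  F1 be s r = Phi1 be s (be * B s * r).
Hypothesis HFP2 : forall be s r, 0 < be <= 1 -> a <= s <= b -> -1 <= r <= 1 ->
  F2 be s r = Phi2 be s (be * B s * r).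

Let Hab : a < b := chart_ab a b B g11 g12 g22 Hchart.
Let HB : ct1 a b B := chart_B_ct1 a b B g11 g12 g22 Hchart.
Let HdB : ct1 a b (Derive B) := chart_dB_ct1 a b B g11 g12 g22 Hchart.
Let HBd := chart_B_ex_derive a b B g11 g12 g22 Hchart.
Let HBpos := chart_B_pos a b B g11 g12 g22 Hchart.

(* In lists of derivatives 0, 1, 2 stand for beta, s, r; the head is the outermost one. *)
Let c1 l s r := dpart3 l F1 0 s r.
Let c2 l s r := dpart3 l F2 0 s r.
Let G be s r := g11 s (be * B s * r).
Let A be s r := e00 g11 (Phi1 be) (Phi2 be) s (be * B s * r).
Let K be s r := e01 (Phi1 be) (Phi2 be) s (be * B s * r).
Let C be s r := e11 (Phi1 be) (Phi2 be) s (be * B s * r).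

Lemma Phi1_smooth be : 0 < be <= 1 -> smooth2_on (InDbeta a b B be) (Phi1 be).
Proof. intros Hb. apply (Hfam be Hb). Qed.

Lemma Phi2_smooth be : 0 < be <= 1 -> smooth2_on (InDbeta a b B be) (Phi2 be).
Proof. intros Hb. apply (Hfam be Hb). Qed.

(** |F_r|^2 - (be B)^2 = 2 (be B)^2 E_22, and E_22 is small in mean square by the energy bound. In
    the limit this leaves |F_r|^2 = 0 at beta = 0. *)
Lemma collapse s r : a <= s <= b -> -1 <= r <= 1 -> c1 [2%nat] s r = 0 /\ c2 [2%nat] s r = 0.
Proof.
  revert s r.
  assert (cB : ct2 a b (fun s _ => B s)) by (now apply ct2_s).
  (* The term with factor 0 is the value of (be B)^2 at beta = 0, written as the calculus of
     expansions delivers it. *)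
  assert (E : forall s r, a <= s <= b -> -1 <= r <= 1 ->
    c1 [2%nat] s r * c1 [2%nat] s r + c2 [2%nat] s r * c2 [2%nat] s r - 0 * (B s * B s) = 0).
  { destruct (energy_bound a b Y nu B g11 g12 g22 Phi1 Phi2 Hchart HY Hnu Hfam) as [M HM].
    destruct (ct2_bounded a b _ cB) as [MB [HMB HBb]].
    pose proof (family_taylor_d a b Hab F1 U1 HU1 HSU1 HF1 2 (or_intror eq_refl)) as T1.
    pose proof (family_taylor_d a b Hab F2 U2 HU2 HSU2 HF2 2 (or_intror eq_refl)) as T2.
    assert (cBB : ct2 a b (fun s _ => B s * B s)) by ct2_tac.
    assert (Tb : ex3 a b (fun be _ _ => be ^ 2) (fun _ _ => 0) (fun _ _ => 0) (fun _ _ => 1)).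
    { refine (ex3_ext a b _ _ _ _ _ _ (ex3_poly a b _ _ _ (ct2_const a b 0) (ct2_const a b 0)
        (ct2_const a b 1))). intros. cbv beta. ring. }
    pose proof (ex3_minus a b _ _ _ _ _ _ _ _ (ex3_plus a b _ _ _ _ _ _ _ _
      (ex3_mult a b _ _ _ _ _ _ _ _ T1 T1) (ex3_mult a b _ _ _ _ _ _ _ _ T2 T2))
      (ex3_mult a b _ _ _ _ _ _ _ _ Tb (ex3_ct2 a b _ cBB))) as T.
    apply ex3_approx0 in T. cbv beta in T.
    apply (square_limit a b Hab _ _ (4 * (MB * MB) ^ 2 * Rabs M) T).
    intros be Hb.
    assert (d1 := dpart3_ct2 a b Hab F1 U1 HSU1 HF1 [2%nat] be ltac:(lra)).
    assert (d2 := dpart3_ct2 a b Hab F2 U2 HSU2 HF2 [2%nat] be ltac:(lra)).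
    assert (d1' : ct2 a b (fun s r => dpart3 [2%nat] F1 be s r)) by exact d1.
    assert (d2' : ct2 a b (fun s r => dpart3 [2%nat] F2 be s r)) by exact d2.
    split; [ct2_tac |].
    destruct (thin_ct2 a b Y nu B g11 g12 g22 Phi1 Phi2 Hchart Hnu Hfam be Hb) as [_ [_ [_ [_ [_ cC]]]]].
    apply Rle_trans with (dbl a b (fun s r => 4 * (MB * MB) ^ 2 * C be s r ^ 2)).
    - apply dbl_le; [lra | ct2_tac | |].
      + apply ct2_mult; [apply ct2_const | now apply ct2_pow].
      + intros s r Hs Hr.
        rewrite (family_dr a b B HBpos Phi1 F1 U1 HSU1 HF1 Phi1_smooth HFP1 be s r Hb Hs Hr).
        rewrite (family_dr a b B HBpos Phi2 F2 U2 HSU2 HF2 Phi2_smooth HFP2 be s r Hb Hs Hr).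
        match goal with |- ?e ^ 2 <= _ => replace e with (2 * (be ^ 2 * (B s * B s)) * C be s r)
          by (unfold C, e11; field) end.
        rewrite !Rpow_mult_distr. apply Rmult_le_compat_r; [apply pow2_ge_0 |].
        replace (4 * (MB ^ 2 * MB ^ 2)) with (2 ^ 2 * (1 ^ 2 * (MB ^ 2 * MB ^ 2))) by ring.
        assert (HBs : 0 <= B s <= MB).
        { specialize (HBb s r Hs Hr). pose proof (HBpos s Hs). rewrite Rabs_pos_eq in HBb; lra. }
        apply Rmult_le_compat_l; [lra |].
        apply Rmult_le_compat; [apply pow2_ge_0 | | |].
        * apply Rmult_le_pos; apply pow2_ge_0.
        * apply pow_incr. split; [apply pow_le; lra |]. nra.
        * apply Rmult_le_compat; try apply pow2_ge_0; apply pow_incr; lra.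
    - rewrite dbl_scal; [| lra | now apply ct2_pow].
      destruct (HM be Hb) as [_ [_ H3]].
      replace (4 * (MB * MB) ^ 2 * Rabs M * be) with (4 * (MB * MB) ^ 2 * (Rabs M * be)) by ring.
      apply Rmult_le_compat_l; [pose proof (pow2_ge_0 (MB * MB)); lra |].
      apply Rle_trans with (1 := H3). apply Rmult_le_compat_r; [lra | apply Rle_abs]. }
  intros s r Hs Hr. specialize (E s r Hs Hr).
  split; nra.
Qed.

(* d_1 Phi = (x1, x2) + beta (p1, q1) + beta^2 (p2, q2) + O(beta^3),
   d_2 Phi = (z1, z2) + beta (u1, v1) + beta^2 (u2, v2) + O(beta^3),
   g_11 = 1 + beta h1 + beta^2 h2 + O(beta^3). *)
Let x1 (s r : R) := c1 [1%nat] s 0.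
Let x2 (s r : R) := c2 [1%nat] s 0.
Let z1 s r := c1 [2; 0]%nat s r / B s.
Let z2 s r := c2 [2; 0]%nat s r / B s.
Let bb s := Derive B s / B s.
Let p1 s r := c1 [1; 0]%nat s r - r * bb s * c1 [2; 0]%nat s r.
Let q1 s r := c2 [1; 0]%nat s r - r * bb s * c2 [2; 0]%nat s r.
Let p2 s r := (c1 [1; 0; 0]%nat s r - r * bb s * c1 [2; 0; 0]%nat s r) / 2.
Let q2 s r := (c2 [1; 0; 0]%nat s r - r * bb s * c2 [2; 0; 0]%nat s r) / 2.
Let u1 s r := c1 [2; 0; 0]%nat s r / (2 * B s).
Let v1 s r := c2 [2; 0; 0]%nat s r / (2 * B s).
Let h1 s r := B s * r * pd2 1 g11 s 0.
Let h2 s r := (B s * r) ^ 2 * pd2 1 (pd2 1 g11) s 0 / 2.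
Let u2 s r := c1 [2; 0; 0; 0]%nat s r / (6 * B s).
Let v2 s r := c2 [2; 0; 0; 0]%nat s r / (6 * B s).

Lemma map_expansions :
  ex3 a b (fun be s r => pd2 0 (Phi1 be) s (be * B s * r)) x1 p1 p2 /\
  ex3 a b (fun be s r => pd2 0 (Phi2 be) s (be * B s * r)) x2 q1 q2 /\
  ex3 a b (fun be s r => pd2 1 (Phi1 be) s (be * B s * r)) z1 u1 u2 /\
  ex3 a b (fun be s r => pd2 1 (Phi2 be) s (be * B s * r)) z2 v1 v2.
Proof.
  pose proof (fun s r Hs Hr => proj1 (collapse s r Hs Hr)) as C1.
  pose proof (fun s r Hs Hr => proj2 (collapse s r Hs Hr)) as C2.
  split; [| split; [| split]].
  - refine (ex3_limit_ext a b Hab _ _ _ _ _ _ _ (X_expansion a b B Hab HB HdB HBd HBpos Phi1 F1 U1 HU1 HSU1 HF1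
      Phi1_smooth HFP1) _ _ _); try reflexivity.
    intros s r Hs Hr. pose proof (C1 s r Hs Hr) as E. unfold c1 in E. rewrite E.
    rewrite (proj2 (coefficient_const a b Hab F1 U1 HSU1 HF1 C1 s r Hs Hr)). unfold x1, c1. ring.
  - refine (ex3_limit_ext a b Hab _ _ _ _ _ _ _ (X_expansion a b B Hab HB HdB HBd HBpos Phi2 F2 U2 HU2 HSU2 HF2
      Phi2_smooth HFP2) _ _ _); try reflexivity.
    intros s r Hs Hr. pose proof (C2 s r Hs Hr) as E. unfold c2 in E. rewrite E.
    rewrite (proj2 (coefficient_const a b Hab F2 U2 HSU2 HF2 C2 s r Hs Hr)). unfold x2, c2. ring.
  - exact (Z_expansion a b B Hab HB HBpos Phi1 F1 U1 HU1 HSU1 HF1 Phi1_smooth HFP1 C1).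
  - exact (Z_expansion a b B Hab HB HBpos Phi2 F2 U2 HU2 HSU2 HF2 Phi2_smooth HFP2 C2).
Qed.

(* Coefficients of E_11 (a), E_12 (k) and E_22 (d). *)
Let a0 s r := / 2 * (x1 s r * x1 s r + x2 s r * x2 s r - 1).
Let a1 s r := x1 s r * p1 s r + x2 s r * q1 s r - h1 s r / 2.
Let a2 s r := x1 s r * p2 s r + x2 s r * q2 s r + / 2 * (p1 s r * p1 s r + q1 s r * q1 s r)
  - h2 s r / 2.
Let k0 s r := / 2 * (x1 s r * z1 s r + x2 s r * z2 s r).
Let k1 s r := / 2 * (x1 s r * u1 s r + p1 s r * z1 s r + x2 s r * v1 s r + q1 s r * z2 s r).
Let k2 s r := / 2 * (x1 s r * u2 s r + p1 s r * u1 s r + p2 s r * z1 s r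
  + (x2 s r * v2 s r + q1 s r * v1 s r + q2 s r * z2 s r)).
Let d0 s r := / 2 * (z1 s r * z1 s r + z2 s r * z2 s r - 1).
Let d1 s r := z1 s r * u1 s r + z2 s r * v1 s r.
Let d2 s r := z1 s r * u2 s r + z2 s r * v2 s r + / 2 * (u1 s r * u1 s r + v1 s r * v1 s r).

Lemma strain_ex3 : ex3 a b A a0 a1 a2 /\ ex3 a b K k0 k1 k2 /\ ex3 a b C d0 d1 d2.
Proof.
  destruct map_expansions as [E1 [E2 [E3 E4]]].
  exact (strain_expansions a b _ _ _ _ _ _ _ _ _ _ _ _ _ _ _ _ _ _ _ Hab E1 E2 E3 E4
    (metric_expansion a b B g11 g12 g22 Hchart)).
Qed.

(** The energy bound removes the constant terms of all three strains; this says that the limit of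
    dPhi is an isometry, with orthonormal frame (x, z). *)
Lemma frame_limit s r : a <= s <= b -> -1 <= r <= 1 ->
  x1 s r * x1 s r + x2 s r * x2 s r = 1 /\ z1 s r * z1 s r + z2 s r * z2 s r = 1 /\
  x1 s r * z1 s r + x2 s r * z2 s r = 0 /\ a0 s r = 0 /\ k0 s r = 0 /\ d0 s r = 0.
Proof.
  intros Hs Hr.
  destruct (energy_bound a b Y nu B g11 g12 g22 Phi1 Phi2 Hchart HY Hnu Hfam) as [M HM].
  destruct strain_ex3 as [EA [EK EC]].
  pose proof (thin_ct2 a b Y nu B g11 g12 g22 Phi1 Phi2 Hchart Hnu Hfam) as Ct.
  assert (ZA : a0 s r = 0).
  { apply (square_limit a b Hab A a0 M (ex3_approx0 a b _ _ _ _ EA)); auto.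
    intros be Hb. split; [apply (Ct be Hb) | apply (HM be Hb)]. }
  assert (ZK : k0 s r = 0).
  { apply (square_limit a b Hab K k0 M (ex3_approx0 a b _ _ _ _ EK)); auto.
    intros be Hb. split; [apply (Ct be Hb) | apply (HM be Hb)]. }
  assert (ZC : d0 s r = 0).
  { apply (square_limit a b Hab C d0 M (ex3_approx0 a b _ _ _ _ EC)); auto.
    intros be Hb. split; [apply (Ct be Hb) | apply (HM be Hb)]. }
  unfold a0 in *. unfold k0 in *. unfold d0 in *. repeat split; lra.
Qed.

(** (z1, z2) is a unit vector orthogonal to (x1, x2), which does not depend on r. Differentiating
    both relations in r shows that dz/dr is orthogonal to z and to x, hence zero. *)
Lemma director_const s r : a <= s <= b -> -1 <= r <= 1 ->
  c1 [2; 0]%nat s r = c1 [2; 0]%nat s 0 /\ c2 [2; 0]%nat s r = c2 [2; 0]%nat s 0.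
Proof.
  intros Hs Hr. pose proof (HBpos s Hs) as HBs.
  assert (D1 : forall t, -1 <= t <= 1 -> is_derive (fun r => c1 [2; 0]%nat s r) t (c1 [2; 2; 0]%nat s t)).
  { intros t Ht. exact (proj2 (proj2 (dpart3_is_derive a b F1 U1 HSU1 HF1 [2; 0]%nat 0 s t ltac:(lra) Hs Ht))). }
  assert (D2 : forall t, -1 <= t <= 1 -> is_derive (fun r => c2 [2; 0]%nat s r) t (c2 [2; 2; 0]%nat s t)).
  { intros t Ht. exact (proj2 (proj2 (dpart3_is_derive a b F2 U2 HSU2 HF2 [2; 0]%nat 0 s t ltac:(lra) Hs Ht))). }
  assert (Z : forall t, -1 <= t <= 1 -> c1 [2; 2; 0]%nat s t = 0 /\ c2 [2; 2; 0]%nat s t = 0).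
  { intros t Ht. destruct (frame_limit s t Hs Ht) as [Ex [Ez [Exz _]]].
    apply (orthonormal_zero (x1 s t) (x2 s t) (z1 s t) (z2 s t)); auto.
    - pose proof (is_derive_plus (V := R_NormedModule) _ _ _ _ _
        (is_derive_scal _ _ (x1 s 0) _ (D1 t Ht)) (is_derive_scal _ _ (x2 s 0) _ (D2 t Ht))) as D.
      assert (E0 : Derive (fun r => x1 s 0 * c1 [2; 0]%nat s r + x2 s 0 * c2 [2; 0]%nat s r) t = 0).
      { transitivity (Derive (fun _ => 0) t); [| apply Derive_const].
        apply (Derive_eq_on_interval (-1) 1); auto; [lra | eexists; exact D | apply ex_derive_const |].
        intros y Hy. destruct (frame_limit s y Hs Hy) as [_ [_ [E _]]].
        transitivity (B s * (x1 s y * z1 s y + x2 s y * z2 s y)); [| rewrite E; ring].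
        unfold z1, z2, x1, x2. field. lra. }
      exact (eq_trans (eq_sym (is_derive_unique _ _ _ D)) E0).
    - pose proof (is_derive_plus (V := R_NormedModule) _ _ _ _ _
        (is_derive_mult _ _ _ _ _ (D1 t Ht) (D1 t Ht) Rmult_comm)
        (is_derive_mult _ _ _ _ _ (D2 t Ht) (D2 t Ht) Rmult_comm)) as D.
      assert (E0 : Derive (fun r => c1 [2; 0]%nat s r * c1 [2; 0]%nat s r
        + c2 [2; 0]%nat s r * c2 [2; 0]%nat s r) t = 0).
      { transitivity (Derive (fun _ => B s * B s) t); [| apply Derive_const].
        apply (Derive_eq_on_interval (-1) 1); auto; [lra | eexists; exact D | apply ex_derive_const |].
        intros y Hy. destruct (frame_limit s y Hs Hy) as [_ [E _]].
        transitivity (B s * B s * (z1 s y * z1 s y + z2 s y * z2 s y)); [| rewrite E; ring].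
        unfold z1, z2. field. lra. }
      pose proof (eq_trans (eq_sym (is_derive_unique _ _ _ D)) E0) as E.
      unfold plus, mult in E; simpl in E.
      apply Rmult_eq_reg_l with (2 * B s); [| lra]. rewrite Rmult_0_r, <- E.
      unfold z1, z2. field. lra. }
  assert (M : forall f df, (forall t, -1 <= t <= 1 -> is_derive f t (df t)) ->
    (forall t, -1 <= t <= 1 -> df t = 0) -> f r = f 0).
  { intros f df Hd H0.
    destruct (MVT_gen f 0 r df) as [t [Ht E]].
    - intros t Ht. apply Hd. unfold Rmin, Rmax in Ht. destruct Rle_dec; lra.
    - intros t Ht. apply ex_derive_continuity_pt. exists (df t). apply Hd.
      unfold Rmin, Rmax in Ht. destruct Rle_dec; lra.
    - rewrite H0 in E; [lra |]. unfold Rmin, Rmax in Ht. destruct Rle_dec; lra. }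
  split.
  - apply (M (fun r => c1 [2; 0]%nat s r) (fun t => c1 [2; 2; 0]%nat s t) D1). apply Z.
  - apply (M (fun r => c2 [2; 0]%nat s r) (fun t => c2 [2; 2; 0]%nat s t) D2). apply Z.
Qed.

Lemma strain_leading k ea ek ec : approx a b k A ea -> approx a b k K ek -> approx a b k C ec ->
  forall s r, a <= s <= b -> -1 <= r <= 1 ->
    ek s r = 0 /\ ec s r = - nu * ea s r /\
    RInt (ea s) (-1) 1 = 0 /\ RInt (fun r => ea s r * r) (-1) 1 = 0.
Proof.
  intros HA HK HC.
  destruct (lame_facts Y nu HY Hnu) as [Hl [HL Hmu]].
  destruct (metric_lower a b B g11 g12 g22 Hchart) as [m [Hm HGm]].
  destruct map_expansions as [E1 [E2 [E3 E4]]].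
  assert (Hmu0 : lame_mu Y nu <> 0) by lra.
  refine (leading_order a b (lame_lambda Y nu) (lame_mu Y nu) nu B Hab HB HBpos Hmu0 Hl HL Hnu
    G _ _ _ _ (fun be s r => Phi1 be s (be * B s * r)) (fun be s r => Phi2 be s (be * B s * r))
    A K C x1 x2 z1 z2 m Hm (fun be s r Hb Hs Hr => proj1 (HGm be s r Hb Hs Hr))
    (ex3_approx0 a b _ _ _ _ (metric_expansion a b B g11 g12 g22 Hchart))
    (ex3_approx0 a b _ _ _ _ E1) (ex3_approx0 a b _ _ _ _ E2)
    (ex3_approx0 a b _ _ _ _ E3) (ex3_approx0 a b _ _ _ _ E4)
    _ _ _ _ _ _ _ _ _ _ _ _ k ea ek ec HA HK HC).
  - intros s r Hs Hr. apply (frame_limit s r Hs Hr).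
  - intros s r Hs Hr. apply (frame_limit s r Hs Hr).
  - intros s r Hs Hr. apply (frame_limit s r Hs Hr).
  - intros s r Hs Hr. split; reflexivity.
  - intros s r Hs Hr. destruct (director_const s r Hs Hr) as [D1 D2].
    unfold z1, z2. now rewrite D1, D2.
  - exact (displacement_expansion a b B Hab HB HBpos Phi1 F1 U1 HSU1 HF1 HFP1
      (fun s r Hs Hr => proj1 (collapse s r Hs Hr)) (fun s r Hs Hr => proj1 (director_const s r Hs Hr))).
  - exact (displacement_expansion a b B Hab HB HBpos Phi2 F2 U2 HSU2 HF2 HFP2
      (fun s r Hs Hr => proj2 (collapse s r Hs Hr)) (fun s r Hs Hr => proj2 (director_const s r Hs Hr))).
  - intros be Hb. destruct (thin_ct2 a b Y nu B g11 g12 g22 Phi1 Phi2 Hchart Hnu Hfam be Hb) as [_ [P1 [P2 _]]].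
    split; assumption.
  - intros be Hb. exact (proj1 (balance a b Y nu B g11 g12 g22 Phi1 Phi2 Hchart Hnu Hfam be Hb)).
  - intros be s Hb Hs.
    exact (proj1 (proj2 (balance a b Y nu B g11 g12 g22 Phi1 Phi2 Hchart Hnu Hfam be Hb)) s Hs).
  - intros be s Hb Hs.
    exact (proj1 (proj2 (proj2 (balance a b Y nu B g11 g12 g22 Phi1 Phi2 Hchart Hnu Hfam be Hb))) s Hs).
  - intros be i n Hb.
    exact (proj2 (proj2 (proj2 (balance a b Y nu B g11 g12 g22 Phi1 Phi2 Hchart Hnu Hfam be Hb))) i n).
Qed.

(** * Strain at first and second order *)

(** (Q1, Q2) is B dz/ds on the center curve; it is the slope in r of the first correction (p1, q1)
    to d_1 Phi. *)
Let Q1 s := c1 [1; 2; 0]%nat s 0 - bb s * c1 [2; 0]%nat s 0.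
Let Q2 s := c2 [1; 2; 0]%nat s 0 - bb s * c2 [2; 0]%nat s 0.

Lemma first_coefficient_affine s r : a <= s <= b -> -1 <= r <= 1 ->
  p1 s r = p1 s 0 + r * Q1 s /\ q1 s r = q1 s 0 + r * Q2 s.
Proof.
  intros Hs Hr. destruct (director_const s r Hs Hr) as [D1 D2].
  pose proof (proj2 (coefficient_affine a b Hab F1 U1 HSU1 HF1 1
    (fun s r Hs Hr => proj1 (director_const s r Hs Hr)) s r Hs Hr)) as E1.
  pose proof (proj2 (coefficient_affine a b Hab F2 U2 HSU2 HF2 1
    (fun s r Hs Hr => proj2 (director_const s r Hs Hr)) s r Hs Hr)) as E2.
  cbn [repeat] in E1, E2.
  fold (c1 [1; 0]%nat s r) (c1 [1; 0]%nat s 0) (c1 [1; 2; 0]%nat s 0) in E1.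
  fold (c2 [1; 0]%nat s r) (c2 [1; 0]%nat s 0) (c2 [1; 2; 0]%nat s 0) in E2.
  unfold p1, q1, Q1, Q2. rewrite D1, D2, E1, E2. split; ring.
Qed.

(** The order-one coefficient of E_11 is affine in r, and an affine function with zero mean and zero
    first moment vanishes; E_12 and E_22 follow. The vanishing slope says that, up to orientation,
    the image of the center curve keeps in the limit its geodesic curvature d_2 g11 / 2. *)
Lemma first_order s : a <= s <= b ->
  (forall r, -1 <= r <= 1 -> a1 s r = 0 /\ k1 s r = 0 /\ d1 s r = 0) /\
  x1 s 0 * Q1 s + x2 s 0 * Q2 s = B s * pd2 1 g11 s 0 / 2.
Proof.
  intros Hs. destruct strain_ex3 as [EA [EK EC]].
  assert (Z : forall s r, a <= s <= b -> -1 <= r <= 1 -> a0 s r = 0 /\ k0 s r = 0 /\ d0 s r = 0)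
    by (intros; now apply frame_limit).
  assert (L := strain_leading 1 a1 k1 d1
    (ex3_approx1 a b _ _ _ _ EA (fun s r Hs Hr => proj1 (Z s r Hs Hr)))
    (ex3_approx1 a b _ _ _ _ EK (fun s r Hs Hr => proj1 (proj2 (Z s r Hs Hr))))
    (ex3_approx1 a b _ _ _ _ EC (fun s r Hs Hr => proj2 (proj2 (Z s r Hs Hr))))).
  set (al := x1 s 0 * p1 s 0 + x2 s 0 * q1 s 0).
  set (ga := x1 s 0 * Q1 s + x2 s 0 * Q2 s - B s * pd2 1 g11 s 0 / 2).
  assert (Ea : forall r, -1 <= r <= 1 -> a1 s r = al + ga * r + 0 * r ^ 2).
  { intros r Hr. destruct (first_coefficient_affine s r Hs Hr) as [E1 E2].
    unfold a1, al, ga. rewrite E1, E2. unfold h1, x1, x2. field. }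
  destruct (RInt_quadratic _ _ _ _ Ea) as [I0 I1].
  destruct (L s 0 Hs ltac:(lra)) as [_ [_ [J0 J1]]].
  rewrite J0 in I0. rewrite J1 in I1.
  assert (Z1 : al = 0) by lra. assert (Z2 : ga = 0) by lra.
  split; [| unfold ga in Z2; lra].
  intros r Hr. destruct (L s r Hs Hr) as [H1 [H2 _]].
  assert (H0 : a1 s r = 0) by (rewrite (Ea r Hr), Z1, Z2; ring).
  split; [exact H0 |]. split; [exact H1 |]. rewrite H2, H0. ring.
Qed.

(** z has unit length along the center curve, hence is orthogonal to dz/ds, of which (Q1, Q2) is a
    multiple. *)
Lemma slope_tangent s : a <= s <= b -> z1 s 0 * Q1 s + z2 s 0 * Q2 s = 0.
Proof.
  intros Hs. pose proof (HBpos s Hs) as HBs.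
  assert (D1 := proj1 (proj2 (dpart3_is_derive a b F1 U1 HSU1 HF1 [2; 0]%nat 0 s 0 ltac:(lra) Hs ltac:(lra)))).
  assert (D2 := proj1 (proj2 (dpart3_is_derive a b F2 U2 HSU2 HF2 [2; 0]%nat 0 s 0 ltac:(lra) Hs ltac:(lra)))).
  pose proof (is_derive_plus (V := R_NormedModule) _ _ _ _ _
    (is_derive_mult _ _ _ _ _ D1 D1 Rmult_comm) (is_derive_mult _ _ _ _ _ D2 D2 Rmult_comm)) as D.
  pose proof (Derive_correct _ _ (HBd s Hs)) as DB.
  pose proof (is_derive_mult _ _ _ _ _ DB DB Rmult_comm) as DBB.
  assert (E0 : Derive (fun t => c1 [2; 0]%nat t 0 * c1 [2; 0]%nat t 0
    + c2 [2; 0]%nat t 0 * c2 [2; 0]%nat t 0) s = Derive (fun t => B t * B t) s).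
  { apply (Derive_eq_on_interval a b); auto; [eexists; exact D | eexists; exact DBB |].
    intros t Ht. destruct (frame_limit t 0 Ht ltac:(lra)) as [_ [E _]].
    pose proof (HBpos t Ht).
    transitivity (B t * B t * (z1 t 0 * z1 t 0 + z2 t 0 * z2 t 0)); [| rewrite E; ring].
    unfold z1, z2. field. lra. }
  pose proof (eq_trans (eq_trans (eq_sym (is_derive_unique _ _ _ D)) E0) (is_derive_unique _ _ _ DBB)) as E.
  assert (E' : (c1 [1; 2; 0]%nat s 0 * c1 [2; 0]%nat s 0 + c1 [2; 0]%nat s 0 * c1 [1; 2; 0]%nat s 0) +
    (c2 [1; 2; 0]%nat s 0 * c2 [2; 0]%nat s 0 + c2 [2; 0]%nat s 0 * c2 [1; 2; 0]%nat s 0) =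
    Derive B s * B s + B s * Derive B s) by exact E.
  clear E.
  destruct (frame_limit s 0 Hs ltac:(lra)) as [_ [Ez _]].
  unfold Q1, Q2, bb.
  transitivity ((c1 [2; 0]%nat s 0 * c1 [1; 2; 0]%nat s 0 + c2 [2; 0]%nat s 0 * c2 [1; 2; 0]%nat s 0) / B s
    - Derive B s * (z1 s 0 * z1 s 0 + z2 s 0 * z2 s 0)); [unfold z1, z2; field; lra |].
  rewrite Ez.
  replace (c1 [2; 0]%nat s 0 * c1 [1; 2; 0]%nat s 0 + c2 [2; 0]%nat s 0 * c2 [1; 2; 0]%nat s 0)
    with (B s * Derive B s) by lra.
  field. lra.
Qed.

(** The order-one relations E_12 = E_22 = 0 are subtracted at r and at 0. There (p1, q1) changes by
    r (Q1, Q2), which is orthogonal to z, so the change of (u1, v1) is orthogonal to both x and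
    z. *)
Lemma director2_const s r : a <= s <= b -> -1 <= r <= 1 ->
  c1 [2; 0; 0]%nat s r = c1 [2; 0; 0]%nat s 0 /\ c2 [2; 0; 0]%nat s r = c2 [2; 0; 0]%nat s 0.
Proof.
  intros Hs Hr. pose proof (HBpos s Hs) as HBs.
  destruct (first_order s Hs) as [L _]. pose proof (slope_tangent s Hs) as T.
  destruct (L r Hr) as [_ [K1 D1]]. destruct (L 0 ltac:(lra)) as [_ [K0 D0]].
  destruct (frame_limit s 0 Hs ltac:(lra)) as [Ex [Ez [Exz _]]].
  destruct (first_coefficient_affine s r Hs Hr) as [E1 E2].
  assert (Zr : z1 s r = z1 s 0 /\ z2 s r = z2 s 0).
  { destruct (director_const s r Hs Hr) as [e1 e2]. unfold z1, z2. now rewrite e1, e2. }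
  destruct Zr as [Z1 Z2].
  unfold k1 in K1, K0. unfold d1 in D1, D0. rewrite E1, E2, Z1, Z2 in K1. rewrite Z1, Z2 in D1.
  change (x1 s r) with (x1 s 0) in K1. change (x2 s r) with (x2 s 0) in K1.
  destruct (orthonormal_zero (x1 s 0) (x2 s 0) (z1 s 0) (z2 s 0) (u1 s r - u1 s 0) (v1 s r - v1 s 0)
    Ex Ez Exz) as [W1 W2].
  - assert (T' : r * (z1 s 0 * Q1 s + z2 s 0 * Q2 s) = 0) by (rewrite T; ring). lra.
  - lra.
  - unfold u1 in W1. unfold v1 in W2.
    split; apply Rmult_eq_reg_r with (/ (2 * B s)); try (apply Rinv_neq_0_compat; lra);
      unfold Rdiv in W1, W2; lra.
Qed.

(** The slope in r of (p2, q2). It enters E_11 at order two only through the linear coefficient,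
    which the moment balance removes. *)
Let R1 s := (c1 [1; 2; 0; 0]%nat s 0 - bb s * c1 [2; 0; 0]%nat s 0) / 2.
Let R2 s := (c2 [1; 2; 0; 0]%nat s 0 - bb s * c2 [2; 0; 0]%nat s 0) / 2.

Lemma second_coefficient_affine s r : a <= s <= b -> -1 <= r <= 1 ->
  p2 s r = p2 s 0 + r * R1 s /\ q2 s r = q2 s 0 + r * R2 s.
Proof.
  intros Hs Hr. destruct (director2_const s r Hs Hr) as [D1 D2].
  pose proof (proj2 (coefficient_affine a b Hab F1 U1 HSU1 HF1 2
    (fun s r Hs Hr => proj1 (director2_const s r Hs Hr)) s r Hs Hr)) as E1.
  pose proof (proj2 (coefficient_affine a b Hab F2 U2 HSU2 HF2 2
    (fun s r Hs Hr => proj2 (director2_const s r Hs Hr)) s r Hs Hr)) as E2.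
  cbn [repeat] in E1, E2.
  fold (c1 [1; 0; 0]%nat s r) (c1 [1; 0; 0]%nat s 0) (c1 [1; 2; 0; 0]%nat s 0) in E1.
  fold (c2 [1; 0; 0]%nat s r) (c2 [1; 0; 0]%nat s 0) (c2 [1; 2; 0; 0]%nat s 0) in E2.
  unfold p2, q2, R1, R2. rewrite D1, D2, E1, E2. split; field.
Qed.

Let curv s := - / 2 * pd2 1 (pd2 1 g11) s 0 + / 4 * pd2 1 g11 s 0 ^ 2.

(** At order two E_11 is quadratic in r. Its constant and linear coefficients contain data of the
    minimizer that are not known, but zero mean and zero first moment fix them; the coefficient of
    r^2 is determined by the metric. *)
Lemma second_order :
  approx a b 2 A a2 /\ approx a b 2 K k2 /\ approx a b 2 C d2 /\
  forall s r, a <= s <= b -> -1 <= r <= 1 ->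
    a2 s r = / 2 * curv s * B s ^ 2 * (r ^ 2 - / 3) /\ k2 s r = 0 /\ d2 s r = - nu * a2 s r.
Proof.
  destruct strain_ex3 as [EA [EK EC]].
  assert (Z0 : forall s r, a <= s <= b -> -1 <= r <= 1 -> a0 s r = 0 /\ k0 s r = 0 /\ d0 s r = 0)
    by (intros; now apply frame_limit).
  assert (Z1 : forall s r, a <= s <= b -> -1 <= r <= 1 -> a1 s r = 0 /\ k1 s r = 0 /\ d1 s r = 0)
    by (intros s r Hs Hr; exact (proj1 (first_order s Hs) r Hr)).
  assert (HA := ex3_approx2 a b _ _ _ _ EA (fun s r Hs Hr => proj1 (Z0 s r Hs Hr))
    (fun s r Hs Hr => proj1 (Z1 s r Hs Hr))).
  assert (HK := ex3_approx2 a b _ _ _ _ EK (fun s r Hs Hr => proj1 (proj2 (Z0 s r Hs Hr)))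
    (fun s r Hs Hr => proj1 (proj2 (Z1 s r Hs Hr)))).
  assert (HC := ex3_approx2 a b _ _ _ _ EC (fun s r Hs Hr => proj2 (proj2 (Z0 s r Hs Hr)))
    (fun s r Hs Hr => proj2 (proj2 (Z1 s r Hs Hr)))).
  assert (L := strain_leading 2 a2 k2 d2 HA HK HC).
  repeat (split; [assumption |]). intros s r Hs Hr.
  destruct (L s r Hs Hr) as [L1 [L2 [I0 I1]]].
  split; [| split; assumption].
  set (al := x1 s 0 * p2 s 0 + x2 s 0 * q2 s 0 + / 2 * (p1 s 0 * p1 s 0 + q1 s 0 * q1 s 0)).
  set (ga := x1 s 0 * R1 s + x2 s 0 * R2 s + (p1 s 0 * Q1 s + q1 s 0 * Q2 s)).
  set (de := / 2 * curv s * B s ^ 2).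
  (* (Q1, Q2) is orthogonal to z, so its length is its component along x, known from the first
     order. *)
  assert (EQ : Q1 s * Q1 s + Q2 s * Q2 s = (B s * pd2 1 g11 s 0 / 2) ^ 2).
  { destruct (frame_limit s 0 Hs ltac:(lra)) as [Ex [Ez [Exz _]]].
    rewrite <- (proj2 (first_order s Hs)).
    apply (orthonormal_norm _ _ (z1 s 0) (z2 s 0)); auto. now apply slope_tangent. }
  assert (Ea : forall r, -1 <= r <= 1 -> a2 s r = al + ga * r + de * r ^ 2).
  { intros t Ht. destruct (first_coefficient_affine s t Hs Ht) as [E1 E2].
    destruct (second_coefficient_affine s t Hs Ht) as [E3 E4].
    unfold a2. rewrite E1, E2, E3, E4. change (x1 s t) with (x1 s 0). change (x2 s t) with (x2 s 0).
    transitivity (al + ga * t + (/ 2 * (Q1 s * Q1 s + Q2 s * Q2 s) * t ^ 2 - h2 s t / 2)).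
    - unfold al, ga. field.
    (* With G = g11 at the center, (B G_2 / 2)^2 / 2 - B^2 G_22 / 4 = B^2 (- G_22 / 2 + G_2^2 / 4) /
       2. *)
    - rewrite EQ. unfold de, curv, h2. field. }
  destruct (RInt_quadratic _ _ _ _ Ea) as [J0 J1]. rewrite I0 in J0. rewrite I1 in J1.
  (* The mean of r^2 over [-1, 1] is 1/3. *)
  assert (Eal : al = - de / 3) by lra. assert (Ega : ga = 0) by lra.
  rewrite (Ea r Hr), Eal, Ega. unfold de. field.
Qed.

(** * Orders of the frame components *)

Lemma UO_bigO0 f s r : a <= s <= b -> -1 <= r <= 1 -> UO a b 3 f ->
  bigO0 (fun be => f be s r) 3.
Proof.
  intros Hs Hr [D H]. exists D, 1. split; [lra |]. intros be Hb. apply H; auto; lra.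
Qed.

Lemma approx_zero_UO p f h : approx a b p f h ->
  (forall s r, a <= s <= b -> -1 <= r <= 1 -> h s r = 0) -> UO a b (S p) f.
Proof.
  intros [_ H] H0. refine (UO_ext a b _ _ _ _ H). intros be s r _ Hs Hr. rewrite H0 by assumption. ring.
Qed.

(** Each index 1 divides the covariant strain by sqrt g11 and multiplies the contravariant stress by
    it. *)
Lemma frame_components be s r : 0 < be <= 1 -> a <= s <= b -> -1 <= r <= 1 ->
  strain_fr g11 g12 g22 (Phi1 be) (Phi2 be) 0 0 s (be * B s * r) = A be s r / G be s r /\
  strain_fr g11 g12 g22 (Phi1 be) (Phi2 be) 1 1 s (be * B s * r) = C be s r /\
  stress_fr Y nu g11 g12 g22 (Phi1 be) (Phi2 be) 0 1 s (be * B s * r)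
    = s01 (lame_mu Y nu) g11 (Phi1 be) (Phi2 be) s (be * B s * r) * sqrt (G be s r) /\
  stress_fr Y nu g11 g12 g22 (Phi1 be) (Phi2 be) 1 0 s (be * B s * r)
    = s01 (lame_mu Y nu) g11 (Phi1 be) (Phi2 be) s (be * B s * r) * sqrt (G be s r) /\
  stress_fr Y nu g11 g12 g22 (Phi1 be) (Phi2 be) 1 1 s (be * B s * r)
    = s11 (lame_lambda Y nu) (lame_mu Y nu) g11 (Phi1 be) (Phi2 be) s (be * B s * r).
Proof.
  intros Hb Hs Hr.
  destruct (thin_diag a b B g11 g12 g22 Hchart be Hb s (be * B s * r)) as [D1 [D2 D3]].
  { exact (strip_mem a b B HBpos be s r Hb Hs Hr). }
  destruct (strain_diag g11 g12 g22 (Phi1 be) (Phi2 be) s (be * B s * r) D1 D2) as [S1 [S2 [S3 S4]]].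
  destruct (stress_diag Y nu g11 g12 g22 (Phi1 be) (Phi2 be) s (be * B s * r) D1 D2 D3)
    as [T1 [T2 [T3 T4]]].
  unfold strain_fr, stress_fr, sum2, frameP, frameQ.
  rewrite S1, S2, S3, S4, T1, T2, T3, T4. fold (G be s r) in D3 |- *.
  pose proof (sqrt_lt_R0 _ D3) as Hq. pose proof (sqrt_sqrt (G be s r) ltac:(lra)) as E.
  split; [| split; [| split; [| split]]]; try (unfold C; ring).
  assert (Ei : / sqrt (G be s r) * / sqrt (G be s r) = / G be s r) by (now rewrite <- Rinv_mult, E).
  unfold Rdiv. rewrite <- Ei. unfold A. ring.
Qed.

(** The factors sqrt g11 and 1 / g11 are 1 + O(beta), so the passage to the frame preserves the
    coefficients of order two. *)
Lemma strip_asymptotics s r : a <= s <= b -> -1 <= r <= 1 ->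
  let Sfr := fun p q beta =>
    stress_fr Y nu g11 g12 g22 (Phi1 beta) (Phi2 beta) p q s (beta * B s * r) in
  let Efr := fun p q beta =>
    strain_fr g11 g12 g22 (Phi1 beta) (Phi2 beta) p q s (beta * B s * r) in
  bigO0 (Sfr 0%nat 1%nat) 3 /\ bigO0 (Sfr 1%nat 0%nat) 3 /\ bigO0 (Sfr 1%nat 1%nat) 3 /\
  bigO0 (fun beta => Efr 0%nat 0%nat beta
           - / 2 * gaussK g11 g12 g22 s 0 * (beta * B s) ^ 2 * (r ^ 2 - / 3)) 3 /\
  bigO0 (fun beta => Efr 1%nat 1%nat beta + nu * Efr 0%nat 0%nat beta) 3.
Proof.
  intros Hs Hr Sfr Efr.
  destruct second_order as [HA [HK [HC Hval]]].
  destruct (lame_facts Y nu HY Hnu) as [Hl [HL Hmu]].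
  destruct (metric_lower a b B g11 g12 g22 Hchart) as [m [Hm HGm]].
  assert (HGm1 : forall be s r, 0 < be <= 1 -> a <= s <= b -> -1 <= r <= 1 -> m <= G be s r)
    by (intros; now apply HGm).
  pose proof (ex3_approx0 a b _ _ _ _ (metric_expansion a b B g11 g12 g22 Hchart)) as HG.
  destruct (stress_leading a b (lame_lambda Y nu) (lame_mu Y nu) G A K C m Hm HGm1 HG 2 a2 k2 d2 HA HK HC)
    as [_ [T1 T2]].
  pose proof (approx_inv a b G m Hm HGm1 HG) as Hi.
  assert (Hq : approx a b 0 (fun be s r => sqrt (G be s r)) (fun _ _ => 1)).
  { apply approx_sqrt; auto. intros be t q Hb Ht Hq. pose proof (HGm1 be t q Hb Ht Hq). lra. }
  pose proof (approx_mult a b 2 0 _ _ _ _ T1 Hq) as T1'. cbn [Nat.add] in T1'.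
  pose proof (approx_mult a b 2 0 _ _ _ _ HA Hi) as HA'. cbn [Nat.add] in HA'.
  assert (U1' := approx_zero_UO _ _ _ T1'). assert (U2' := approx_zero_UO _ _ _ T2).
  assert (F : forall f, (exists g, UO a b 3 g /\ forall be, 0 < be <= 1 -> f be = g be s r) -> bigO0 f 3).
  { intros f [g [Hg E]]. destruct (UO_bigO0 g s r Hs Hr Hg) as [D [de [Hde H]]].
    (* The frame formulas hold for beta <= 1, hence the minimum with 1. *)
    exists D, (Rmin de 1). split; [apply Rmin_glb_lt; lra |]. intros be Hb.
    pose proof (Rmin_l de 1). pose proof (Rmin_r de 1). rewrite E by lra. apply H. lra. }
  split; [| split; [| split; [| split]]]; apply F.
  - eexists. split; [apply U1' |].
    + intros t q Ht Hq'. destruct (Hval t q Ht Hq') as [_ [E _]]. cbv beta. rewrite E. ring.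
    + intros be Hb. exact (proj1 (proj2 (proj2 (frame_components be s r Hb Hs Hr)))).
  - eexists. split; [apply U1' |].
    + intros t q Ht Hq'. destruct (Hval t q Ht Hq') as [_ [E _]]. cbv beta. rewrite E. ring.
    + intros be Hb. exact (proj1 (proj2 (proj2 (proj2 (frame_components be s r Hb Hs Hr))))).
  - eexists. split; [apply U2' |].
    + intros t q Ht Hq'. destruct (Hval t q Ht Hq') as [_ [_ E]]. cbv beta. rewrite E.
      (* The coefficient (lambda + 2 mu) E_22 + lambda E_11 of S^22 with E_22 = - nu E_11. *)
      transitivity (a2 t q * (lame_lambda Y nu - nu * (lame_lambda Y nu + 2 * lame_mu Y nu)));
        [ring | rewrite <- Hl; ring].
    + intros be Hb. exact (proj2 (proj2 (proj2 (proj2 (frame_components be s r Hb Hs Hr))))).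
  - exists (fun be s r => A be s r * / G be s r - be ^ 2 * (a2 s r * 1)). split; [apply HA' |].
    intros be Hb. unfold Efr. rewrite (proj1 (frame_components be s r Hb Hs Hr)).
    rewrite (proj1 (Hval s r Hs Hr)), (gaussK_center a b B g11 g12 g22 Hchart s Hs).
    unfold curv, Rdiv. ring.
  - exists (fun be s r => C be s r + nu * (A be s r * / G be s r)). split.
    + apply (approx_zero_UO 2 _ _ (approx_plus a b 2 _ _ _ _ HC (approx_scal a b 2 nu _ _ HA'))).
      intros t q Ht Hq'. destruct (Hval t q Ht Hq') as [_ [_ E]]. cbv beta. rewrite E. ring.
    + intros be Hb. unfold Efr. destruct (frame_components be s r Hb Hs Hr) as [E1 [E2 _]].
      rewrite E1, E2. reflexivity.
Qed.

End Asymptotics.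

Theorem mainTheorem5 (a b : R) (B : R -> R) (g11 g12 g22 : R -> R -> R)
  (Y nu : R) (Phi1 Phi2 : R -> R -> R -> R) :
  chart_hyp a b B g11 g12 g22 ->
  0 < Y -> -1 < nu < 1 ->
  minimizer_family a b B Y nu g11 g12 g22 Phi1 Phi2 ->
  forall s r, a <= s <= b -> -1 <= r <= 1 ->
    let Sfr := fun p q beta =>
      stress_fr Y nu g11 g12 g22 (Phi1 beta) (Phi2 beta) p q s (beta * B s * r) in
    let Efr := fun p q beta =>
      strain_fr g11 g12 g22 (Phi1 beta) (Phi2 beta) p q s (beta * B s * r) in
    (* (i) *)
    bigO0 (Sfr 0%nat 1%nat) 3 /\ bigO0 (Sfr 1%nat 0%nat) 3 /\ bigO0 (Sfr 1%nat 1%nat) 3 /\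
    (* (ii) *)
    bigO0 (fun beta => Efr 0%nat 0%nat beta
             - / 2 * gaussK g11 g12 g22 s 0 * (beta * B s) ^ 2 * (r ^ 2 - / 3)) 3 /\
    bigO0 (fun beta => Efr 1%nat 1%nat beta + nu * Efr 0%nat 0%nat beta) 3.
Proof.
  intros Hchart HY Hnu [Hfam [F1 [F2 [[U1 [HU1 [HS1 HF1]]] [[U2 [HU2 [HS2 HF2]]] HF]]]]] s r Hs Hr.
  apply (strip_asymptotics a b Y nu B g11 g12 g22 Phi1 Phi2 Hchart HY Hnu Hfam F1 F2 U1 U2); auto.
  - intros be t q Hb Ht Hq. now apply HF.
  - intros be t q Hb Ht Hq. now apply HF.
Qed.
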